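(* Let $c>0$ be a constant and $p(n)=cn^{-1}$, and let $T$ be the theory consisting of the sentences $\mathrm{NO}_\ell$ ($\ell\in\mathbb{N}$) and $\mathrm{YES}_\sigma$ ($\sigma\in\Sigma_{m,k'}$, $m\in\mathbb{N}_0$, $k'\in\mathbb{N}$). Fix a positive integer $k$. Consider the finite index set $I_k$ consisting of all sequences of the form $$\vec n=\big(n_\gamma:\ \gamma\in\Gamma_{s,m,k},\ s\in\{3,\dots,2\cdot3^{k+3}\},\ m\in\{0,\dots,3^{k+3}\}\big),$$ where $n_\gamma\in\{0,1,\dots,k\}$, and which are consistent, i.e. $n_\gamma=\big(\sum_{\sigma\in\mathrm{SUP}(\gamma)}n_\sigma\big)\wedge k$ for all $3\le s\le 2\cdot3^{k+3}$, $0\le m\le 3^{k+3}-1$ and $\gamma\in\Gamma_{s,m,k}$. For every $\vec n\in I_k$, consider the property $\mathcal{A}_{\vec n}$: for all integers $3\le s\le 2\cdot3^{k+3}$, $0\le m\le 3^{k+3}$ and $\gamma\in\Gamma_{s,m,k}$, there exist exactly $n_\gamma$ many unicyclic components with $(s,m,k)$-type $\gamma$ when $n_\gamma<k$, and there exist at least $k$ unicyclic components with $(s,m,k)$-type $\gamma$ when $n_\gamma=k$. Then the family $\{\mathcal{A}_{\vec n}:\vec n\in I_k\}$ is a complete set of $k$-completions for $T$ (with respect to $p(n)=cn^{-1}$).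
   Context: $\mathbb{N}=\{1,2,\dots\}$, $\mathbb{N}_0=\{0,1,2,\dots\}$; $x\wedge y=\min(x,y)$. $G(n,p)$ is the Erdős–Rényi random graph. First order (FO) language on graphs: variables range over vertices; atomic formulas are equality $x=y$ and adjacency $x\sim y$; Boolean connectives and quantification over vertices only. The quantifier depth of an FO property is the minimum number of nested quantifiers needed to write it. A model of a set of sentences is a graph satisfying all of them; $T\models B$ (B is in / derivable from $T$) means $B$ holds in every model of $T$; $T+A$ is the theory obtained by adding $A$ to $T$. A theory is $k$-complete if for every FO sentence $A$ of quantifier depth at most $k$, either $A$ or $\neg A$ is in the theory. A family $\{\mathcal{A}_i:i\in I\}$ of sentences not in $T$, with $I$ a countable index set, is a complete set of $k$-completions for $T$ (with respect to $p(n)$) if: (a) for every $i\in I$, $T+\mathcal{A}_i$ is $k$-complete; (b) for all distinct $i,j\in I$, $T\models\neg(\mathcal{A}_i\wedge\mathcal{A}_j)$; (c) for every $i\in I$ the limit $\lim_{n\to\infty}\mathbf{P}[G(n,p(n))\models\mathcal{A}_i]$ exists, and the sum of these limits over $i\in I$ is $1$. Tree types. For a rooted tree $t$, $t|_m$ is the truncation consisting of the vertices at depth at most $m$ (the root has depth $0$); the principal branches of $t$ are the subtrees, rooted at $v$, consisting of a child $v$ of the root and all descendants of $v$. For $m\in\mathbb{N}_0$ and $k\in\mathbb{N}$, the $(m,k)$-type of $t$ is that of $t|_m$, defined recursively on $m$: there is only one $(0,k)$-type (that of the single root). If $\Sigma_{m-1,k}$ is the (finite) set of all $(m-1,k)$-types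 and $t$ has depth at most $m$, let $n_\sigma$ be the number of principal branches of $t$ with $(m-1,k)$-type $\sigma$; the $(m,k)$-type of $t$ is the vector $(n_\sigma\wedge k:\sigma\in\Sigma_{m-1,k})$. $\Sigma_{m,k}$ is the set of all $(m,k)$-types. A tree component of a graph (a component that is a tree) has $(m,k)$-type $\sigma$ if it has this type when rooted at a suitable vertex. The sentences of $T$. $\mathrm{NO}_\ell$: there does not exist any subset of $\ell$ vertices with $\ell+1$ edges (among these vertices). $\mathrm{YES}_\sigma$ for $\sigma\in\Sigma_{m,k'}$: there exist at least $k'$ tree components with $(m,k')$-type $\sigma$. Unicyclic types. A unicyclic graph $U$ is a connected graph with exactly one cycle; write $U=(v_1,\dots,v_s;T_1,\dots,T_s)$ where $v_1,\dots,v_s$ are the vertices of the cycle in consecutive order and $T_i$ is the tree rooted at $v_i$ (the component of $v_i$ after deleting the cycle edges). Fix a total order on each $\Sigma_{m,k}$ and the induced lexicographic order on words of length $s$. If $\sigma_i$ is the $(m,k)$-type of $T_i$, the $(s,m,k)$-type of $U$ is the minimal word among all images of $(\sigma_1,\dots,\sigma_s)$ under the dihedral group of order $2s$ permuting positions. Thus two unicyclic graphs with cycle length $s$ have the same $(s,m,k)$-type iff their words of tree types agree up to a dihedral permutation. $\Gamma_{s,m,k}$ is the (finite) set of all $(s,m,k)$-types; only unicyclic graphs of cycle length $s$ have an $(s,m,k)$-type. Types for different triples $(s,m,k)$ are treated as different indices. The $(s,m+1,k)$-type of a unicyclic graph determines its $(s,m,k)$-type; for $\gamma\in\Gamma_{s,m,k}$,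 $\mathrm{SUP}(\gamma)$ is the set of $\sigma\in\Gamma_{s,m+1,k}$ whose $(s,m,k)$-type is $\gamma$. *)

(* Defs.v *)
From HB Require Import structures.
From mathcomp Require Import all_boot all_order all_algebra.
From mathcomp Require Import all_classical all_reals all_analysis.

Set Implicit Arguments.
Unset Strict Implicit.
Unset Printing Implicit Defensive.

Import Order.TTheory GRing.Theory Num.Theory.
Import numFieldNormedType.Exports.

Local Open Scope nat_scope.
Local Open Scope classical_set_scope.
Local Open Scope card_scope.

(* Simple graphs, possibly infinite.  The [eqType] structure of the vertex    *)
(* type is no restriction, since [{classic X}] is an [eqType] for all [X].    *)
Record graph := Graph {
  vertex :> eqType;
  adj : rel vertex;
  adj_sym : symmetric adj;
  adj_irr : irreflexive adj }.

(* First order formulas with free variables in [V]; a quantifier binds the    *)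
(* variable [None] of [option V].                                             *)
Inductive fo (V : Type) : Type :=
| FoEq of V & V
| FoAdj of V & V
| FoNot of fo V
| FoAnd of fo V & fo V
| FoOr of fo V & fo V
| FoImp of fo V & fo V
| FoEx of fo (option V)
| FoAll of fo (option V).

Fixpoint qdepth (V : Type) (f : fo V) : nat :=
  match f with
  | FoEq _ _ | FoAdj _ _ => 0
  | FoNot f1 => qdepth f1
  | FoAnd f1 f2 | FoOr f1 f2 | FoImp f1 f2 => maxn (qdepth f1) (qdepth f2)
  | FoEx f1 | FoAll f1 => (qdepth f1).+1
  end.

Fixpoint sat (G : graph) (V : Type) (env : V -> G) (f : fo V) : Prop :=
  match f with
  | FoEq x y => env x = env y
  | FoAdj x y => adj (env x) (env y)
  | FoNot f1 => ~ sat env f1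
  | FoAnd f1 f2 => sat env f1 /\ sat env f2
  | FoOr f1 f2 => sat env f1 \/ sat env f2
  | FoImp f1 f2 => sat env f1 -> sat env f2
  | FoEx f1 => exists v : G, sat (fun x => if x is Some y then env y else v) f1
  | FoAll f1 => forall v : G, sat (fun x => if x is Some y then env y else v) f1
  end.

(* Being a tree component or a unicyclic component is not a first order       *)
(* notion, so the sentences of a theory are arbitrary graph properties; only  *)
(* the sentences tested by [k_complete] are first order.                      *)
Definition property := graph -> Prop.

Definition fo_prop (f : fo void) : property :=
  fun G => sat (fun x : void => of_void G x) f.

Definition theory := property -> Prop.

Definition model (T : theory) (G : graph) : Prop := forall A, T A -> A G.

Definition entails (T : theory) (B : property) : Prop :=
  forall G, model T G -> B G.

Definition add_sentence (T : theory) (A : property) : theory :=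
  fun B => T B \/ B = A.

Definition k_complete (k : nat) (T : theory) : Prop :=
  forall f : fo void, (qdepth f <= k)%N ->
    entails T (fo_prop f) \/ entails T (fun G => ~ fo_prop f G).

Section ErdosRenyi.
Variable n : nat.

Definition edge_slots : {set {set 'I_n}} :=
  finset (fun a : {set 'I_n} => #|a| == 2).

Definition edge_rel (E : {set {set 'I_n}}) : rel 'I_n :=
  fun i j => (i != j) && ([set i; j]%SET \in E).

Lemma edge_rel_sym E : symmetric (edge_rel E).
Proof. by move=> i j; rewrite /edge_rel eq_sym finset.setUC. Qed.

Lemma edge_rel_irr E : irreflexive (edge_rel E).
Proof. by move=> i; rewrite /edge_rel eqxx. Qed.

Definition graph_of (E : {set {set 'I_n}}) : graph :=
  Graph (edge_rel_sym E) (edge_rel_irr E).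

(* Meaningful for [0 <= p <= 1] only; for [p = c / n] this holds as soon as   *)
(* [n >= c], which is enough for limits.                                      *)
Definition gnp_prob (R : realType) (p : R) (A : property) : R :=
  (\sum_(E : {set {set 'I_n}} | (E \subset edge_slots) && `[< A (graph_of E) >])
     p ^+ #|E| * (1 - p) ^+ (#|edge_slots| - #|E|))%R.

End ErdosRenyi.

Definition complete_set_of_completions (R : realType) (p : nat -> R) (k : nat)
    (T : theory) (I : countType) (A : I -> property) : Prop :=
  let prob i n := gnp_prob n (p n) (A i) in
  [/\ forall i, ~ entails T (A i),
      forall i, k_complete k (add_sentence T (A i)),
      forall i j, i <> j -> entails T (fun G => ~ (A i G /\ A j G)) &
      (forall i, cvgn (prob i)) /\
      (\esum_(i in [set: I]) (limn (prob i))%:E)%R = 1%:E].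

(* [capped_card A k j] : the minimum of [k] and the cardinality of [A] is [j],*)
(* for [j <= k].                                                              *)
Definition capped_card (X : Type) (A : set X) (k j : nat) : Prop :=
  if (j < k)%N then A #= `I_j else `I_k #<= A.

Definition dihedral_images (X : Type) (w : seq X) : seq (seq X) :=
  [seq rot i w | i <- iota 0 (size w)] ++
  [seq rev (rot i w) | i <- iota 0 (size w)].

(* Graph notions below are relative to the subgraph of [e] induced on a set   *)
(* [A] of vertices.                                                           *)
Section Subgraphs.
Variables (V : eqType) (e : rel V).

Definition walk (A : set V) (x : V) (p : seq V) (y : V) : Prop :=
  [/\ path e x p, last x p = y & forall z, z \in x :: p -> A z].

Definition linked (A : set V) (x y : V) : Prop := exists p, walk A x p y.

Definition connected_on (A : set V) : Prop :=
  A !=set0 /\ forall x y, A x -> A y -> linked A x y.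

Definition components : set (set V) := range (linked setT).

Definition cycle_in (A : set V) (c : seq V) : Prop :=
  [/\ (3 <= size c)%N, ucycle e c & forall z, z \in c -> A z].

Definition is_tree (A : set V) : Prop :=
  connected_on A /\ forall c, ~ cycle_in A c.

(* Two sequences list the vertices of the same cycle iff they differ by a     *)
(* rotation or a reflection, so this says that [c] is the only cycle of [A].  *)
Definition unicyclic (A : set V) (c : seq V) : Prop :=
  [/\ connected_on A, cycle_in A c &
      forall c', cycle_in A c' -> c' \in dihedral_images c].

Definition del_cycle (c : seq V) : rel V := fun x y =>
  [&& e x y, ~~ ((x \in c) && (y == next c x))
           & ~~ ((y \in c) && (x == next c y))].

Definition truncation (A : set V) (r : V) (m : nat) : set V :=
  [set u | exists2 p, walk A r p u & (size p <= m)%N].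

(* In the tree [A] rooted at [r], the vertices reachable from the child [v]   *)
(* without passing through the root are [v] and its descendants.              *)
Definition branch (A : set V) (r v : V) : set V := linked (A `\ r) v.

End Subgraphs.

(* Every vector with entries in {0, ..., k} is the type of some tree.         *)
Fixpoint Sigma (m k : nat) : finType :=
  if m is m'.+1 then {ffun Sigma m' k -> 'I_k.+1} : finType else unit.

(* [tree_type e k A r m s] : the tree [A], rooted at [r], has (m,k)-type [s]. *)
Fixpoint tree_type (V : eqType) (e : rel V) (k : nat) (A : set V) (r : V)
    (m : nat) : Sigma m k -> Prop :=
  match m return Sigma m k -> Prop with
  | 0 => fun _ => True
  | m'.+1 => fun s =>
      let B := truncation e A r m'.+1 in
      forall t : Sigma m' k,
        capped_card
          [set v | [/\ B v, e r v & tree_type e (branch e B r v) v t]] k (s t)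
  end.

Definition NO (l : nat) : property := fun G =>
  ~ exists S : set G, S #= `I_l /\
      `I_l.+1 #<= [set a : set G |
        exists x y : G, [/\ S x, S y, adj x y & a = [set x; y]]].

Definition YES (m k : nat) (s : Sigma m k) : property := fun G =>
  `I_k #<= [set C : set G | [/\ components (@adj G) C, is_tree (@adj G) C &
              exists2 r, C r & tree_type (@adj G) C r s]].

Definition sparse_theory : theory :=
  fun A => (exists2 l, (0 < l)%N & A = NO l) \/
           (exists m k (s : Sigma m k), (0 < k)%N /\ A = YES s).

Definition total_order (X : eqType) (r : rel X) : Prop :=
  [/\ reflexive r, antisymmetric r, transitive r & total r].

Fixpoint lex_le (X : eqType) (r : rel X) (u w : seq X) : bool :=
  match u, w with
  | x :: u', y :: w' => if x == y then lex_le r u' w' else r x y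
  | [::], _ => true
  | _ :: _, [::] => false
  end.

Definition min_image (X : eqType) (r : rel X) (u w : seq X) : bool :=
  (w \in dihedral_images u) && all (lex_le r w) (dihedral_images u).

Section Unicyclic.
Variable le : forall m k, rel (Sigma m k).

Definition Gamma (s m k : nat) : finType :=
  {w : s.-tuple (Sigma m k) |
    [exists u : s.-tuple (Sigma m k), min_image (@le m k) u w]}.

(* [A] is unicyclic with (s,m,k)-type [g].                                    *)
Definition unicyclic_type (V : eqType) (e : rel V) (A : set V) (s m k : nat)
    (g : Gamma s m k) : Prop :=
  exists (c : s.-tuple V) (w : s.-tuple (Sigma m k)),
    [/\ unicyclic e A c,
        forall i : 'I_s,
          tree_type (del_cycle e c) (linked (del_cycle e c) A (tnth c i))
            (tnth c i) (tnth w i)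
      & min_image (@le m k) w (val g)].

(* The (s,m,k)-type is determined by the (s,m+1,k)-type, so it can be read    *)
(* off from any unicyclic graph [U] of (s,m+1,k)-type [h].                    *)
Definition SUP (s m k : nat) (g : Gamma s m k) : set (Gamma s m.+1 k) :=
  [set h | exists U : graph, unicyclic_type (@adj U) [set: U] h /\
                             unicyclic_type (@adj U) [set: U] g].

Variable k : nat.

Definition max_depth : nat := 3 ^ (k + 3).

Definition cycle_length : finType :=
  {s : 'I_(2 * max_depth).+1 | (3 <= s)%N}.

Definition position : finType :=
  {sm : cycle_length * 'I_max_depth.+1 & Gamma (val (val sm.1)) sm.2 k}.

Definition entry (n : {ffun position -> 'I_k.+1}) (s : cycle_length)
    (m : 'I_max_depth.+1) (g : Gamma (val (val s)) m k) : nat :=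
  n (existT (fun sm : cycle_length * 'I_max_depth.+1 =>
               Gamma (val (val sm.1)) sm.2 k : Type) (s, m) g).

Definition consistent (n : {ffun position -> 'I_k.+1}) : Prop :=
  forall (s : cycle_length) (m : nat) (hm : (m < max_depth.+1)%N)
         (hm1 : (m.+1 < max_depth.+1)%N) (g : Gamma (val (val s)) m k),
    entry n (m := Ordinal hm) g =
    minn (\sum_(h : Gamma (val (val s)) m.+1 k | h \in SUP g)
            entry n (m := Ordinal hm1) h) k.

Definition completion_index : finType :=
  {n : {ffun position -> 'I_k.+1} | `[< consistent n >]}.

Definition completion (n : completion_index) : property := fun G =>
  forall (s : cycle_length) (m : 'I_max_depth.+1) (g : Gamma (val (val s)) m k),
    capped_card
      [set C : set G | components (@adj G) C /\ unicyclic_type (@adj G) C g]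
      k (entry (val n) g).

End Unicyclic.

(* Main.v *)
Require Import Defs.
From HB Require Import structures.
From mathcomp Require Import all_boot all_order all_algebra.
From mathcomp Require Import all_classical all_reals all_analysis.
From mathcomp Require Import zify ring lra.

Set Implicit Arguments.
Unset Strict Implicit.
Unset Printing Implicit Defensive.

Import Order.TTheory GRing.Theory Num.Theory.
Import numFieldNormedType.Exports.

(* Duplicator wins the [k]-round Ehrenfeucht-Fraisse game on two models of the
   theory satisfying the same [completion i].  NO makes every component with a
   cycle unicyclic, and a vertex lies near a short cycle only inside a component
   whose type up to depth [3 ^ (k + 3)] is recorded by [i]; components of equal
   type are matched and played by comparing capped tree types.  A vertex chosen
   far from all short cycles sees a tree, which YES reproduces in a fresh tree
   component of the other graph.  YES and NO themselves hold in a forest with a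
   vertex for each word of tree types, with or without a triangle added, so no
   completion is entailed.

   For the limits, let [S] be the union of the unicyclic components with a cycle
   of length at most [2 * 3 ^ (k + 3)].  The completion satisfied by [G(n, p)]
   depends only on the graph induced by [S], and by inclusion-exclusion
     P(completion) = sum_u C(n, u) p ^ u (1 - p) ^ (edge slots meeting u fixed
                     vertices, minus u) * a(u)
   where [a] is independent of [n] and [p].  Each term converges; since
   [y exp (1 - y) <= 1], the coefficients are at most a constant times those of
   the case [p = 1 / n], where the sum of the absolute values is bounded by an
   expectation over families of disjoint short cycles.  Dominated convergence
   gives the limits, and the finitely many completions exhaust all graphs. *)

Local Open Scope nat_scope.
Local Open Scope classical_set_scope.
Local Open Scope card_scope.

(** * Capped cardinals *)

(** With [j] rounds left only distances up to [2 ^ j] matter, so the depth [3 ^ (k + 3)] covers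
    every neighbourhood that a game of [k] rounds inspects; and a ball of radius [r] that meets no
    cycle of length at most [2 r + 2] is acyclic, which the bound on cycle lengths covers. A vertex
    near a short cycle cannot be answered by a fresh tree. Instead the whole cycle is put into the
    position at once, at no cost in rounds, so that from then on only moves near the position and
    moves far from everything remain.

    For the limits, the obstacle is that infinitely many isomorphism types share one type:
    contributions of all sizes up to [n] have to be added, and convergence for each size separately
    does not suffice. The critical value is [c = 1], where [c exp(- c)] reaches its maximum
    [exp(- 1)], the radius of convergence of the series involved. There the bound on the cycle
    lengths decides: at [p = 1 / n] the closed sequences of any given length have total weight one,
    so finitely many lengths give a bounded total. *)

Section CappedCard.
Variable T : eqType.
Implicit Types (A B : set T) (s : seq T).

Lemma card_eq_seq A n : A #= `I_n <->
  exists s, [/\ uniq s, size s = n & forall x, A x <-> x \in s].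
Proof.
elim: n A => [|n IH] A; split.
- by rewrite II0 card_eq0 => /eqP ->; exists [::].
- case=> s [_ /size0nil -> sA]; rewrite II0 card_eq0; apply/eqP.
  by apply/seteqP; split => x // /sA.
- move=> /eq_cardSP[x Ax /IH[s [us ss sA]]]; exists (x :: s); split => /=.
  + rewrite us andbT; apply/negP => /sA[_]; exact.
  + by rewrite ss.
  + move=> y; rewrite inE; split => [Ay|/orP[/eqP->//|/sA[]//]].
    by case: eqP => //= yx; apply/sA; split.
- case=> -[|x s] [] //= /andP[xs us] [ss] sA; apply/eq_cardSP.
  exists x; first by apply/sA; rewrite mem_head.
  apply/IH; exists s; split => // y; split => [[/sA]|ys].
    by rewrite inE => /orP[/eqP -> []|].
  split; first by apply/sA; rewrite inE ys orbT.
  by move=> /= yx; move: xs; rewrite -yx ys.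
Qed.

Lemma card_ge_seq A n : `I_n #<= A <->
  exists s, [/\ uniq s, size s = n & forall x, x \in s -> A x].
Proof.
split=> [/card_subP[B BI BA]|[s [us ss sA]]].
  have /card_eq_seq[s [us ss sB]] := BI.
  by exists s; split => // x /sB /BA.
apply/card_subP; exists [set x | x \in s]; last by move=> x /sA.
by apply/card_eq_seq; exists s; split.
Qed.

Lemma capped_cardP A k j : j <= k -> capped_card A k j <->
  exists s, [/\ uniq s, size s = j, forall x, x \in s -> A x &
               j < k -> forall x, A x -> x \in s].
Proof.
move=> jk; rewrite /capped_card; case: ltnP => jk'.
  rewrite card_eq_seq; split => -[s [us ss sA]].
    by exists s; split => // [x /sA|_ x /sA].
  by move=> As; exists s; split => // x; split; [exact: As|exact: sA].
have -> : k = j by apply/eqP; rewrite eqn_leq jk'.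
rewrite card_ge_seq; split => -[s [us ss sA]]; last by exists s.
by exists s; split.
Qed.

Lemma capped_card_uniq A k i j : i <= k -> j <= k ->
  capped_card A k i -> capped_card A k j -> i = j.
Proof.
move=> ik jk /(capped_cardP _ ik)[s [us ss sA As]].
move=> /(capped_cardP _ jk)[t [ut tt tA At]].
have lei : i < k -> j <= i.
  by move=> /As h; rewrite -ss -tt uniq_leq_size // => x /tA /h.
have lej : j < k -> i <= j.
  by move=> /At h; rewrite -ss -tt uniq_leq_size // => x /sA /h.
case: (ltngtP i j) => // ij.
- by have := lei (leq_trans ij jk); rewrite leqNgt ij.
- by have := lej (leq_trans ij ik); rewrite leqNgt ij.
Qed.

Lemma capped_card_ex A k : exists2 j, j <= k & capped_card A k j.
Proof.
suff [s [us ss sA As]] : exists s, [/\ uniq s, size s <= k,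
    forall x, x \in s -> A x & size s < k -> forall x, A x -> x \in s].
  by exists (size s) => //; apply/capped_cardP => //; exists s; split.
elim: k => [|k [s [us ss sA As]]]; first by exists [::].
have [sk|sk] := ltnP (size s) k.
  by exists s; split => // [|_]; [exact: ltnW|exact: As].
have [[x [Ax xs]]|nex] := pselect (exists x, A x /\ x \notin s).
  exists (x :: s); split => /=.
  - by rewrite xs.
  - by [].
  - by move=> y; rewrite inE => /orP[/eqP->//|/sA].
  - by rewrite ltnNge ltnS sk.
exists s; split => //; first exact: ltnW.
by move=> _ x Ax; apply/negPn/negP => xs; apply: nex; exists x.
Qed.

Lemma capped_cardU A B k a b : a <= k -> b <= k ->
  (forall x, A x -> B x -> False) -> capped_card A k a -> capped_card B k b ->
  capped_card [set x | A x \/ B x] k (minn (a + b) k).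
Proof.
move=> ak bk AB /(capped_cardP _ ak)[s [us ss sA As]].
move=> /(capped_cardP _ bk)[t [ut tt tB Bt]].
apply/capped_cardP; first exact: geq_minr.
exists (take k (s ++ t)); split.
- apply: take_uniq; rewrite cat_uniq us ut andbT /=.
  by apply/hasPn => x /tB Bx; apply/negP => /sA Ax; exact: AB Bx.
- by rewrite size_take_min size_cat ss tt minnC.
- move=> x /mem_take; rewrite mem_cat => /orP[/sA|/tB]; by [left|right].
- rewrite gtn_min ltnn orbF => abk x.
  rewrite take_oversize ?size_cat ?ss ?tt; last exact: ltnW.
  rewrite mem_cat; case=> [/As ->//|/Bt ->]; rewrite ?orbT //.
    by apply: leq_ltn_trans abk; rewrite leq_addr.
  by apply: leq_ltn_trans abk; rewrite leq_addl.
Qed.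

(** Capping commutes with disjoint sums, since an inner cap at [k] does not change an outer one.
    This is why capped counts at depth [m + 1] determine those at depth [m]. *)
Lemma capped_card_bigU (I : eqType) (r : seq I) (P : pred I) (F : I -> set T)
    (n : I -> nat) k :
  uniq r -> (forall i, i \in r -> P i -> n i <= k /\ capped_card (F i) k (n i)) ->
  (forall i j x, F i x -> F j x -> i = j) ->
  capped_card [set x | exists2 i, i \in r & P i /\ F i x] k
    (minn (\sum_(i <- r | P i) n i) k).
Proof.
move=> ur hF dF; elim: r ur hF => [_ _|i r IH /= /andP[ir ur] hF].
  rewrite big_nil min0n; apply/capped_cardP => //; exists [::]; split => //.
  by move=> _ x [].
have {}IH := IH ur (fun j jr => hF j (mem_behead (s := i :: r) jr)).
rewrite big_cons; case: ifP => Pi.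
- have [nik ci] := hF i (mem_head _ _) Pi.
  have -> : minn (n i + \sum_(j <- r | P j) n j) k =
            minn (n i + minn (\sum_(j <- r | P j) n j) k) k.
    by lia.
  suff -> : [set x | exists2 i0, i0 \in i :: r & P i0 /\ F i0 x] =
     [set x | F i x \/ [set x | exists2 i, i \in r & P i /\ F i x] x].
    apply: capped_cardU => //; first exact: geq_minr.
    by move=> x Fi [j jr [_ Fj]]; rewrite (dF _ _ _ Fi Fj) jr in ir.
  apply/seteqP; split => x /=.
    by case=> j; rewrite inE => /orP[/eqP-> []|jr h]; [left|right; exists j].
  case=> [Fi|[j jr h]]; first by exists i => //; exact: mem_head.
  by exists j => //; rewrite inE jr orbT.
- suff -> : [set x | exists2 i0, i0 \in i :: r & P i0 /\ F i0 x] =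
     [set x | exists2 i, i \in r & P i /\ F i x] by [].
  apply/seteqP; split => x /= [j].
    by rewrite inE => /orP[/eqP-> []|jr h]; [rewrite Pi|exists j].
  by move=> jr h; exists j => //; rewrite inE jr orbT.
Qed.

End CappedCard.

Section CappedCardMap.
Variables T U : eqType.
Implicit Types (A : set T) (s : seq T).

Lemma capped_card_image (f : T -> U) A k j : j <= k -> {in A &, injective f} ->
  capped_card A k j -> capped_card (f @` A) k j.
Proof.
move=> jk finj /(capped_cardP _ jk)[s [us ss sA As]].
apply/capped_cardP => //; exists (map f s); split.
- by rewrite map_inj_in_uniq // => x y /sA Ax /sA Ay; apply: finj; rewrite inE.
- by rewrite size_map.
- by move=> x /mapP[y /sA Ay ->]; exists y.
- by move=> /As {}As x [y /As ys <-]; exact: map_f.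
Qed.

(** If [B] held only matched elements, [j] would be at most the number of matched pairs, hence below
    [k], and [A] would have exactly [j] elements; but the matched ones together with [x] are more.
    [M] may contain repetitions, hence the [undup]. *)
Lemma capped_card_match A (B : set U) k j (M : seq (T * U)) x : j <= k ->
  capped_card A k j -> capped_card B k j ->
  {in M &, forall a b, a.1 = b.1 <-> a.2 = b.2} ->
  (forall a, a \in M -> A a.1 /\ B a.2) ->
  size M < k -> A x -> x \notin map fst M -> exists2 y, B y & y \notin map snd M.
Proof.
move=> jk cA cB Minj MAB Mk Ax xM; apply: contrapT => nex.
have B2 y : B y -> y \in map snd M.
  by move=> By; apply/negPn/negP => yM; apply: nex; exists y.
pose M1 := undup M.
have injf : {in M1 &, injective fst}.
  move=> [a1 a2] [b1 b2]; rewrite !mem_undup => aM bM /= e.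
  by have [/(_ e) /= -> _] := Minj _ _ aM bM; rewrite e.
have injs : {in M1 &, injective snd}.
  move=> [a1 a2] [b1 b2]; rewrite !mem_undup => aM bM /= e.
  by have [_ /(_ e) /= ->] := Minj _ _ aM bM; rewrite e.
have sM1 : size M1 < k by exact: leq_ltn_trans (size_undup _) Mk.
have jB : j <= size M1.
  have /(capped_cardP _ jk)[t [ut <- tB _]] := cB.
  rewrite -(size_map snd); apply: uniq_leq_size => // y /tB /B2 /mapP[a aM ->].
  by rewrite map_f // mem_undup.
have /(capped_cardP _ jk)[t [ut st tA At]] := cA.
have : size (x :: map fst M1) <= size t.
  apply: uniq_leq_size.
    rewrite /= map_inj_in_uniq ?undup_uniq // andbT.
    by apply: contra xM => /mapP[a]; rewrite mem_undup => aM ->; rewrite map_f.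
  move=> y; rewrite inE => /orP[/eqP->|/mapP[a]].
    by apply: At => //; exact: leq_ltn_trans sM1.
  rewrite mem_undup => aM ->; apply: At; last by have [] := MAB _ aM.
  exact: leq_ltn_trans sM1.
by rewrite /= size_map st ltnNge jB.
Qed.

End CappedCardMap.

(** * Walks and cycles *)

Section Walks.
Variables (V : eqType) (e : rel V).
Implicit Types (A B : set V) (x y z : V) (p q : seq V).

Lemma walk_nil A x : A x -> walk e A x [::] x.
Proof. by move=> Ax; split => // z; rewrite inE => /eqP->. Qed.

Lemma walk_cons A x y p z :
  A x -> e x y -> walk e A y p z -> walk e A x (y :: p) z.
Proof.
move=> Ax exy [pp lp pA]; split => //=; first by rewrite exy.
by move=> u; rewrite inE => /orP[/eqP->|/pA].
Qed.

Lemma walk_consE A x y p z :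
  walk e A x (y :: p) z <-> [/\ A x, e x y & walk e A y p z].
Proof.
split=> [[/= /andP[exy pp] lp pA]|[Ax exy w]]; last exact: walk_cons.
split => //; first by apply: pA; rewrite mem_head.
by split => // u up; apply: pA; rewrite inE up orbT.
Qed.

Lemma walk_cat A x y z p q :
  walk e A x p y -> walk e A y q z -> walk e A x (p ++ q) z.
Proof.
move=> [pp lp pA] [pq lq qA]; split.
- by rewrite cat_path pp lp.
- by rewrite last_cat lp.
- move=> u; rewrite -cat_cons mem_cat => /orP[/pA//|uq].
  by apply: qA; rewrite inE uq orbT.
Qed.

Lemma walk_catE A x z p q : walk e A x (p ++ q) z <->
  walk e A x p (last x p) /\ walk e A (last x p) q z.
Proof.
split=> [|[]]; last exact: walk_cat.
case; rewrite cat_path => /andP[pp pq] lq qA; split; split => //.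
- by move=> u up; apply: qA; rewrite -cat_cons mem_cat up.
- by move: lq; rewrite last_cat.
- move=> u; rewrite inE => /orP[/eqP->|uq]; apply: qA.
    by rewrite -cat_cons mem_cat mem_last.
  by rewrite -cat_cons mem_cat uq orbT.
Qed.

Lemma walk_rcons A x y z p :
  walk e A x p y -> e y z -> A z -> walk e A x (rcons p z) z.
Proof.
move=> w eyz Az; rewrite -cats1; apply: (walk_cat w).
apply: walk_cons => //; last exact: walk_nil.
by case: w => _ <-; apply; exact: mem_last.
Qed.

Lemma walk_start A x y p : walk e A x p y -> A x.
Proof. by case=> _ _; apply; exact: mem_head. Qed.

Lemma walk_end A x y p : walk e A x p y -> A y.
Proof. by case=> _ <-; apply; exact: mem_last. Qed.

Lemma walk_sub A B x y p : A `<=` B -> walk e A x p y -> walk e B x p y.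
Proof. by move=> AB [pp lp pA]; split => // z /pA /AB. Qed.

Lemma walk_in A B x y p : (forall z, z \in x :: p -> B z) ->
  walk e A x p y -> walk e B x p y.
Proof. by move=> AB [pp lp pA]. Qed.

Lemma walk_uniq A x y p : walk e A x p y ->
  exists q, [/\ walk e A x q y, uniq (x :: q), size q <= size p &
                {subset q <= p}].
Proof.
case=> pp lp pA; case/shortenP: pp lp => q pq uq sq lq; exists q.
have szq : size q <= size p by apply: uniq_leq_size => //; case/andP: uq.
split => //; split => // z; rewrite inE => zq; apply: pA.
by rewrite inE; case/orP: zq => [->//|/sq ->]; rewrite orbT.
Qed.

Lemma walk_rev A x y p : symmetric e ->
  walk e A x p y -> exists2 q, size q = size p & walk e A y q x.
Proof.
move=> se [pp lp pA]; exists (rev (belast x p)); first by rewrite size_rev size_belast.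
split.
- rewrite -lp rev_path; apply: sub_path pp => u v /=; by rewrite se.
- by case: p lp {pp pA} => [//|z p] _ /=; rewrite rev_cons last_rcons.
- move=> z; rewrite inE mem_rev => zp; apply: pA.
  case/orP: zp => [/eqP->|/mem_belast//]; by rewrite -lp mem_last.
Qed.

Lemma linked_refl A x : A x -> linked e A x x.
Proof. by move=> Ax; exists [::]; exact: walk_nil. Qed.

Lemma linked_trans A y x z : linked e A x y -> linked e A y z -> linked e A x z.
Proof. by move=> [p wp] [q wq]; exists (p ++ q); exact: walk_cat wq. Qed.

Lemma linked_sym A x y : symmetric e -> linked e A x y -> linked e A y x.
Proof. by move=> se [p /(walk_rev se)[q _ wq]]; exists q. Qed.

Lemma linked_sub A B x y : A `<=` B -> linked e A x y -> linked e B x y.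
Proof. by move=> AB [p /(walk_sub AB) wp]; exists p. Qed.

Lemma linked_end A x y : linked e A x y -> A y.
Proof. by case=> p /walk_end. Qed.

Lemma linked1 A x y : A x -> A y -> e x y -> linked e A x y.
Proof.
move=> Ax Ay exy; exists [:: y]; apply: walk_cons => //; exact: walk_nil.
Qed.

Lemma walk_linked A x y p z : walk e A x p y -> z \in x :: p -> linked e A x z.
Proof.
move=> w; rewrite inE => /orP[/eqP->|zp]; first exact/linked_refl/(walk_start w).
case/path.splitP: zp w => p1 p2 /walk_catE[w _]; exists (rcons p1 z).
by move: w; rewrite last_rcons.
Qed.

Lemma walk_linkedin A x y p : walk e A x p y -> walk e (linked e A x) x p y.
Proof. by move=> w; apply: (walk_in _ w) => z; exact: (walk_linked w). Qed.

(* The cycle follows the first path up to its first meeting point with the *)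
(* second path, and returns along the latter.                              *)
Lemma two_paths_cycle x v p w q : symmetric e ->
  path e x (v :: p) -> path e x (w :: q) -> uniq (x :: v :: p) ->
  uniq (x :: w :: q) -> v <> w -> last v p = last w q ->
  exists c, [/\ ucycle e [:: x, v & c], 0 < size c <= size p + size q
    & {subset [:: x, v & c] <= [:: x, v & p] ++ w :: q}].
Proof.
move=> se pp pq; rewrite !(cons_uniq x) => /andP[xp up] /andP[xq uq] vw lpq.
have hasz : has (mem (w :: q)) (v :: p).
  apply/hasP; exists (last v p); first exact: mem_last.
  by rewrite /= lpq mem_last.
have [z [p1 [p2 [epv zr np1]]]] : exists z p1 p2,
    [/\ v :: p = rcons p1 z ++ p2, z \in w :: q & ~~ has (mem (w :: q)) p1].
  by case: (split_find hasz) => z p1 p2 h1 h2; exists z, p1, p2.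
have [q1 [q2 eqr]] : exists q1 q2, q1 ++ z :: q2 = w :: q.
  by case/splitPr: zr => q1 q2; exists q1, q2.
have disj u : u \in p1 -> u \notin w :: q by apply/hasPn.
have [s es] : exists s, rcons p1 z = v :: s.
  by case: (p1) epv => [|a l] /= [->]; [exists [::]|exists (rcons l z)].
exists (s ++ rev q1).
have eqc : [:: x, v & s ++ rev q1] = x :: rcons p1 z ++ rev q1 by rewrite es.
have p1v u : u \in rcons p1 z -> u \in v :: p.
  by rewrite epv mem_cat => ->.
have q1w u : u \in q1 -> u \in w :: q by rewrite -eqr mem_cat => ->.
rewrite eqc; split.
- rewrite /ucycle; apply/andP; split.
  + rewrite /cycle rcons_cat -rev_cons.
    have -> : x :: q1 = belast x (rcons q1 z) by rewrite belast_rcons.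
    rewrite cat_path last_rcons; move: pp; rewrite epv cat_path => /andP[-> _] /=.
    have {1}-> : z = last x (rcons q1 z) by rewrite last_rcons.
    rewrite rev_path; have : path e x (rcons q1 z).
      by move: pq; rewrite -eqr -cat_rcons cat_path => /andP[].
    by apply: sub_path => a b /=; rewrite se.
  + rewrite -cat_cons cat_uniq rev_uniq; apply/and3P; split.
    * rewrite cons_uniq; apply/andP; split; first by apply: contra xp => /p1v.
      by move: up; rewrite epv cat_uniq => /andP[].
    * apply/hasPn => u; rewrite mem_rev => uq1; rewrite inE negb_or mem_rcons.
      rewrite inE negb_or; apply/and3P; split.
      - by apply: contra xq => /eqP <-; exact: q1w.
      - apply/eqP => uz; move: uq; rewrite -eqr cat_uniq => /and3P[_ /hasPn h _].
        by have /negP := h z (mem_head _ _); rewrite /= -uz.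
      - by apply/negP => /disj; rewrite q1w.
    * by move: uq; rewrite -eqr cat_uniq => /andP[].
- have e1 : size s = size p1 by have /= := congr1 size es; rewrite size_rcons => -[].
  have e2 : (size p).+1 = (size p1).+1 + size p2.
    by have /= := congr1 size epv; rewrite size_cat size_rcons.
  have e3 : (size q).+1 = size q1 + (size q2).+1.
    by have /= <- := congr1 size eqr; rewrite size_cat.
  rewrite size_cat size_rev e1; apply/andP; split; last by lia.
  case: (p1) (q1) es eqr e1 => [|//] [|//] /= [zv _] [zw _].
  by case: vw; rewrite -zv zw.
- move=> u uc; have : [|| u == x, u \in rcons p1 z | u \in q1].
    by move: uc; rewrite in_cons mem_cat mem_rev.
  case/or3P => [/eqP->|/p1v up1|/q1w uq1].
  + by rewrite mem_head.
  + by rewrite mem_cat (in_cons x) up1 orbT.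
  + by rewrite mem_cat uq1 orbT.
Qed.

End Walks.

(** * Dihedral symmetries of cyclic sequences *)

Section Dihedral.

Lemma mem_dihedral (X : eqType) (c d : seq X) : 0 < size c ->
  reflect (exists2 i, i <= size c & d = rot i c \/ d = rev (rot i c))
    (d \in dihedral_images c).
Proof.
move=> c0; rewrite mem_cat; apply: (iffP orP) => [[]/mapP[i]|[i ic h]].
- by rewrite mem_iota => /andP[_ /ltnW ic] ->; exists i => //; left.
- by rewrite mem_iota => /andP[_ /ltnW ic] ->; exists i => //; right.
- have [j jc erot] : exists2 j, j < size c & rot i c = rot j c.
    move: ic; rewrite leq_eqVlt => /orP[/eqP->|ic]; last by exists i.
    by exists 0 => //; rewrite rot_size rot0.
  rewrite erot in h; case: h => ->; [left|right]; apply/mapP; exists j => //;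
  by rewrite mem_iota.
Qed.

Lemma dihedral_refl (X : eqType) (c : seq X) : 0 < size c -> c \in dihedral_images c.
Proof. by move=> c0; apply/mem_dihedral => //; exists 0 => //; left; rewrite rot0. Qed.

Lemma dihedral_gt0 (X : eqType) (c d : seq X) : d \in dihedral_images c -> 0 < size c.
Proof. by case: c. Qed.

Lemma size_dihedral (X : eqType) (c d : seq X) :
  d \in dihedral_images c -> size d = size c.
Proof.
move=> dc; have c0 := dihedral_gt0 dc; case/(mem_dihedral _ c0): dc => i _ [] ->;
by rewrite ?size_rev size_rot.
Qed.

Lemma dihedral_sym (X : eqType) (c d : seq X) :
  d \in dihedral_images c -> c \in dihedral_images d.
Proof.
move=> dc; have c0 := dihedral_gt0 dc; have sd := size_dihedral dc.
case/(mem_dihedral _ c0): dc => i ic [] ed; (apply/mem_dihedral; first by rewrite sd).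
  exists (size d - i); first exact: leq_subr.
  by left; rewrite -/(rotr i d) ed rotK.
exists i; first by rewrite sd.
by right; rewrite rev_rot ed revK rotK.
Qed.

Lemma dihedral_trans (X : eqType) (c d b : seq X) :
  d \in dihedral_images c -> b \in dihedral_images d -> b \in dihedral_images c.
Proof.
move=> dc bd; have c0 := dihedral_gt0 dc; have sd := size_dihedral dc.
have rr i j : i <= size c -> j <= size c ->
    exists2 k, k <= size c & rot j (rot i c) = rot k c.
  move=> ic jc; rewrite rot_add_mod //; case: ifP => h; first by exists (i + j); rewrite // addnC.
  by eexists; last reflexivity; lia.
apply/mem_dihedral => //.
case/(mem_dihedral _ c0): dc => i ic hd.
have d0 : 0 < size d by rewrite sd.
case/(mem_dihedral _ d0): bd => j; rewrite sd => jc hb.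
have rrr k : rotr j (rot k c) = rot (size c - j) (rot k c) by rewrite /rotr size_rot.
have [k1 k1c e1] := rr _ _ ic jc.
have [k2 k2c e2] := rr _ _ ic (leq_subr j (size c)).
case: hd hb => -> [] ->.
- by exists k1 => //; left.
- by exists k1 => //; right; rewrite e1.
- by exists k2 => //; right; rewrite -e2 -rrr rev_rotr.
- by exists k2 => //; left; rewrite -e2 -rrr rev_rot revK.
Qed.

Lemma dihedral_eqi (X : eqType) (c d : seq X) :
  d \in dihedral_images c -> dihedral_images d =i dihedral_images c.
Proof.
move=> dc b; apply/idP/idP; first exact: dihedral_trans.
exact/dihedral_trans/dihedral_sym.
Qed.

Lemma map_dihedral (X Y : eqType) (f : X -> Y) (c : seq X) :
  dihedral_images (map f c) = map (map f) (dihedral_images c).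
Proof.
rewrite /dihedral_images map_cat size_map -!map_comp; congr (_ ++ _);
by apply: eq_map => i /=; rewrite ?map_rev map_rot.
Qed.

Lemma mem_dihedral_mem (X : eqType) (c d : seq X) :
  d \in dihedral_images c -> d =i c.
Proof.
move=> dc x; case/(mem_dihedral _ (dihedral_gt0 dc)): dc => i _ [] ->;
by rewrite ?mem_rev mem_rot.
Qed.

Lemma dihedral_uniq (X : eqType) (c d : seq X) :
  d \in dihedral_images c -> uniq d = uniq c.
Proof.
move=> dc; case/(mem_dihedral _ (dihedral_gt0 dc)): dc => i _ [] ->;
by rewrite ?rev_uniq rot_uniq.
Qed.

Definition consecutive (X : eqType) (c : seq X) (x y : X) :=
  ((x \in c) && (y == next c x)) || ((y \in c) && (x == next c y)).

Lemma consecutiveC (X : eqType) (c : seq X) : symmetric (consecutive c).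
Proof. by move=> x y; rewrite /consecutive orbC. Qed.

Lemma consecutive_mem (X : eqType) (c : seq X) x y :
  consecutive c x y -> (x \in c) && (y \in c).
Proof. by case/orP => /andP[h /eqP->]; rewrite mem_next h. Qed.

Lemma del_cycleE (X : eqType) (e : rel X) c x y :
  del_cycle e c x y = e x y && ~~ consecutive c x y.
Proof. by rewrite /del_cycle /consecutive negb_or. Qed.

Lemma consecutive_dihedral (X : eqType) (c d : seq X) : uniq c ->
  d \in dihedral_images c -> consecutive d =2 consecutive c.
Proof.
move=> uc dc x y; rewrite /consecutive !(mem_dihedral_mem dc).
case/(mem_dihedral _ (dihedral_gt0 dc)): dc => i _ [] ->.
  by rewrite !next_rot.
rewrite !next_rev ?rot_uniq // !prev_rot //.
have pn u v : (u \in c) && (v == prev c u) = (v \in c) && (u == next c v).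
  apply/andP/andP => -[h /eqP->]; first by rewrite mem_prev next_prev.
  by rewrite mem_next prev_next.
by rewrite !pn orbC.
Qed.

Lemma cycle_traject (X : eqType) (c : seq X) x : uniq c -> x \in c ->
  exists i, rot i c = traject (next c) x (size c) /\ iter (size c) (next c) x = x.
Proof.
move=> uc xc; case: (rot_to xc) => i p ec; exists i.
have up : uniq (x :: p) by rewrite -ec rot_uniq.
have [f [fE fp]] : exists f, f =1 next c /\ fpath f x (rcons p x).
  exists (next (x :: p)); split; last exact: (cycle_next up).
  by rewrite -ec; exact: next_rot.
have /fpathP[n en] := fp.
have sn : (size p).+1 = n by rewrite -(size_rcons p x) en size_traject.
have ss : size c = (size p).+1 by rewrite -(size_rot i) ec.
have etr k u : traject f u k = traject (next c) u k.
  by elim: k u => // k IH u; rewrite !trajectS IH fE.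
split.
  rewrite ec ss trajectS -fE -etr; congr cons.
  have := congr1 (take (size p)) en; rewrite -sn trajectSr.
  by rewrite -!cats1 !take_size_cat ?size_traject.
have := congr1 (last x) en; rewrite last_rcons -sn last_traject ss => {2}->.
by apply: eq_iter => u; rewrite fE.
Qed.

Lemma iter_next_neq (X : eqType) (c : seq X) x j : uniq c -> x \in c ->
  0 < j < size c -> iter j (next c) x != x.
Proof.
move=> uc xc /andP[j0 jc]; have [i [ec _]] := cycle_traject uc xc.
have : uniq (traject (next c) x (size c)) by rewrite -ec rot_uniq.
case: (size c) jc => // n jn /=; case: j j0 jn => // j _ jn /andP[h _].
apply/negP => /eqP e; move/negP: h; apply; apply/trajectP; exists j => //.
by rewrite -iterSr e.
Qed.

Lemma next2_neq (X : eqType) (c : seq X) x : uniq c -> x \in c -> 2 < size c ->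
  next c (next c x) != x.
Proof. by move=> uc xc c3; exact: (@iter_next_neq _ c x 2). Qed.

(* Two cycles with the same edges agree up to a dihedral symmetry: reversing *)
(* one of them if needed, their successor functions agree at one vertex,     *)
(* hence all along.                                                          *)
Lemma consecutive_sub_dihedral (X : eqType) (c d : seq X) :
  uniq c -> uniq d -> 2 < size c -> 2 < size d ->
  (forall x, x \in d -> consecutive c x (next d x)) -> d \in dihedral_images c.
Proof.
move=> uc ud c3 d3 dc.
have [x xd] : exists x, x \in d by case: (d) d3 => // a l _; exists a; exact: mem_head.
wlog fw : c uc c3 dc / (x \in c) && (next d x == next c x).
  move=> H; have /orP[h|/andP[h1 /eqP h2]] := dc x xd; first exact: H h.
  have c0 : 0 < size c by apply: ltn_trans c3.
  have rc : rev c \in dihedral_images c.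
    by apply/mem_dihedral => //; exists 0 => //; right; rewrite rot0.
  rewrite -(dihedral_eqi rc); apply: H; rewrite ?rev_uniq ?size_rev //.
    by move=> y yd; rewrite (consecutive_dihedral uc rc) dc.
  have -> : next (rev c) x = next d x by rewrite next_rev // [in LHS]h2 prev_next.
  by rewrite mem_rev eqxx andbT h2 mem_next.
have {fw}[xc /eqP fw] := andP fw.
have it j : iter j (next d) x \in d by elim: j => //= j; rewrite mem_next.
have agree j : (iter j (next d) x \in c) &&
    (next d (iter j (next d) x) == next c (iter j (next d) x)).
  elim: j => [|j /andP[IH1 /eqP IH2]]; first by rewrite /= xc fw eqxx.
  rewrite iterS; set y := iter j _ x in IH1 IH2 *.
  have /orP[//|/andP[_ /eqP h]] := dc (next d y) (it j.+1).
  (* In the remaining case [d] turns back: applying [next d] twice would fix [y], which a cycle of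
     length at least three excludes. *)
  rewrite IH2 in h; have := congr1 (prev c) h; rewrite !prev_next // => h'.
  by have /negP[] := next2_neq ud (it j) d3; rewrite -/y IH2; apply/eqP.
have itE j : iter j (next d) x = iter j (next c) x.
  by elim: j => //= j <-; have /andP[_ /eqP] := agree j.
have [i [ei li]] := cycle_traject uc xc.
have [j [ej lj]] := cycle_traject ud xd.
have ss : size c = size d.
  apply/eqP; rewrite eqn_leq; apply/andP; split; rewrite leqNgt; apply/negP => h.
  - have := @iter_next_neq _ c x (size d) uc xc; rewrite h andbT.
    by rewrite (ltn_trans _ d3) // => /(_ isT); rewrite -itE lj eqxx.
  - have := @iter_next_neq _ d x (size c) ud xd; rewrite h andbT.
    by rewrite (ltn_trans _ c3) // => /(_ isT); rewrite itE li eqxx.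
have etr : rot j d = rot i c.
  rewrite ei ej ss; apply: (@eq_from_nth _ x); rewrite !size_traject // => k kd.
  by rewrite !nth_traject // itE.
have c0 : 0 < size c by apply: ltn_trans c3.
have d0 : 0 < size d by apply: ltn_trans d3.
have rot_dih (b : seq X) k : 0 < size b -> rot k b \in dihedral_images b.
  move=> b0; apply/mem_dihedral => //; case: (leqP k (size b)) => kb.
    by exists k => //; left.
  by exists 0 => //; left; rewrite rot_oversize ?rot0 // ltnW.
apply: dihedral_trans (rot_dih c i c0) _; rewrite -etr.
exact/dihedral_sym/rot_dih.
Qed.

End Dihedral.

(** * Types of trees and unicyclic graphs *)

Section TreeTypes.
Variables (V : eqType) (k : nat).
Implicit Types (e : rel V) (A B : set V) (r x y : V).

Definition typed_children e A r m (t : Sigma m k) : set V :=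
  let B := truncation e A r m.+1 in
  [set v | [/\ B v, e r v & tree_type e (branch e B r v) v t]].

Lemma tree_typeS e A r m (s : Sigma m.+1 k) : tree_type e A r s =
  forall t : Sigma m k, capped_card (typed_children e A r t) k (s t).
Proof. by []. Qed.

Lemma tree_type_ex e A r m : exists s : Sigma m k, tree_type e A r s.
Proof.
case: m => [|m]; first by exists tt.
set X := fun t : Sigma m k => typed_children e A r t.
have ex t : exists j : 'I_k.+1, capped_card (X t) k j.
  by have [j jk h] := capped_card_ex (X t) k; exists (Ordinal (jk : j < k.+1)).
exists [ffun t => projT1 (cid (ex t))]; rewrite tree_typeS => t.
by rewrite ffunE; case: cid.
Qed.

Lemma tree_type_uniq e A r m (s t : Sigma m k) :
  tree_type e A r s -> tree_type e A r t -> s = t.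
Proof.
case: m s t => [|m] s t /=; first by case: s; case: t.
move=> hs ht; apply/ffunP => u; apply/val_inj => /=.
by apply: (capped_card_uniq _ _ (hs u) (ht u)); rewrite -ltnS ltn_ord.
Qed.

Lemma tree_type_trunc e A B r m (s : Sigma m k) :
  truncation e A r m = truncation e B r m -> tree_type e A r s -> tree_type e B r s.
Proof. by case: m s => //= m s ->. Qed.

Lemma truncation_sub e A r m : truncation e A r m `<=` A.
Proof. by move=> x [p /walk_end]. Qed.

Lemma truncation_le e A r m n :
  m <= n -> truncation e A r m `<=` truncation e A r n.
Proof. by move=> mn x [p w pm]; exists p => //; exact: leq_trans mn. Qed.

Lemma truncation_root e A r m : A r -> truncation e A r m r.
Proof. by move=> Ar; exists [::] => //; exact: walk_nil. Qed.

Lemma truncation_walk e A r m p x : walk e A r p x -> size p <= m ->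
  walk e (truncation e A r m) r p x.
Proof.
move=> w pm; apply: (walk_in _ w) => z; rewrite inE => /orP[/eqP->|zp].
  exact/truncation_root/(walk_start w).
case/path.splitP: zp w pm => p1 p2 /walk_catE[w _].
rewrite last_rcons in w; rewrite size_cat => h.
by exists (rcons p1 z) => //; apply: leq_trans h; rewrite leq_addr.
Qed.

Lemma truncation_child e A r m v : A r -> A v -> e r v -> truncation e A r m.+1 v.
Proof.
move=> Ar Av erv; exists [:: v] => //; apply: walk_cons => //; exact: walk_nil.
Qed.

(** The map on types induced by cutting off the last level: branches are regrouped by their own
    projected type. The sum is capped at [k], so [inord] never falls back to its default. *)
Fixpoint proj_type (m : nat) : Sigma m.+1 k -> Sigma m k :=
  match m return Sigma m.+1 k -> Sigma m k with
  | 0 => fun _ => tt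
  | m'.+1 => fun s =>
      [ffun t => inord (minn (\sum_(u | proj_type u == t) s u) k)]
  end.

Lemma proj_typeP e A r m (s : Sigma m.+1 k) : irreflexive e -> A r ->
  tree_type e A r s -> tree_type e A r (proj_type s).
Proof.
move=> ie; elim: m A r s => [//|m IH] A r s Ar; rewrite !tree_typeS => hs t.
rewrite ffunE inordK ?ltnS ?geq_minr //.
set B2 := truncation e A r m.+2; set B1 := truncation e A r m.+1.
have B12 : B1 `<=` B2 by exact: truncation_le.
(* A walk of length at most [m] from a child of [r] stays within depth [m.+1], so cutting the tree
   at [m.+1] or at [m.+2] leaves the same branch up to depth [m]. *)
have tr v : B1 v -> e r v ->
    truncation e (branch e B2 r v) v m = truncation e (branch e B1 r v) v m.
  move=> B1v erv; apply/seteqP; split => x [p w pm]; exists p => //; last first.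
    by apply: walk_sub w => y; apply: linked_sub => u [/B12 ? ?]; split.
  apply: walk_linkedin; apply: (walk_in _ w) => z zp.
  have [[q1 wq1 _] zr] : (B2 `\ r) z.
    by case: w => _ _ h; apply: linked_end (h z zp).
  split => //.
  have w1 : walk e A v p x.
    apply: walk_sub w => y /linked_end[[q wq _] _]; exact: walk_end wq.
  have w2 : walk e A r (v :: p) x by apply: walk_cons.
  have [_ _] := truncation_walk w2 (pm : size (v :: p) <= m.+1).
  by apply; rewrite inE zp orbT.
have -> : typed_children e A r t =
  [set v | exists2 u : Sigma m.+1 k, u \in index_enum (Sigma m.+1 k) &
     proj_type u == t /\ typed_children e A r u v].
  apply/seteqP; split => v /=.
    move=> [B1v erv ht]; have [u hu] := tree_type_ex e (branch e B2 r v) v m.+1.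
    exists u; first exact: mem_index_enum.
    split; last by split => //; exact: B12.
    apply/eqP; apply: (tree_type_uniq _ ht).
    apply: tree_type_trunc (tr _ B1v erv) _; apply: IH hu.
    apply: linked_refl; split; first exact: B12.
    by move=> vr; move: erv; rewrite vr ie.
  case=> u _ [/eqP <- [B2v erv hu]].
  have B1v : B1 v by apply: truncation_child => //; exact: truncation_sub B2v.
  split => //; apply: tree_type_trunc (tr _ B1v erv) _; apply: IH hu.
  apply: linked_refl; split => //.
  by move=> vr; move: erv; rewrite vr ie.
apply: capped_card_bigU; first exact: index_enum_uniq.
  by move=> u _ _; split; rewrite // -ltnS.
by move=> u u' x [_ _ h] [_ _ h']; exact: tree_type_uniq h h'.
Qed.

End TreeTypes.

(** * Transport along injections of graphs *)

Section Transport.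
Variables (V' V : eqType) (f : V' -> V) (e' : rel V') (e : rel V).
Hypotheses (injf : injective f) (ie' : irreflexive e').
Implicit Types (A B : set V') (r x y : V').

Definition embeds_on A := forall x y, A x -> A y -> e' x y = e (f x) (f y).

Lemma seq_image A (q : seq V) : (forall z, z \in q -> (f @` A) z) ->
  exists2 p, q = map f p & forall z, z \in p -> A z.
Proof.
elim: q => [|z q IH] h; first by exists [::].
have [|p -> pA] := IH; first by move=> u uq; apply: h; rewrite inE uq orbT.
have [y Ay <-] := h z (mem_head _ _); exists (y :: p) => // u.
by rewrite inE => /orP[/eqP->|/pA].
Qed.

Lemma mem_image_inj A x : (f @` A) (f x) -> A x.
Proof. by case=> y Ay /injf <-. Qed.

Lemma path_map_on A x p : embeds_on A -> (forall z, z \in x :: p -> A z) ->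
  path e (f x) (map f p) = path e' x p.
Proof.
move=> eA; elim: p x => //= y p IH x h; rewrite IH; last first.
  by move=> z zp; apply: h; rewrite inE zp orbT.
by rewrite eA //; apply: h; rewrite !inE eqxx ?orbT.
Qed.

Lemma walk_map A x p y : embeds_on A ->
  walk e (f @` A) (f x) (map f p) (f y) <-> walk e' A x p y.
Proof.
move=> eA; split => -[pp lp pA].
- have pA' z : z \in x :: p -> A z.
    by move=> zp; apply: mem_image_inj; apply: pA; rewrite -map_cons map_f.
  split => //; first by rewrite -(path_map_on eA).
  by apply: injf; rewrite -lp last_map.
- split; first by rewrite (path_map_on eA).
    by rewrite last_map lp.
  by rewrite -map_cons => z /mapP[u /pA Au ->]; exists u.
Qed.

Lemma walk_lift A x q z : embeds_on A -> walk e (f @` A) (f x) q z ->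
  exists p y, [/\ q = map f p, z = f y & walk e' A x p y].
Proof.
move=> eA w; have [p qE pA] : exists2 p, q = map f p & forall z, z \in p -> A z.
  by apply: seq_image => u uq; case: w => _ _; apply; rewrite inE uq orbT.
exists p, (last x p); have zE : z = f (last x p).
  by case: w => _ <- _; rewrite qE last_map.
by split => //; apply/(walk_map _ _ _ eA); rewrite -qE -zE.
Qed.

Lemma linked_map A x : embeds_on A ->
  linked e (f @` A) (f x) = f @` linked e' A x.
Proof.
move=> eA; apply/seteqP; split => z.
  by case=> q /(walk_lift eA)[p [y [_ -> w]]]; exists y => //; exists p.
by case=> y [p w] <-; exists (map f p); apply/walk_map.
Qed.

Lemma truncation_map A r m : embeds_on A ->
  truncation e (f @` A) (f r) m = f @` truncation e' A r m.
Proof.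
move=> eA; apply/seteqP; split => z.
  case=> q /(walk_lift eA)[p [y [-> -> w]]]; rewrite size_map => pm.
  by exists y => //; exists p.
by case=> y [p w pm] <-; exists (map f p); [apply/walk_map|rewrite size_map].
Qed.

Lemma embeds_on_sub A B : B `<=` A -> embeds_on A -> embeds_on B.
Proof. by move=> BA eA x y /BA Ax /BA Ay; exact: eA. Qed.

Lemma image_setD1 A r : (f @` A) `\ (f r) = f @` (A `\ r).
Proof.
apply/seteqP; split => z.
  by case=> -[y Ay <-] yr; exists y => //; split => // h; apply: yr; rewrite h.
by case=> y [Ay yr] <-; split; [exists y|move=> /injf].
Qed.

Lemma branch_map A r v : embeds_on A ->
  branch e (f @` A) (f r) (f v) = f @` branch e' A r v.
Proof.
move=> eA; rewrite /branch image_setD1 linked_map //.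
by apply: embeds_on_sub eA => x [].
Qed.

Lemma tree_type_map k A r m (s : Sigma m k) : embeds_on A -> A r ->
  tree_type e' A r s -> tree_type e (f @` A) (f r) s.
Proof.
elim: m A r s => [//|m IH] A r s eA Ar; rewrite !tree_typeS => hs t.
have fwd v (u : Sigma m k) : typed_children e' A r u v ->
    typed_children e (f @` A) (f r) u (f v).
  case=> Bv erv hv; split.
  - by rewrite truncation_map //; exists v.
  - by rewrite -eA //; exact: truncation_sub Bv.
  - rewrite truncation_map // branch_map; last first.
      exact: embeds_on_sub (@truncation_sub _ _ _ _ _) eA.
    apply: IH hv; first by apply: embeds_on_sub eA => x /linked_end[/truncation_sub].
    by apply: linked_refl; split => // vr; move: erv; rewrite vr ie'.
suff -> : typed_children e (f @` A) (f r) t = f @` typed_children e' A r t.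
  apply: capped_card_image => //; first by rewrite -ltnS.
  by move=> x y _ _ /injf.
apply/seteqP; split => [z [Bz erz hz]|z [v /fwd h <-//]].
move: Bz erz hz; rewrite truncation_map // => -[v Bv <-] erv hv; exists v => //.
have e'rv : e' r v by rewrite eA //; exact: truncation_sub Bv.
(* The converse inclusion needs no second induction: the preimage has some type [u], which is
   carried forward, and types are unique. *)
have [u hu] := tree_type_ex k e' (branch e' (truncation e' A r m.+1) r v) v m.
have [_ _ hu'] : typed_children e (f @` A) (f r) u (f v) by apply: fwd; split.
rewrite truncation_map // in hu'.
by rewrite (tree_type_uniq hv hu'); split.
Qed.

Lemma cycle_in_map A c : embeds_on A -> (forall z, z \in c -> A z) ->
  cycle_in e (f @` A) (map f c) <-> cycle_in e' A c.
Proof.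
move=> eA cA; rewrite /cycle_in size_map /ucycle map_inj_uniq //.
have -> : cycle e (map f c) = cycle e' c.
  case: c cA => //= x c cA; rewrite -map_rcons (path_map_on eA) // => z.
  by rewrite inE mem_rcons => /orP[/eqP->|/cA//]; apply: cA; rewrite mem_head.
split=> -[c3 uc _]; split => // z /mapP[u /cA Au ->]; by exists u.
Qed.

Lemma connected_on_map A : embeds_on A ->
  connected_on e (f @` A) <-> connected_on e' A.
Proof.
move=> eA; split => -[[x Ax] h]; split.
- by case: Ax => y Ay _; exists y.
- move=> y z Ay Az; have := h (f y) (f z); rewrite linked_map //.
  by case; [exists y|exists z|move=> u lu /injf <-].
- by exists (f x); exists x.
- move=> _ _ [y Ay <-] [z Az <-]; rewrite linked_map //; exists z => //.
  exact: h.
Qed.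

Lemma unicyclic_map A c : embeds_on A -> (forall z, z \in c -> A z) ->
  unicyclic e (f @` A) (map f c) <-> unicyclic e' A c.
Proof.
move=> eA cA; have h1 := connected_on_map eA; have h2 := cycle_in_map eA cA.
split => -[/h1 con /h2 cyc h3]; split => // d hd.
- have dA : forall z, z \in d -> A z by case: hd.
  have /h3 : cycle_in e (f @` A) (map f d) by apply/cycle_in_map.
  by rewrite map_dihedral mem_map //; exact: inj_map.
- have [p dE pA] : exists2 p, d = map f p & forall z, z \in p -> A z.
    by apply: seq_image; case: hd.
  rewrite dE map_dihedral; apply: map_f; apply: h3.
  by apply/cycle_in_map => //; rewrite -dE.
Qed.

Lemma del_cycle_map A c : uniq c -> embeds_on A ->
  forall x y, A x -> A y ->
  del_cycle e' c x y = del_cycle e (map f c) (f x) (f y).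
Proof.
move=> uc eA x y Ax Ay; rewrite /del_cycle eA // !mem_map // !next_map //.
by rewrite !(inj_eq injf).
Qed.

End Transport.

(** * Unicyclic graphs and their words of types *)

Section CycleInUnicyclic.
Variables (V : eqType) (e : rel V).
Implicit Types (A : set V) (c d : seq V).

Lemma del_cycle_dihedral c d : uniq c -> d \in dihedral_images c ->
  del_cycle e d = del_cycle e c.
Proof.
move=> uc dc; apply/funext => x; apply/funext => y.
by rewrite !del_cycleE (consecutive_dihedral uc dc).
Qed.

Lemma del_cycle_sym c : symmetric e -> symmetric (del_cycle e c).
Proof. by move=> se x y; rewrite !del_cycleE se consecutiveC. Qed.

Lemma del_cycle_irr c : irreflexive e -> irreflexive (del_cycle e c).
Proof. by move=> ie x; rewrite del_cycleE ie. Qed.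

Lemma unicyclic_uniq A c : unicyclic e A c -> uniq c.
Proof. by case=> _ [_ /andP[]]. Qed.

Lemma unicyclic_size A c : unicyclic e A c -> 2 < size c.
Proof. by case=> _ []. Qed.

Lemma unicyclic_mem A c x : unicyclic e A c -> x \in c -> A x.
Proof. by case=> _ [_ _ h] _ /h. Qed.

Lemma cycle_in_dihedral A c d : symmetric e -> cycle_in e A c ->
  d \in dihedral_images c -> cycle_in e A d.
Proof.
move=> se [c3 uc cA] dc; split; first by rewrite (size_dihedral dc).
  have c0 : 0 < size c by apply: ltn_trans c3.
  move: uc; rewrite /ucycle (dihedral_uniq dc) => /andP[cc ->]; rewrite andbT.
  case/(mem_dihedral _ c0): dc => i _ [] ->; first by rewrite rot_cycle.
  rewrite rev_cycle rot_cycle; rewrite -(@eq_cycle _ e) // => x y; exact: se.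
by move=> z; rewrite (mem_dihedral_mem dc) => /cA.
Qed.

Lemma unicyclic_dihedral A c d : symmetric e -> unicyclic e A c ->
  d \in dihedral_images c -> unicyclic e A d.
Proof.
move=> se [con cyc h] dc; split => //; first exact: cycle_in_dihedral cyc dc.
by move=> b /h; rewrite (dihedral_eqi dc).
Qed.

Lemma unicyclic_consecutive A c d x : unicyclic e A c -> cycle_in e A d ->
  x \in d -> consecutive c x (next d x).
Proof.
move=> uc; have [_ _ h] := uc => /h dc xd.
by rewrite -(consecutive_dihedral (unicyclic_uniq uc) dc) /consecutive xd eqxx.
Qed.

End CycleInUnicyclic.

Section Lexicographic.
Variables (X : eqType) (r : rel X).
Hypothesis hr : total_order r.

Lemma lex_le_total (u w : seq X) : lex_le r u w || lex_le r w u.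
Proof.
have [_ _ _ tr] := hr.
elim: u w => [|x u IH] [|y w] //=; rewrite [y == x]eq_sym.
by case: eqP => [_|_]; [exact: IH|exact: tr].
Qed.

Lemma lex_le_trans : transitive (lex_le r).
Proof.
have [_ ar tr _] := hr.
elim=> [|y w IH] [|x u] [|z v] //=.
have [<-|xy] := eqVneq x y.
  by case: eqP => // _; exact: IH.
have [<-|yz] := eqVneq y z.
  by rewrite (negbTE xy).
have [<- xy1 yx1|xz] := eqVneq x z; last exact: tr.
by move: xy; rewrite (ar x y) ?eqxx // xy1.
Qed.

Lemma lex_le_anti (u w : seq X) : lex_le r u w -> lex_le r w u -> u = w.
Proof.
have [_ ar _ _] := hr.
elim: u w => [|x u IH] [|y w] //=; rewrite [y == x]eq_sym.
have [<- h1 h2|xy h1 h2] := eqVneq x y; first by rewrite (IH w).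
by move: xy; rewrite (ar x y) ?eqxx // h1.
Qed.

Lemma min_image_uniq (u w w' : seq X) : min_image r u w -> min_image r u w' -> w = w'.
Proof.
move=> /andP[wu /allP hw] /andP[w'u /allP hw'].
by apply: lex_le_anti; [exact: hw|exact: hw'].
Qed.

Lemma min_image_dihedral (u v : seq X) : v \in dihedral_images u ->
  min_image r v =1 min_image r u.
Proof.
move=> vu w; have e := dihedral_eqi vu.
by rewrite /min_image e (eq_all_r e).
Qed.

Lemma min_image_ex (u : seq X) : 0 < size u -> exists w, min_image r u w.
Proof.
move=> u0.
have refl w : lex_le r w w by have := lex_le_total w w; rewrite orbb.
suff H s v : v \in s -> exists2 w, w \in s & all (lex_le r w) s.
  by have [w ws h] := H _ _ (dihedral_refl u0); exists w; rewrite /min_image ws.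
elim: s v => // x [|y s] IH v _; first by exists x; rewrite ?mem_head //= refl.
have [w ws hw] := IH y (mem_head _ _).
have [xw|wx] := orP (lex_le_total x w).
  exists x; first exact: mem_head.
  rewrite [all _ _]/= -/(all _ (y :: s)) refl; apply/allP => z zs.
  by apply: lex_le_trans xw _; move/allP: hw; exact.
exists w; first by rewrite inE ws orbT.
by rewrite [all _ _]/= -/(all _ (y :: s)) wx.
Qed.

End Lexicographic.

Section UnicyclicTypes.
Variable le : forall m k : nat, rel (Sigma m k).
Hypothesis hle : forall m k : nat, total_order (@le m k).

Section OneGraph.
Variables (V : eqType) (e : rel V).
Hypotheses (se : symmetric e) (ie : irreflexive e).
Implicit Types (A : set V) (c d : seq V).

Definition hanging_type (e1 : rel V) A m k (x : V) : Sigma m k :=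
  projT1 (cid (tree_type_ex k e1 (linked e1 A x) x m)).

Lemma hanging_typeP e1 A m k x :
  tree_type e1 (linked e1 A x) x (hanging_type e1 A m k x).
Proof. by rewrite /hanging_type; case: cid. Qed.

Definition cycle_word A m k c := map (hanging_type (del_cycle e c) A m k) c.

Lemma unicyclic_typeE A s m k (g : Gamma le s m k) : unicyclic_type e A g <->
  exists c, [/\ size c = s, unicyclic e A c &
                min_image (@le m k) (cycle_word A m k c) (val g)].
Proof.
split=> [[c [w [uc hw mw]]]|[c [/eqP cs uc mw]]].
  exists c; split; rewrite ?size_tuple //.
  suff -> : cycle_word A m k c = w by [].
  apply: (congr1 val (_ : map_tuple _ c = w)).
  apply: eq_from_tnth => i; rewrite tnth_map.
  exact: tree_type_uniq (hanging_typeP _ _ _ _ _) (hw i).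
exists (Tuple cs), (map_tuple (hanging_type (del_cycle e c) A m k) (Tuple cs)).
by split => // i; rewrite tnth_map; exact: hanging_typeP.
Qed.

Lemma cycle_word_dihedral A m k c d : uniq c -> d \in dihedral_images c ->
  cycle_word A m k d = map (hanging_type (del_cycle e c) A m k) d.
Proof. by move=> uc dc; rewrite /cycle_word (del_cycle_dihedral e uc dc). Qed.

Lemma cycle_word_image A m k c d : uniq c -> d \in dihedral_images c ->
  cycle_word A m k d \in dihedral_images (cycle_word A m k c).
Proof.
by move=> uc dc; rewrite (cycle_word_dihedral _ _ _ uc dc) map_dihedral map_f.
Qed.

(** The cycle can be relisted so that its word is the stored representative itself. Two graphs of
    the same type then have equal words, letter by letter, which is the form the game needs. *)
Lemma unicyclic_type_word A s m k (g : Gamma le s m k) : unicyclic_type e A g ->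
  exists c, [/\ size c = s, unicyclic e A c & cycle_word A m k c = val g].
Proof.
move=> /unicyclic_typeE[c [cs uc /andP[]]].
rewrite {1}/cycle_word map_dihedral => /mapP[d dc gd] _.
exists d; split.
- by rewrite (size_dihedral dc).
- exact: unicyclic_dihedral uc dc.
- by rewrite (cycle_word_dihedral _ _ _ (unicyclic_uniq uc) dc).
Qed.

Lemma unicyclic_type_ex A s m k c : unicyclic e A c -> size c = s ->
  exists g : Gamma le s m k, unicyclic_type e A g.
Proof.
move=> uc cs; have c0 : 0 < size (cycle_word A m k c).
  by rewrite size_map; apply: ltn_trans (unicyclic_size uc).
have [w mw] := min_image_ex (hle m k) c0.
have ws : size w == s.
  by have /andP[/size_dihedral -> _] := mw; rewrite size_map cs.
have us : size (cycle_word A m k c) == s by rewrite size_map cs.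
have pw : [exists u : s.-tuple (Sigma m k), min_image (@le m k) u (Tuple ws)].
  by apply/existsP; exists (Tuple us).
by exists (exist _ (Tuple ws) pw); apply/unicyclic_typeE; exists c.
Qed.

Lemma unicyclic_type_size A s m k (g : Gamma le s m k) c :
  unicyclic_type e A g -> unicyclic e A c -> size c = s.
Proof.
move=> /unicyclic_typeE[d [ds ud _]] uc; rewrite -[RHS]ds; apply: size_dihedral.
by case: ud => _ _; apply; case: uc.
Qed.

Lemma unicyclic_type_uniq A s m k (g h : Gamma le s m k) :
  unicyclic_type e A g -> unicyclic_type e A h -> g = h.
Proof.
move=> /unicyclic_typeE[c [cs uc mg]] /unicyclic_typeE[d [ds ud mh]].
apply/val_inj/val_inj; apply: (min_image_uniq (hle m k) mg).
have dc : d \in dihedral_images c by case: uc => _ _; apply; case: ud.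
by rewrite -(min_image_dihedral _ (cycle_word_image A m k (unicyclic_uniq uc) dc)).
Qed.

(** Projecting the letters of a minimal word need not give a minimal word, as the orders on types of
    different depths are unrelated; hence the second minimisation. *)
Lemma unicyclic_type_proj A s m k (h : Gamma le s m.+1 k) (g : Gamma le s m k) :
  unicyclic_type e A h -> unicyclic_type e A g <->
  min_image (@le m k) (map (@proj_type k m) (val h)) (val g).
Proof.
move=> /unicyclic_type_word[c [cs uc <-]].
have -> : map (@proj_type k m) (cycle_word A m.+1 k c) = cycle_word A m k c.
  rewrite /cycle_word -map_comp; apply/eq_in_map => x xc /=.
  have lx : linked (del_cycle e c) A x x.
    by apply: linked_refl; exact: (unicyclic_mem uc xc).
  apply: (tree_type_uniq (proj_typeP _ lx (hanging_typeP _ _ _ _ _))).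
    exact: del_cycle_irr.
  exact: hanging_typeP.
split=> [/unicyclic_typeE[d [ds ud mg]]|mg]; last by apply/unicyclic_typeE; exists c.
have dc : d \in dihedral_images c by case: uc => _ _; apply; case: ud.
by rewrite -(min_image_dihedral _ (cycle_word_image A m k (unicyclic_uniq uc) dc)).
Qed.

End OneGraph.

Lemma unicyclic_type_map (V' V : eqType) (f : V' -> V) (e' : rel V') (e : rel V)
    (A : set V') s m k (g : Gamma le s m k) :
  injective f -> symmetric e' -> irreflexive e' -> symmetric e -> irreflexive e ->
  embeds_on f e' e A ->
  unicyclic_type e (f @` A) g <-> unicyclic_type e' A g.
Proof.
move=> injf se' ie' se ie eA.
have fwd (h : Gamma le s m k) : unicyclic_type e' A h -> unicyclic_type e (f @` A) h.
  move=> /unicyclic_typeE[c [cs uc mh]]; apply/unicyclic_typeE; exists (map f c).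
  have cA z : z \in c -> A z by exact: (unicyclic_mem uc).
  split; [by rewrite size_map|by apply/(unicyclic_map injf eA cA)|].
  suff -> : cycle_word e (f @` A) m k (map f c) = cycle_word e' A m k c by [].
  have eA' : embeds_on f (del_cycle e' c) (del_cycle e (map f c)) A.
    by move=> x y Ax Ay; exact: (del_cycle_map injf (unicyclic_uniq uc) eA).
  rewrite /cycle_word -map_comp; apply/eq_in_map => x xc /=.
  apply: (tree_type_uniq (hanging_typeP _ _ _ _ _)).
  rewrite (linked_map injf x eA'); apply: (tree_type_map injf (del_cycle_irr (e := e') c ie')).
  - by apply: embeds_on_sub eA' => y /linked_end.
  - by apply: linked_refl; exact: cA.
  - exact: hanging_typeP.
split; last exact: fwd.
move=> hg; have /unicyclic_typeE[d [ds ud _]] := hg.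
have [c dE cA] : exists2 c, d = map f c & forall z, z \in c -> A z.
  by apply: seq_image => z; exact: (unicyclic_mem ud).
have uc : unicyclic e' A c by apply/(unicyclic_map injf eA cA); rewrite -dE.
have cs : size c = s by rewrite -ds dE size_map.
have [h hh] := unicyclic_type_ex m k uc cs.
by rewrite (unicyclic_type_uniq hg (fwd _ hh)).
Qed.

(** [SUP] ranges over whole graphs, whereas types occur on components; this turns a component into a
    graph of its own. *)
Lemma induced_graph (G : graph) (C : set G) : exists U : graph,
  forall s m k (g : Gamma le s m k),
    unicyclic_type (@adj U) [set: U] g <-> unicyclic_type (@adj G) C g.
Proof.
pose T : eqType := {x : G | `[< C x >]}.
pose a : rel T := fun x y => adj (val x) (val y).
have sa : symmetric a by move=> x y; exact: adj_sym.
have ia : irreflexive a by move=> x; exact: adj_irr.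
exists (Graph sa ia) => s m k g.
have CE : C = val @` [set: T].
  apply/seteqP; split => [x Cx|_ [[x Cx] _ <-]]; last exact/asboolP.
  by exists (exist _ x (asboolT Cx)).
rewrite [in X in _ <-> X]CE; apply: iff_sym.
have vinj : injective (val : T -> G) by exact: val_inj.
by apply: (unicyclic_type_map g vinj sa ia (@adj_sym G) (@adj_irr G)).
Qed.

Section Completions.
Variable k : nat.
Implicit Types G : graph.

Definition typed_components G s m (g : Gamma le s m k) : set (set G) :=
  [set C | components (@adj G) C /\ unicyclic_type (@adj G) C g].

Arguments typed_components G {s m} g.

Lemma completion_uniq G (i j : completion_index le k) :
  completion i G -> completion j G -> i = j.
Proof.
move=> hi hj; apply/val_inj/ffunP => -[[s m] g]; apply/val_inj.
have /= hi' := hi s m g; have /= hj' := hj s m g.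
by apply: (@capped_card_uniq {classic set G} _ k _ _ _ _ hi' hj');
  rewrite -ltnS ltn_ord.
Qed.

Lemma SUP_proj s m (g : Gamma le s m k) (h : Gamma le s m.+1 k) (G : graph) C :
  unicyclic_type (@adj G) C h -> SUP g h <-> unicyclic_type (@adj G) C g.
Proof.
move=> hC; split.
  case=> U [hU gU]; apply/(unicyclic_type_proj (@adj_sym _) (@adj_irr _) g hC).
  by apply/(unicyclic_type_proj (@adj_sym _) (@adj_irr _) g hU).
move=> gC; have [U hU] := induced_graph C.
by exists U; split; apply/hU.
Qed.

(** The capped counts of [G] form the index. They are consistent because the components of type [g]
    split according to their type one level deeper, and capping commutes with the sum. *)
Lemma completion_ex G : exists i : completion_index le k, completion i G.
Proof.
have ex (p : position le k) : exists j : 'I_k.+1,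
    capped_card (typed_components G (tagged p)) k j.
  have [j jk h] := @capped_card_ex {classic set G} (typed_components G (tagged p)) k.
  by exists (Ordinal (jk : j < k.+1)).
pose n : {ffun position le k -> 'I_k.+1} := [ffun p => projT1 (cid (ex p))].
have nP (p : position le k) : capped_card (typed_components G (tagged p)) k (n p).
  by rewrite ffunE; case: cid.
have nk p : n p <= k by rewrite -ltnS.
suff cn : consistent n.
  by exists (exist _ n (asboolT cn)) => s m g; exact: (nP (existT _ (s, m) g)).
move=> s m hm hm1 g.
apply: (@capped_card_uniq {classic set G} (typed_components G g) k).
- exact: nk.
- exact: geq_minr.
- exact: (nP (existT _ (s, Ordinal hm) g)).
have -> : typed_components G g = [set C | exists2 h, h \in index_enum _ &
    (h \in SUP g) /\ typed_components G h C].
  apply/seteqP; split => C /=.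
    move=> [cC gC]; have /unicyclic_typeE[c [cs uc _]] := gC.
    have [h hC] := unicyclic_type_ex m.+1 k uc cs.
    exists h; first exact: mem_index_enum.
    by split => //; apply/mem_set/(SUP_proj g hC).
  by case=> h _ [/set_mem hg [cC hC]]; split => //; apply/(SUP_proj g hC).
apply: (@capped_card_bigU {classic set G}); first exact: index_enum_uniq.
  by move=> h _ _; split; [exact: nk|exact: (nP (existT _ (s, Ordinal hm1) h))].
by move=> h h' C [_ hC] [_ h'C]; exact: unicyclic_type_uniq hC h'C.
Qed.

End Completions.
End UnicyclicTypes.

(** * Ehrenfeucht-Fraisse games *)

Section Games.
Variables (V W : eqType).
Implicit Types (A : set V) (B : set W).
Implicit Types (P M : seq (V * W)) (a b : V * W).

Definition atomic_iso (e : rel V) (e' : rel W) P := forall a b, a \in P -> b \in P ->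
  (a.1 == b.1) = (a.2 == b.2) /\ e a.1 b.1 = e' a.2 b.2.

(* Duplicator survives [j] more rounds from the position [P] of the game in *)
(* which the players choose vertices of [A] and [B].                        *)
Fixpoint game (e : rel V) (e' : rel W) A B (j : nat) P : Prop :=
  if j is j'.+1 then
    [/\ game e e' A B j' P,
        forall x, A x -> exists2 y, B y & game e e' A B j' ((x, y) :: P) &
        forall y, B y -> exists2 x, A x & game e e' A B j' ((x, y) :: P)]
  else atomic_iso e e' P.

Lemma game_eq_rel (e1 e : rel V) (e1' e' : rel W) A B j P :
  (forall x y, A x -> A y -> e x y = e1 x y) ->
  (forall x y, B x -> B y -> e' x y = e1' x y) ->
  (forall a, a \in P -> A a.1 /\ B a.2) ->
  game e1 e1' A B j P -> game e e' A B j P.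
Proof.
move=> eA eB; elim: j P => [|j IH] P PAB /=.
  move=> h a b aP bP; have [-> h2] := h a b aP bP; split => //.
  by have [? ?] := PAB a aP; have [? ?] := PAB b bP; rewrite eA // eB.
case=> g f b; split; first exact: IH.
- move=> x Ax; have [y By h] := f x Ax; exists y => //; apply: IH h => a.
  by rewrite inE => /orP[/eqP->|/PAB].
- move=> y By; have [x Ax h] := b y By; exists x => //; apply: IH h => a.
  by rewrite inE => /orP[/eqP->|/PAB].
Qed.

Lemma game_singleton (e : rel V) (e' : rel W) r r' j P : irreflexive e -> irreflexive e' ->
  (forall a, a \in P -> a = (r, r')) -> game e e' [set r] [set r'] j P.
Proof.
move=> ie ie'; elim: j P => [|j IH] P hP /=.
  by move=> a b /hP-> /hP->; rewrite !eqxx ie ie'.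
split; first exact: IH.
- by move=> x ->; exists r' => //; apply: IH => a; rewrite inE => /orP[/eqP|/hP].
- by move=> x ->; exists r => //; apply: IH => a; rewrite inE => /orP[/eqP|/hP].
Qed.

(* Duplicator's answer to the midpoint of a path splits the walk in two. *)
Lemma game_walk e e' A B j P a b p : game e e' A B j P -> a \in P -> b \in P ->
  walk e A a.1 p b.1 -> size p <= 2 ^ j -> truncation e' setT a.2 (2 ^ j) b.2.
Proof.
elim: j P a b p => [|j IH] P a b p.
  move=> g aP bP w; have [h1 h2] := g a b aP bP.
  case: p w => [|y [|//]] w _.
    have ab : a.1 = b.1 by case: w.
    have /eqP -> : a.2 == b.2 by rewrite -h1 ab eqxx.
    exact: truncation_root.
  have [Aa ay [_ yb _]] := (walk_consE _ _ _ _ _ _).1 w; rewrite /= in yb.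
  exists [:: b.2] => //; apply: walk_cons; [by []| |exact: walk_nil].
  by rewrite -h2 -yb.
case=> _ f _ aP bP w sp; rewrite -[p](cat_take_drop (2 ^ j)) in w.
have [w1 w2] := (walk_catE _ _ _ _ _ _).1 w.
have [y _ g] := f _ (walk_end w1); set z := last _ _ in w1 w2 g.
have zP : (z, y) \in (z, y) :: P by rewrite mem_head.
have aP' : a \in (z, y) :: P by rewrite inE aP orbT.
have bP' : b \in (z, y) :: P by rewrite inE bP orbT.
have [|q1 wq1 s1] := IH _ a (z, y) _ g aP' zP w1.
  by rewrite size_take_min geq_minl.
have [|q2 wq2 s2] := IH _ (z, y) b _ g zP bP' w2.
  by rewrite size_drop leq_subLR addnn -mul2n -expnS.
exists (q1 ++ q2); first exact: walk_cat wq2.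
by rewrite size_cat expnS mul2n -addnn leq_add.
Qed.

End Games.

Definition swap_pair (V W : Type) (a : V * W) : W * V := (a.2, a.1).

Lemma swap_pairK (V W : Type) : cancel (@swap_pair V W) (@swap_pair W V).
Proof. by case. Qed.

Lemma map_swapK (V W : Type) (P : seq (V * W)) :
  map (@swap_pair W V) (map (@swap_pair V W) P) = P.
Proof. exact: (mapK (@swap_pairK V W)). Qed.

Lemma mem_map_swap (V W : eqType) (P : seq (V * W)) (a : W * V) :
  (a \in map (@swap_pair V W) P) = (swap_pair a \in P).
Proof.
rewrite -[in LHS](swap_pairK a) mem_map //; exact: can_inj (@swap_pairK _ _).
Qed.

Lemma atomic_iso_swap (V W : eqType) (e : rel V) (e' : rel W) (P : seq (V * W)) :
  atomic_iso e e' P -> atomic_iso e' e (map (@swap_pair V W) P).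
Proof.
move=> h a b; rewrite !mem_map_swap => aP bP.
by have [-> ->] := h _ _ aP bP.
Qed.

Lemma game_swap (V W : eqType) (e : rel V) (e' : rel W) A B j (P : seq (V * W)) :
  game e e' A B j P -> game e' e B A j (map (@swap_pair V W) P).
Proof.
elim: j P => [|j IH] P /=; first exact: atomic_iso_swap.
case=> g f b; split; first exact: IH.
- by move=> y /b[x Ax h]; exists x => //; exact: IH h.
- by move=> y /f[x Ax h]; exists x => //; exact: IH h.
Qed.

(* A structure cut into parts indexed by their roots, in which every edge   *)
(* between two parts joins their roots.                                     *)
Definition rooted_parts (V : eqType) (e : rel V) (R : set V) (p : V -> set V) :=
  [/\ forall v, R v -> p v v,
      forall v v' x, R v -> R v' -> p v x -> p v' x -> v = v' &
      forall v v' x x', R v -> R v' -> v != v' -> p v x -> p v' x' -> e x x' ->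
        x = v /\ x' = v'].

Definition union_parts (V : eqType) (R : set V) (p : V -> set V) : set V :=
  [set x | exists2 v, R v & p v x].

(** * Composing games over parts joined at their roots *)

Section Composition.
Variables (V W : eqType) (e : rel V) (e' : rel W).
Variables (RA : set V) (RB : set W) (pA : V -> set V) (pB : W -> set W).
(* [Good j M]: the roots matched by [M] can be extended during [j] rounds.  *)
Variable Good : nat -> seq (V * W) -> Prop.

Definition good_matching := forall j M, Good j M ->
  atomic_iso e e' M /\ forall a, a \in M -> RA a.1 /\ RB a.2.

Definition good_step := forall j M v, Good j.+1 M -> RA v -> v \notin map fst M ->
  exists w, [/\ RB w, game e e' (pA v) (pB w) j.+1 [:: (v, w)]
                & Good j ((v, w) :: M)].

(** [Q a] collects the moves made inside the pair of parts rooted at [a], always including [a]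
    itself; together these sub-positions cover [P]. *)
Definition parts_state j M (Q : V * W -> seq (V * W)) (P : seq (V * W)) :=
  [/\ Good j M,
      forall a, a \in M -> [/\ a \in Q a, game e e' (pA a.1) (pB a.2) j (Q a) &
        forall b, b \in Q a -> pA a.1 b.1 /\ pB a.2 b.2] &
      forall b, b \in P -> exists2 a, a \in M & b \in Q a].

(** A vertex in a part already opened is answered in the game of that part. Otherwise its root is
    matched first, which costs nothing: [good_step] delivers the new subgame with [j.+1] rounds
    still to play from the root pair. *)
Lemma parts_forth j M Q P x : rooted_parts e RA pA -> rooted_parts e' RB pB ->
  good_matching -> good_step -> (forall j M, Good j.+1 M -> Good j M) ->
  parts_state j.+1 M Q P -> union_parts RA pA x ->
  exists M' Q' y, union_parts RB pB y /\ parts_state j M' Q' ((x, y) :: P).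
Proof.
move=> [rA _ _] [rB _ _] gM gS gD [gd hQ hP] [v Rv px].
have [_ MR] := gM _ _ gd.
have [/mapP[a aM va]|vM] := boolP (v \in map fst M).
  have [aQ [_ fw _] Qp] := hQ a aM.
  have [|y py gy] := fw x; first by rewrite -va.
  exists M, (fun b => if b == a then (x, y) :: Q a else Q b), y.
  have [_ Ra2] := MR a aM.
  split; first by exists a.2.
  split; first exact: gD.
  - move=> b bM; case: eqP => [->|_]; last first.
      by have [? [? _ _] ?] := hQ b bM; split.
    split; [by rewrite inE aQ orbT|exact: gy|move=> d].
    by rewrite inE => /orP[/eqP->|/Qp//]; split; rewrite //= -va.
  - move=> b; rewrite inE => /orP[/eqP->|/hP[d dM bd]].
      by exists a => //; rewrite eqxx mem_head.
    by exists d => //; case: eqP bd => // -> bd; rewrite inE bd orbT.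
have [w [Rw gvw gMw]] := gS _ _ _ gd Rv vM.
have [_ fw _] := gvw; have [y py gy] := fw x px.
exists ((v, w) :: M), (fun b => if b == (v, w) then [:: (x, y); (v, w)] else Q b), y.
split; first by exists w.
have vwM b : b \in M -> b != (v, w).
  by move=> bM; apply: contra vM => /eqP bv; rewrite -[v]/((v, w).1) -bv map_f.
split => //.
- move=> b; rewrite inE; case: eqP => [-> _|_ /= bM]; last first.
    by have [? [? _ _] ?] := hQ b bM; split.
  split; [by rewrite !inE eqxx orbT|exact: gy|move=> d].
  by rewrite !inE => /orP[] /eqP ->; split => //=; [exact: rA|exact: rB].
- move=> b; rewrite inE => /orP[/eqP->|/hP[d dM bd]].
    by exists (v, w); rewrite ?mem_head // eqxx mem_head.
  by exists d; rewrite ?inE ?dM ?orbT // (negbTE (vwM _ dM)).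
Qed.

(** Edges between different parts join roots, and each sub-position contains its root pair, so a
    chosen vertex is a root exactly when its answer is; adjacency then follows from the matching of
    the roots. *)
Lemma parts_atomic M Q P : rooted_parts e RA pA -> rooted_parts e' RB pB ->
  good_matching -> parts_state 0 M Q P -> atomic_iso e e' P.
Proof.
move=> [rA dA cA] [rB dB cB] gM [gd hQ hP] b b' /hP[a aM bQ] /hP[a' aM' bQ'].
have [at_ MR] := gM _ _ gd.
have [aQ ga Qa] := hQ a aM; have [aQ' ga' Qa'] := hQ a' aM'.
have [eqaa|naa] := eqVneq a a'; first by subst a'; exact: ga.
have [eq12 eaa] := at_ _ _ aM aM'.
have n1 : a.1 != a'.1.
  apply: contra naa => h; have := eq12; rewrite h => /esym/eqP h2.
  by rewrite [a]surjective_pairing [a']surjective_pairing (eqP h) h2.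
have n2 : a.2 != a'.2 by rewrite -eq12.
have [R1 R2] := MR _ aM; have [R1' R2'] := MR _ aM'.
have [p1 p2] := Qa _ bQ; have [p1' p2'] := Qa' _ bQ'.
have [hb1 _] := ga _ _ bQ aQ; have [hb1' _] := ga' _ _ bQ' aQ'.
split.
  have /negbTE -> : b.1 != b'.1.
    by apply: contra n1 => /eqP h; apply/eqP; apply: dA p1 _; rewrite // h.
  apply/esym/negbTE; apply: contra n2 => /eqP h; apply/eqP.
  by apply: dB p2 _; rewrite // h.
apply/idP/idP => h.
  have [h1 h2] := cA _ _ _ _ R1 R1' n1 p1 p1' h.
  move: hb1 hb1'; rewrite h1 h2 !eqxx => /esym/eqP -> /esym/eqP ->.
  by rewrite -eaa -h1 -h2.
have [h1 h2] := cB _ _ _ _ R2 R2' n2 p2 p2' h.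
move: hb1 hb1'; rewrite h1 h2 !eqxx => /eqP -> /eqP ->.
by rewrite eaa -h1 -h2.
Qed.

End Composition.

Lemma parts_state_swap (V W : eqType) (e : rel V) (e' : rel W) pA pB
    (Good : nat -> seq (V * W) -> Prop) j M Q P :
  parts_state e e' pA pB Good j M Q P ->
  parts_state e' e pB pA (fun j M => Good j (map (@swap_pair W V) M)) j
    (map (@swap_pair V W) M)
    (fun a => map (@swap_pair V W) (Q (swap_pair a))) (map (@swap_pair V W) P).
Proof.
move=> [gd hQ hP]; split; first by rewrite map_swapK.
- move=> a; rewrite mem_map_swap => /hQ[h1 h2 h3]; split.
  + by rewrite mem_map_swap.
  + exact: game_swap.
  + by move=> b; rewrite mem_map_swap => /h3[].
- move=> b; rewrite mem_map_swap => /hP[a aM bQ]; exists (swap_pair a).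
    by rewrite mem_map_swap swap_pairK.
  by rewrite mem_map_swap swap_pairK.
Qed.

(** Applied to a rooted tree, cut into its root and its branches, and to the surroundings of a
    cycle, cut into the trees hanging on it. There are two step hypotheses because Spoiler may move
    in either graph. *)
Lemma game_parts (V W : eqType) (e : rel V) (e' : rel W) RA RB pA pB
    (Good : nat -> seq (V * W) -> Prop) j M Q P :
  rooted_parts e RA pA -> rooted_parts e' RB pB ->
  good_matching e e' RA RB Good -> (forall j M, Good j.+1 M -> Good j M) ->
  good_step e e' RA RB pA pB Good ->
  good_step e' e RB RA pB pA (fun j M => Good j (map (@swap_pair W V) M)) ->
  parts_state e e' pA pB Good j M Q P ->
  game e e' (union_parts RA pA) (union_parts RB pB) j P.
Proof.
move=> hA hB gM gD gS gS'; elim: j M Q P => [|j IH] M Q P st /=.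
  exact: (parts_atomic hA hB gM st).
split.
- case: st => gd hQ hP; apply: (IH M Q); split => //; first exact: gD.
  by move=> a /hQ[? [? _ _] ?].
- move=> x Ax; have [M' [Q' [y [By st']]]] := parts_forth hA hB gM gS gD st Ax.
  by exists y => //; exact: IH st'.
- move=> y By; have st' := parts_state_swap st.
  have gM' : good_matching e' e RB RA (fun j M => Good j (map (@swap_pair W V) M)).
    move=> i N /gM[at_ h]; split.
      by rewrite -[N]map_swapK; exact: atomic_iso_swap.
    by move=> a aN; have [|] := h (swap_pair a); rewrite ?mem_map_swap ?swap_pairK.
  have gD' i N : Good i.+1 (map (@swap_pair W V) N) -> Good i (map (@swap_pair W V) N).
    exact: gD.
  have [M' [Q' [x [Ax /parts_state_swap st2]]]] := parts_forth hB hA gM' gS' gD' st' By.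
  exists x => //.
  have -> : (x, y) :: P = map (@swap_pair W V) ((y, x) :: map (@swap_pair V W) P).
    by rewrite /= map_swapK.
  apply: (IH (map (@swap_pair W V) M')).
  case: st2 => gd hQ hP; split; [|exact: hQ|exact: hP].
  by move: gd; rewrite map_swapK.
Qed.

Definition acyclic (V : eqType) (e : rel V) (A : set V) := forall c, ~ cycle_in e A c.

Lemma acyclic_sub (V : eqType) (e : rel V) (A B : set V) :
  B `<=` A -> acyclic e A -> acyclic e B.
Proof. by move=> BA h c [c3 uc cB]; apply: (h c); split => // z /cB /BA. Qed.

(** * Cutting a rooted tree at its root *)

Section TreeParts.
Variables (V : eqType) (e : rel V).
Hypotheses (se : symmetric e) (ie : irreflexive e).
Implicit Types (A B : set V) (r v x : V).

(** A simple walk between two distinct children that avoids [r] closes up to a cycle through [r]. *)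
Lemma acyclic_child B r v u : acyclic e B -> B r -> e r v -> e r u ->
  linked e (B `\ r) v u -> u = v.
Proof.
move=> ac Br erv eru [p w]; apply: contrapT => uv.
have [q [[pq lq qB] uq _ _]] := walk_uniq w.
apply: (ac (r :: v :: q)); split.
- by case: q lq {pq qB uq} => //= vu; case: uv.
- rewrite /ucycle (cons_uniq r) uq andbT; apply/andP; split.
    by rewrite /= erv rcons_path pq lq se.
  by apply/negP => /qB[_] /(_ erefl).
- by move=> z; rewrite inE => /orP[/eqP->//|/qB[]].
Qed.

Variables (A : set V) (r : V) (m : nat).
Hypothesis Ar : A r.
Let B := truncation e A r m.+1.

(** The root is a part of its own, so that the edges to its children join roots of parts. *)
Definition child_roots : set V := [set v | v = r \/ (B v /\ e r v)].

Definition child_parts (v : V) : set V :=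
  if v == r then [set r] else branch e B r v.

Lemma truncation_split x : B x -> x != r ->
  exists v p, [/\ B v, e r v, walk e (B `\ r) v p x & size p <= m].
Proof.
move=> [p w pm] xr; have [q [wq uq qp _]] := walk_uniq w.
have qm : size q <= m.+1 by exact: leq_trans pm.
have wB := truncation_walk wq qm.
case: q wB uq qm {wq qp} => [[_ rx _]|v q]; first by rewrite -rx eqxx in xr.
move=> /walk_consE[_ erv wv] /andP[rq _] qm; exists v, q; split => //.
  exact: walk_start wv.
apply: (walk_in _ wv) => z zq; split; first by case: wv => _ _; apply.
by move=> zr; rewrite -zr zq in rq.
Qed.

Lemma Br : B r. Proof. exact: truncation_root. Qed.

Lemma neq_root v : e r v -> v != r.
Proof. by apply: contraTneq => ->; rewrite ie. Qed.

Lemma union_child_parts : union_parts child_roots child_parts = B.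
Proof.
apply/seteqP; split => x.
  move=> [v Rv]; rewrite /child_parts; case: eqP => [_ ->|_]; first exact: Br.
  by move/linked_end => [].
move=> Bx; have [->|xr] := eqVneq x r.
  by exists r; [left|rewrite /child_parts eqxx].
have [v [p [Bv erv w _]]] := truncation_split Bx xr.
exists v; first by right.
by rewrite /child_parts (negbTE (neq_root erv)); exists p.
Qed.

Hypothesis acB : acyclic e B.

Lemma rooted_child_parts : rooted_parts e child_roots child_parts.
Proof.
have BrP := Br.
split.
- move=> v [->|[Bv erv]]; rewrite /child_parts ?eqxx //.
  rewrite (negbTE (neq_root erv)); apply: linked_refl; split => //.
  exact/eqP/neq_root.
- move=> v v' x; rewrite /child_parts; case: (eqVneq v r) => [->|vr].
    case: (eqVneq v' r) => [->//|_ _ _ -> /linked_end[_ h]]; by case: h.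
  case: (eqVneq v' r) => [-> _ _ /linked_end[_ h] h'|v'r]; first by case: h.
  case=> [/eqP|[Bv erv]]; first by rewrite (negbTE vr).
  case=> [/eqP|[Bv' erv']]; first by rewrite (negbTE v'r).
  move=> h h'; apply/esym; apply: (acyclic_child acB BrP erv erv').
  exact: linked_trans h (linked_sym se h').
- move=> v v' x x'; rewrite /child_parts; case: (eqVneq v r) => [->|vr].
    case: (eqVneq v' r) => [->|v'r] _; first by move=> _ /=.
    case=> [/eqP|[Bv' erv']]; first by rewrite (negbTE v'r).
    move=> _ -> l erx'; split => //.
    exact: (acyclic_child acB BrP erv' erx' l).
  case: (eqVneq v' r) => [->|v'r].
    case=> [/eqP|[Bv erv]]; first by rewrite (negbTE vr).
    move=> _ _ l -> exr; split => //.
    by apply: (acyclic_child acB BrP erv _ l); rewrite se.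
  case=> [/eqP|[Bv erv]]; first by rewrite (negbTE vr).
  case=> [/eqP|[Bv' erv']]; first by rewrite (negbTE v'r).
  move=> vv' l l' exx'; exfalso; move/eqP: vv'; apply; apply/esym.
  apply: (acyclic_child acB BrP erv erv').
  apply: (linked_trans l); apply: (linked_trans _ (linked_sym se l')).
  by apply: linked1 => //; [exact: linked_end l|exact: linked_end l'].
Qed.

(** In a tree the simple walk from [r] to a vertex of the branch enters through [v], so inside the
    truncation at depth [m.+1] the branch has depth [m]. The induction on depth thereby applies to
    whole branches. *)
Lemma truncation_branch v : B v -> e r v ->
  truncation e (branch e B r v) v m = branch e B r v.
Proof.
move=> Bv erv; apply/seteqP; split => x; first exact: truncation_sub.
move=> lx; have [Bx /eqP xr] := linked_end lx.
have [u [p [Bu eru w pm]]] := truncation_split Bx xr.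
have uv : u = v.
  apply: (acyclic_child acB Br erv eru).
  by apply: linked_trans lx (linked_sym se _); exists p.
by subst u; exists p => //; exact: walk_linkedin.
Qed.

End TreeParts.

Lemma count_ltn (T : eqType) (a : pred T) (s : seq T) x :
  x \in s -> ~~ a x -> count a s < size s.
Proof.
move=> xs ax; rewrite -(count_predC a s) -[X in X < _]addn0 ltn_add2l -has_count.
by apply/hasP; exists x.
Qed.

(** The root pair takes up one place in [M], whence the bound [k.+1]: with [j] rounds left at most
    [k - j] children are matched. *)
Definition child_matching (V W : eqType) (e : rel V) (e' : rel W) k A r A' r' m
    (j : nat) (M : seq (V * W)) : Prop :=
  [/\ (r, r') \in M, atomic_iso e e' M, size M + j <= k.+1 &
      forall a, a \in M -> a != (r, r') -> exists t : Sigma m k,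
        typed_children e A r t a.1 /\ typed_children e' A' r' t a.2].

Lemma child_matching_swap (V W : eqType) (e : rel V) (e' : rel W) k A r A' r' m j
    (M : seq (V * W)) :
  child_matching e e' k A r A' r' m j M ->
  child_matching e' e k A' r' A r m j (map (@swap_pair V W) M).
Proof.
move=> [h1 h2 h3 h4]; split; [by rewrite mem_map_swap|exact: atomic_iso_swap|by rewrite size_map|].
move=> a; rewrite mem_map_swap => /h4 h ar; have [|t [? ?]] := h; last by exists t.
by apply: contra ar => /eqP; case: (a) => x y [-> ->].
Qed.

(** Fewer than [k] children of type [t] are matched when a further one has to be answered, and both
    roots have the same capped number of them, so an unmatched one exists on the other side.
    Children are pairwise non-adjacent, so the matching remains an isomorphism. *)
Lemma child_step (V W : eqType) (e : rel V) (e' : rel W) k A r A' r' m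
    (s : Sigma m.+1 k) :
  symmetric e -> irreflexive e -> symmetric e' -> irreflexive e' ->
  A r -> A' r' -> acyclic e (truncation e A r m.+1) ->
  acyclic e' (truncation e' A' r' m.+1) ->
  tree_type e A r s -> tree_type e' A' r' s ->
  (forall v w (t : Sigma m k) j, typed_children e A r t v ->
    typed_children e' A' r' t w -> j <= k ->
    game e e' (child_parts e A r m v) (child_parts e' A' r' m w) j [:: (v, w)]) ->
  good_step e e' (child_roots e A r m) (child_roots e' A' r' m)
    (child_parts e A r m) (child_parts e' A' r' m)
    (child_matching e e' k A r A' r' m).
Proof.
move=> se ie se' ie' Ar A'r' acA acA' hA hA' IH j M v gM.
have [rM at_ sM tM] := gM => -[->|[Bv erv]] vM.
  by move/negP: vM; case; rewrite -[r]/((r, r').1) map_f.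
set B := truncation e A r m.+1 in Bv acA *.
have [t ht] := tree_type_ex k e (branch e B r v) v m.
have vt : typed_children e A r t v by split.
pose Mt := [seq a <- M | `[< typed_children e A r t a.1 >]].
have Mtr (a : V * W) : a \in Mt -> a != (r, r').
  rewrite mem_filter => /andP[/asboolP[_ h _] _]; apply/eqP => ar.
  by rewrite ar ie in h.
have Mt2 (a : V * W) : a \in Mt ->
    typed_children e A r t a.1 /\ typed_children e' A' r' t a.2.
  move=> aM; have := Mtr a aM; move: aM; rewrite mem_filter => /andP[/asboolP h aM].
  move=> /(tM a aM)[u [h1 h2]]; split => //.
  by case: h h1 => _ _ h [_ _ h']; rewrite (tree_type_uniq h h').
have sMt : size Mt < k.
  rewrite size_filter.
  (* [M] contains the root pair, which is no child of type [t]; this makes the bound strict. *)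
  have : count (fun a => `[< typed_children e A r t a.1 >]) M < size M.
    apply: (count_ltn rM); apply/negP => /asboolP[_ h _].
    by rewrite /= ie in h.
  by lia.
have tk : s t <= k by rewrite -ltnS.
have Minj : {in Mt &, forall a b, a.1 = b.1 <-> a.2 = b.2}.
  move=> a b; rewrite !mem_filter => /andP[_ aM] /andP[_ bM].
  by have [h _] := at_ a b aM bM; split => /eqP; [rewrite h|rewrite -h] => /eqP.
have vMt : v \notin map fst Mt.
  by apply: contra vM => /mapP[a]; rewrite mem_filter => /andP[_ aM] ->; rewrite map_f.
have [w [B'w er'w hw] wM] := capped_card_match tk (hA t) (hA' t) Minj Mt2 sMt vt vMt.
have wt : typed_children e' A' r' t w by split.
have vr := neq_root ie erv; have wr' := neq_root ie' er'w.
have wM2 : w \notin map snd M.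
  apply: contra wM => /mapP[a aM wa].
  have [ar|ar] := eqVneq a (r, r'); first by rewrite wa ar eqxx in wr'.
  have [u [h1 h2]] := tM a aM ar.
  have ut : u = t by case: h2 => _ _; rewrite -wa => h2; exact: tree_type_uniq h2 hw.
  rewrite wa map_f // mem_filter aM andbT; apply/asboolP; by rewrite -ut.
exists w; split.
- by right.
- have M0 : 0 < size M by case: (M) rM.
  by apply: IH vt wt _; lia.
split.
- by rewrite inE rM orbT.
- have [_ hp1 hp2] := rooted_child_parts se ie Ar acA.
  have [_ hp1' hp2'] := rooted_child_parts se' ie' A'r' acA'.
  have key a : a \in M -> (v == a.1) = (w == a.2) /\ e v a.1 = e' w a.2.
    move=> aM; split.
      rewrite (_ : v == a.1 = false); last first.
        by apply/negbTE; apply: contra vM => /eqP ->; rewrite map_f.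
      apply/esym/negbTE; apply: contra wM2 => /eqP ->; by rewrite map_f.
    have [->|ar] := eqVneq a (r, r'); first by rewrite /= se erv se' er'w.
    have [u [[h1 h2 _] [h3 h4 _]]] := tM a aM ar.
    have [rp _ _] := rooted_child_parts se ie Ar acA.
    have [rp' _ _] := rooted_child_parts se' ie' A'r' acA'.
    rewrite (_ : e v a.1 = false); last first.
      apply/negbTE/negP => h.
      have va : v != a.1 by apply: contra vM => /eqP ->; rewrite map_f.
      have Rv : child_roots e A r m v by right.
      have Ra : child_roots e A r m a.1 by right.
      have lv := rp _ Rv; rewrite /child_parts (negbTE vr) in lv.
      have la := rp _ Ra; rewrite /child_parts (negbTE (neq_root ie h2)) in la.
      move/eqP: va; apply; apply: (acyclic_child se acA (Br _ _ Ar) h2 erv).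
      apply: (linked_trans la); apply: linked1; [exact: linked_end la|exact: linked_end lv|by rewrite se].
    apply/esym/negbTE/negP => h.
    have wa : w != a.2 by apply: contra wM2 => /eqP ->; rewrite map_f.
    have Rw : child_roots e' A' r' m w by right.
    have Ra : child_roots e' A' r' m a.2 by right.
    have lw := rp' _ Rw; rewrite /child_parts (negbTE wr') in lw.
    have la := rp' _ Ra; rewrite /child_parts (negbTE (neq_root ie' h4)) in la.
    move/eqP: wa; apply; apply: (acyclic_child se' acA' (Br _ _ A'r') h4 er'w).
    apply: (linked_trans la); apply: linked1; [exact: linked_end la|exact: linked_end lw|by rewrite se'].
  move=> a b; rewrite !inE => /orP[/eqP->|aM] /orP[/eqP->|bM] /=.
  + by rewrite !eqxx ie ie'.
  + exact: key.
  + by have [h1 h2] := key a aM; rewrite se se' (eq_sym a.1) (eq_sym a.2).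
  + exact: at_.
- by move: sM; rewrite /= addSnnS.
- move=> a; rewrite inE => /orP[/eqP-> _|aM ar]; last exact: tM.
  by exists t.
Qed.

(** A game of [k] rounds cannot count children beyond [k], so capped types carry all that it sees;
    induction on the depth, cutting at the root. *)
Lemma tree_game (V W : eqType) (e : rel V) (e' : rel W) k m A r A' r'
    (s : Sigma m k) j :
  symmetric e -> irreflexive e -> symmetric e' -> irreflexive e' ->
  A r -> A' r' -> acyclic e (truncation e A r m) ->
  acyclic e' (truncation e' A' r' m) ->
  tree_type e A r s -> tree_type e' A' r' s -> j <= k ->
  game e e' (truncation e A r m) (truncation e' A' r' m) j [:: (r, r')].
Proof.
move=> se ie se' ie'; elim: m A r A' r' s j => [|m IH] A r A' r' s j Ar A'r' acA acA'.
  move=> _ _ _.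
  have tr0 (X : eqType) (f : rel X) D x : D x -> truncation f D x 0 = [set x].
    move=> Dx; apply/seteqP; split => y; last by move=> ->; exact: truncation_root.
    by case=> -[|//] [_ <- _].
  rewrite !tr0 //; apply: game_singleton => // a.
  by rewrite inE => /eqP.
move=> hA hA' jk.
have IH' v w (t : Sigma m k) i : typed_children e A r t v ->
    typed_children e' A' r' t w -> i <= k ->
    game e e' (child_parts e A r m v) (child_parts e' A' r' m w) i [:: (v, w)].
  move=> [Bv erv hv] [Bw er'w hw] ik.
  have vr := neq_root ie erv; have wr' := neq_root ie' er'w.
  rewrite /child_parts (negbTE vr) (negbTE wr').
  rewrite -(truncation_branch se Ar acA Bv erv) -(truncation_branch se' A'r' acA' Bw er'w).
  apply: IH hv hw ik.
  - by apply: linked_refl; split => //; exact/eqP.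
  - by apply: linked_refl; split => //; exact/eqP.
  - by apply: acyclic_sub acA => x /truncation_sub /linked_end[].
  - by apply: acyclic_sub acA' => x /truncation_sub /linked_end[].
rewrite -(union_child_parts ie m Ar) -(union_child_parts ie' m A'r').
apply: (game_parts (Good := child_matching e e' k A r A' r' m)
  (M := [:: (r, r')]) (Q := fun _ => [:: (r, r')])).
- exact: rooted_child_parts.
- exact: rooted_child_parts.
- move=> i M [rM at_ _ tM]; split => // a aM.
  have [->|/(tM a aM)[t [[? ? _] [? ? _]]]] := eqVneq a (r, r'); first by split; left.
  by split; right.
- by move=> i M [h1 h2 h3 h4]; split => //; apply: leq_trans h3; rewrite leq_add2l.
- exact: child_step hA hA' IH'.
- move=> i M v /child_matching_swap; rewrite map_swapK => gM Rv vM.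
  have := @child_step _ _ e' e k A' r' A r m s se' ie' se ie A'r' Ar acA' acA hA' hA.
  move=> /(_ _ i M v gM Rv vM)[].
    move=> w u t l hw hu lk; have := game_swap (IH' u w t l hu hw lk); exact.
  by move=> w [Rw gw /child_matching_swap gM']; exists w; split.
- split.
  + split; [by rewrite mem_head| |by rewrite /= add1n ltnS|].
      by move=> a b; rewrite !inE => /eqP-> /eqP->; rewrite !eqxx ie ie'.
    by move=> a; rewrite inE => ->.
  + move=> a; rewrite inE => /eqP->.
    rewrite (_ : child_parts _ _ _ _ _ = [set r]); last by rewrite /child_parts eqxx.
    rewrite (_ : child_parts _ _ _ _ _ = [set r']); last by rewrite /child_parts eqxx.
    split; first exact: eqxx.
      by apply: game_singleton => // b; rewrite inE => /eqP.
    by move=> b; rewrite inE => /eqP ->; split; exact: erefl.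
  + move=> b bP; exists (r, r') => //; exact: mem_head.
Qed.

(** * The surroundings of a cycle in a unicyclic graph *)

Section UnicyclicParts.
Variables (V : eqType) (e : rel V) (A : set V) (c : seq V).
Hypotheses (se : symmetric e) (ie : irreflexive e) (uc : unicyclic e A c).
Let e1 := del_cycle e c.
Implicit Types (v x y : V).

Lemma del_cycle_sub x y : e1 x y -> e x y.
Proof. by rewrite /e1 del_cycleE => /andP[]. Qed.

Lemma cycle_edge x : x \in c -> e x (next c x).
Proof. by have [_ [_ /andP[cc _] _] _] := uc; exact: next_cycle. Qed.

Lemma consecutive_edge x y : consecutive c x y -> e x y.
Proof. by case/orP => /andP[h /eqP->]; [|rewrite se]; exact: cycle_edge. Qed.

(** By uniqueness every cycle of [A] has its edges among those of [c], which are deleted. *)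
Lemma acyclic_del_cycle : acyclic e1 A.
Proof.
move=> d [d3 /andP[cd ud] dA].
have hd : cycle_in e A d.
  split => //; rewrite /ucycle ud andbT.
  by case: (d) cd => //= x p; apply: sub_path => u w; exact: del_cycle_sub.
have [x xd] : exists x, x \in d by case: (d) d3 => // x l _; exists x; exact: mem_head.
have := next_cycle cd xd; rewrite /e1 del_cycleE.
by rewrite (unicyclic_consecutive uc hd xd) andbF.
Qed.

(* A path avoiding the cycle edges, closed up by an arc of [c], would be a    *)
(* second cycle.                                                              *)
Lemma linked_del_cycle v v' : v \in c -> v' \in c -> linked e1 A v v' -> v = v'.
Proof.
move=> vc v'c [p /walk_uniq[[|z q] [w uq _ _]]]; first by case: w.
have ucc := unicyclic_uniq uc.
apply: contrapT => vv'; have [i l ecl] := rot_to vc.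
have ul : uniq (v :: l) by rewrite -ecl rot_uniq.
have v'l : v' \in l.
  by have := v'c; rewrite -(mem_rot i) ecl inE => /orP[/eqP h|//]; case: vv'.
have pl : path e v l.
  have [_ [_ /andP[cc _] _] _] := uc.
  by move: cc; rewrite -(rot_cycle i) ecl /= rcons_path => /andP[].
have lc x : x \in l -> x \in c by move=> xl; rewrite -(mem_rot i) ecl inE xl orbT.
have nl : next c v = head v l.
  by rewrite -(next_rot i ucc) ecl; case: (l) => [|u t] /=; rewrite eqxx.
case/path.splitP: v'l ul pl lc nl => l1 l2 ul pl lc nl.
have [u [l' el]] : exists u l', rcons l1 v' = u :: l'.
  by case: (l1) => [|u l']; [exists v', [::]|exists u, (rcons l' v')].
have pu : path e v (u :: l') by move: pl; rewrite -el cat_path => /andP[].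
have uu : uniq (v :: u :: l').
  by move: ul; rewrite -el -cat_cons cat_uniq => /andP[].
have nu : next c v = u by rewrite nl el.
have [/= /andP[e1vz pz] lz wA] := w.
have pz' : path e v (z :: q).
  rewrite /= (del_cycle_sub e1vz) /=.
  by apply: sub_path pz => x y; exact: del_cycle_sub.
have zu : z <> u.
  move=> zu; move: e1vz; rewrite /e1 del_cycleE => /andP[_ /negP]; apply.
  by rewrite /consecutive vc nu zu eqxx.
have lq : last z q = last u l'.
  by rewrite lz -[RHS]/(last v (u :: l')) -el last_rcons.
have [d [ud sd dsub]] := two_paths_cycle se pz' pu uq uu zu lq.
have dA : cycle_in e A [:: v, z & d].
  split => //; first by have /andP[] := sd; case: (d).
  move=> x /dsub; rewrite mem_cat => /orP[/wA//|xl].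
  apply: (unicyclic_mem uc); apply: lc; rewrite mem_cat el.
  by rewrite xl.
have := unicyclic_consecutive uc dA (mem_head _ _); rewrite /= eqxx => h.
by move: e1vz; rewrite /e1 del_cycleE h andbF.
Qed.

Variable m : nat.

Definition hanging_tree v : set V := truncation e1 (linked e1 A v) v m.

Lemma hanging_tree_linked v x : hanging_tree v x -> linked e1 A v x.
Proof. exact: truncation_sub. Qed.

(** An edge between two hanging trees that is not an edge of [c] would link two cycle vertices after
    the deletion of the cycle edges. *)
Lemma rooted_hanging_trees : rooted_parts e [set v | v \in c] hanging_tree.
Proof.
have s1 := del_cycle_sym c se.
split.
- by move=> v vc; apply/truncation_root/linked_refl; exact: (unicyclic_mem uc).
- move=> v v' x vc v'c /hanging_tree_linked l /hanging_tree_linked l'.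
  apply: linked_del_cycle => //; exact: linked_trans l (linked_sym s1 l').
- move=> v v' x x' vc v'c /eqP vv' /hanging_tree_linked l /hanging_tree_linked l' exx'.
  have [h|h] := boolP (consecutive c x x'); last first.
    case: vv'; apply: linked_del_cycle => //; apply: (linked_trans l).
    apply: (linked_trans _ (linked_sym s1 l')); apply: linked1.
    + exact: linked_end l.
    + exact: linked_end l'.
    + by rewrite del_cycleE exx'.
  have /andP[xc x'c] := consecutive_mem h.
  by split; apply/esym; exact: linked_del_cycle.
Qed.

Lemma hanging_tree_edge v x y : v \in c -> hanging_tree v x -> hanging_tree v y ->
  e x y = e1 x y.
Proof.
move=> vc /hanging_tree_linked lx /hanging_tree_linked ly; rewrite /e1 del_cycleE.
case: (boolP (consecutive c x y)) => h; last by rewrite andbT.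
have /andP[xc yc] := consecutive_mem h.
by rewrite -(linked_del_cycle vc xc lx) -(linked_del_cycle vc yc ly) ie.
Qed.

(** A chord would survive the deletion of the cycle edges and link two vertices of [c]. *)
Lemma edge_consecutive x y : x \in c -> y \in c -> e x y = consecutive c x y.
Proof.
move=> xc yc; apply/idP/idP; last exact: consecutive_edge.
move=> exy; apply/negPn/negP => h; have xy : x = y.
  apply: linked_del_cycle => //; apply: linked1; try exact: (unicyclic_mem uc).
  by rewrite /e1 del_cycleE exy.
by rewrite xy ie in exy.
Qed.

(** Each visit of the walk to [c] restarts the count at the vertex visited, and between visits no
    edge of [c] is used; so the depth in the hanging tree never exceeds the length of the walk. *)
Lemma near_cycle v p x : v \in c -> walk e A v p x -> size p <= m ->
  union_parts [set v | v \in c] hanging_tree x.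
Proof.
move=> vc; rewrite /hanging_tree; elim/last_ind: p x m => [|p y IH] x n w sp.
  have [_ <- _] := w; exists v => //.
  by apply/truncation_root/linked_refl; exact: (unicyclic_mem uc).
have Ax := walk_end w.
move: w; rewrite -cats1 => /walk_catE[w1]; set z := last v p in w1 *.
move=> /walk_consE[_ ezy [_ yx _]]; rewrite /= in yx; subst y.
rewrite size_rcons in sp; case: n sp => // n sp.
have [xc|xc] := boolP (x \in c).
  by exists x => //; apply/truncation_root/linked_refl.
have [u uc' [q wq sq]] := IH _ _ w1 sp.
have e1zx : e1 z x.
  rewrite /e1 del_cycleE ezy; apply: contra xc => /consecutive_mem/andP[] //.
exists u => //; exists (rcons q x); last by rewrite size_rcons.
apply: (walk_rcons wq e1zx); apply: (linked_trans (walk_end wq)).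
by apply: linked1 => //; exact: walk_end w1.
Qed.

End UnicyclicParts.

Lemma mem_zipP (V W : eqType) (c : seq V) (d : seq W) a x0 y0 : size c = size d ->
  a \in zip c d ->
  exists i, [/\ i < size c, a.1 = nth x0 c i & a.2 = nth y0 d i].
Proof.
move=> cd /(nthP (x0, y0))[i]; rewrite size_zip -cd minnn => ic <-.
by exists i; rewrite nth_zip.
Qed.

Lemma zip_map_fst (V W : eqType) (c : seq V) (d : seq W) : size c = size d ->
  map fst (zip c d) = c.
Proof. by move=> cd; apply: unzip1_zip; rewrite cd. Qed.

Lemma zip_map_snd (V W : eqType) (c : seq V) (d : seq W) : size c = size d ->
  map snd (zip c d) = d.
Proof. by move=> cd; apply: unzip2_zip; rewrite cd. Qed.

Lemma zip_swap (V W : eqType) (c : seq V) (d : seq W) :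
  map (@swap_pair V W) (zip c d) = zip d c.
Proof. by elim: c d => [|x c IH] [|y d] //=; rewrite IH. Qed.

Lemma next_nth_mod (V : eqType) (c : seq V) x0 i : uniq c -> i < size c ->
  next c (nth x0 c i) = nth x0 c (i.+1 %% size c).
Proof.
move=> uc ic; rewrite next_nth mem_nth // index_uniq //.
case: c uc ic => //= y c uc ic.
have [iE|iE] := eqVneq i (size c).
  by rewrite iE nth_default // modnn.
have ic' : i < size c by rewrite ltn_neqAle iE.
by rewrite modn_small ?ltnS //= (set_nth_default x0).
Qed.

Lemma consecutive_nth (V W : eqType) (c : seq V) (d : seq W) x0 y0 i j :
  uniq c -> uniq d -> size c = size d -> i < size c -> j < size c ->
  consecutive c (nth x0 c i) (nth x0 c j) = consecutive d (nth y0 d i) (nth y0 d j).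
Proof.
move=> uc ud cd ic jc; have id : i < size d by rewrite -cd.
have jd : j < size d by rewrite -cd.
rewrite /consecutive !mem_nth // !next_nth_mod // !nth_uniq ?cd //;
by rewrite ltn_mod; apply: leq_ltn_trans id.
Qed.

(** All roots are matched from the start, so [Good] merely freezes the matching [zip c c'], and the
    steps that would open a new part are vacuous. *)
Lemma unicyclic_game (V W : eqType) (e : rel V) (e' : rel W) k m A A' c c' j :
  symmetric e -> irreflexive e -> symmetric e' -> irreflexive e' ->
  unicyclic e A c -> unicyclic e' A' c' ->
  cycle_word e A m k c = cycle_word e' A' m k c' -> j <= k ->
  game e e' (union_parts [set v | v \in c] (hanging_tree e A c m))
    (union_parts [set v | v \in c'] (hanging_tree e' A' c' m)) j (zip c c').
Proof.
move=> se ie se' ie' uc uc' cw jk.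
have cc' : size c = size c' by have := congr1 size cw; rewrite !size_map.
have ucc := unicyclic_uniq uc; have ucc' := unicyclic_uniq uc'.
pose Good (i : nat) (M : seq (V * W)) := M = zip c c' /\ i <= k.
have zat : atomic_iso e e' (zip c c').
  move=> a b aP bP.
  have [i [ic -> ->]] := mem_zipP a.1 a.2 cc' aP.
  have [l [lc -> ->]] := mem_zipP a.1 a.2 cc' bP.
  rewrite !nth_uniq -?cc' //; split => //.
  rewrite (edge_consecutive se ie uc) ?mem_nth //.
  rewrite (edge_consecutive se' ie' uc') ?mem_nth -?cc' //.
  exact: consecutive_nth.
have zR a : a \in zip c c' -> a.1 \in c /\ a.2 \in c'.
  move=> az; rewrite -{1}(zip_map_fst cc') -{2}(zip_map_snd cc').
  by split; exact: map_f.
apply: (game_parts (Good := Good) (M := zip c c') (Q := fun a => [:: a])).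
- exact: rooted_hanging_trees.
- exact: rooted_hanging_trees.
- by move=> i M [-> _]; split.
- by move=> i M [-> /ltnW].
- by move=> i M v [-> _] vc; rewrite (zip_map_fst cc') vc.
- move=> i M v [/(congr1 (map (@swap_pair V W))) + _] vc.
  by rewrite map_swapK zip_swap => ->; rewrite zip_map_fst // vc.
- split => //; last by move=> b bP; exists b => //; exact: mem_head.
  move=> a aP; have [ac ac'] := zR a aP.
  have la : linked (del_cycle e c) A a.1 a.1.
    by apply: linked_refl; exact: (unicyclic_mem uc).
  have la' : linked (del_cycle e' c') A' a.2 a.2.
    by apply: linked_refl; exact: (unicyclic_mem uc').
  have ab b : b \in [:: a] ->
      hanging_tree e A c m a.1 b.1 /\ hanging_tree e' A' c' m a.2 b.2.
    by rewrite inE => /eqP->; split; exact: truncation_root.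
  split => //; first exact: mem_head.
  apply: (game_eq_rel (e1 := del_cycle e c) (e1' := del_cycle e' c')) => //.
  + by move=> x y; exact: hanging_tree_edge.
  + by move=> x y; exact: hanging_tree_edge.
  rewrite [a]surjective_pairing.
  apply: (tree_game (k := k) (s := hanging_type (del_cycle e c) A m k a.1)) => //.
  + exact: del_cycle_sym.
  + exact: del_cycle_irr.
  + exact: del_cycle_sym.
  + exact: del_cycle_irr.
  + apply: acyclic_sub (acyclic_del_cycle uc) => x.
    by move=> /truncation_sub /linked_end.
  + apply: acyclic_sub (acyclic_del_cycle uc') => x.
    by move=> /truncation_sub /linked_end.
  + exact: hanging_typeP.
  + have [i [ic -> ->]] := mem_zipP a.1 a.2 cc' aP.
    have := congr1 (fun w => nth (hanging_type e A m k a.1) w i) cw.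
    rewrite !(nth_map a.1, nth_map a.2) -?cc' // => ->.
    exact: hanging_typeP.
Qed.

(** * Local games *)

Section LocalGame.
Variables (V W : eqType) (e : rel V) (e' : rel W).
Implicit Types (P Q : seq (V * W)) (a b : V * W).

Definition vball (X : eqType) (f : rel X) (x : X) (n : nat) : set X :=
  truncation f setT x n.

(** Spoiler may only move within distance [2 ^ j'] of a vertex already chosen. Positions far apart
    thus do not interact, and moves elsewhere are left to the global strategy. *)
Fixpoint local_game (j : nat) P : Prop :=
  if j is j'.+1 then
    [/\ local_game j' P,
        forall a x, a \in P -> vball e a.1 (2 ^ j') x ->
          exists2 y, vball e' a.2 (2 ^ j') y & local_game j' ((x, y) :: P) &
        forall a y, a \in P -> vball e' a.2 (2 ^ j') y ->
          exists2 x, vball e a.1 (2 ^ j') x & local_game j' ((x, y) :: P)]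
  else atomic_iso e e' P.

Lemma local_game_sub j P Q : {subset Q <= P} -> local_game j P -> local_game j Q.
Proof.
elim: j P Q => [|j IH] P Q sQ /=; first by move=> h a b /sQ ? /sQ; exact: h.
case=> g f b; split; first exact: IH g.
- move=> a x /sQ aP /(f a x aP)[y By h]; exists y => //; apply: IH h => z.
  by rewrite !inE; case/orP => [->//|/sQ->]; rewrite orbT.
- move=> a x /sQ aP /(b a x aP)[y By h]; exists y => //; apply: IH h => z.
  by rewrite !inE; case/orP => [->//|/sQ->]; rewrite orbT.
Qed.

Lemma local_game_le i j P : i <= j -> local_game j P -> local_game i P.
Proof. by move=> /subnK <-; elim: (j - i) => //= n IH [g _ _]; exact: IH. Qed.

End LocalGame.

Lemma local_game_swap (V W : eqType) (e : rel V) (e' : rel W) j (P : seq (V * W)) :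
  local_game e e' j P -> local_game e' e j (map (@swap_pair V W) P).
Proof.
elim: j P => [|j IH] P /=; first exact: atomic_iso_swap.
case=> g f b; split; first exact: IH.
- move=> a x; rewrite mem_map_swap => aP /(b _ _ aP)[y By h].
  by exists y => //; exact: IH h.
- move=> a x; rewrite mem_map_swap => aP /(f _ _ aP)[y By h].
  by exists y => //; exact: IH h.
Qed.

Lemma vball_refl (V : eqType) (e : rel V) x n : vball e x n x.
Proof. exact: truncation_root. Qed.

Lemma vball_trans (V : eqType) (e : rel V) x y z m n :
  vball e x m y -> vball e y n z -> vball e x (m + n) z.
Proof.
move=> [p wp pm] [q wq qn]; exists (p ++ q); first exact: walk_cat wq.
by rewrite size_cat leq_add.
Qed.

Lemma vball_sym (V : eqType) (e : rel V) x y n : symmetric e ->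
  vball e x n y -> vball e y n x.
Proof. by move=> se [p /(walk_rev se)[q sq wq] pn]; exists q; rewrite ?sq. Qed.

Lemma vball_le (V : eqType) (e : rel V) x m n : m <= n -> vball e x m `<=` vball e x n.
Proof. exact: truncation_le. Qed.

Lemma vball1 (V : eqType) (e : rel V) x y : e x y -> vball e x 1 y.
Proof. by move=> exy; apply: truncation_child. Qed.

(** A move within [2 ^ j] of one position stays farther than [2 ^ j] from the other, since the two
    were more than [2 ^ j.+1] apart. At the end a distance above one excludes equality and
    adjacency. *)
Lemma local_game_cat (V W : eqType) (e : rel V) (e' : rel W) j (P Q : seq (V * W)) :
  symmetric e -> symmetric e' -> local_game e e' j P -> local_game e e' j Q ->
  (forall a b, a \in P -> b \in Q ->
     ~ vball e a.1 (2 ^ j) b.1 /\ ~ vball e' a.2 (2 ^ j) b.2) ->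
  local_game e e' j (P ++ Q).
Proof.
move=> se se'; elim: j P Q => [|j IH] P Q.
  move=> hP hQ far a b; rewrite !mem_cat.
  have key a' b' : a' \in P -> b' \in Q -> (a'.1 == b'.1) = (a'.2 == b'.2) /\
      e a'.1 b'.1 = e' a'.2 b'.2.
    move=> aP bQ; have [f1 f2] := far _ _ aP bQ; rewrite expn0 in f1 f2.
    case: eqP => [h|_]; first by case: f1; rewrite h; exact: vball_refl.
    case: eqP => [h|_]; first by case: f2; rewrite h; exact: vball_refl.
    split => //; apply/idP/idP => h; first by case: f1; exact: vball1.
    by case: f2; exact: vball1.
  case/orP => [aP|aQ] /orP[bP|bQ]; [exact: hP|exact: key| |exact: hQ].
  have [h1 h2] := key b a bP aQ.
  by rewrite se se' (eq_sym a.1) (eq_sym a.2).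
move=> hP hQ far.
have far' a b : a \in P -> b \in Q -> forall x, vball e a.1 (2 ^ j) x ->
    ~ vball e x (2 ^ j) b.1.
  move=> aP bQ x ax xb; have [f1 _] := far a b aP bQ; apply: f1.
  by rewrite expnS mul2n -addnn; exact: vball_trans xb.
have far2' a b : a \in P -> b \in Q -> forall x, vball e' a.2 (2 ^ j) x ->
    ~ vball e' x (2 ^ j) b.2.
  move=> aP bQ x ax xb; have [_ f1] := far a b aP bQ; apply: f1.
  by rewrite expnS mul2n -addnn; exact: vball_trans xb.
have farj a b : a \in P -> b \in Q ->
    ~ vball e a.1 (2 ^ j) b.1 /\ ~ vball e' a.2 (2 ^ j) b.2.
  by move=> aP bQ; split; [apply: (far' a b aP bQ)|apply: (far2' a b aP bQ)];
    exact: vball_refl.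
have [gP fP bP] := hP; have [gQ fQ bQ] := hQ.
have addP a x y : a \in P -> vball e a.1 (2 ^ j) x -> vball e' a.2 (2 ^ j) y ->
    local_game e e' j ((x, y) :: P) -> local_game e e' j ((x, y) :: P ++ Q).
  move=> aP ax ay g; rewrite -cat_cons; apply: IH => // d b.
  rewrite inE => /orP[/eqP->|dP] bQ'; last exact: farj.
  by split; [exact: (far' _ _ aP bQ' _ ax)|exact: (far2' _ _ aP bQ' _ ay)].
have addQ a x y : a \in Q -> vball e a.1 (2 ^ j) x -> vball e' a.2 (2 ^ j) y ->
    local_game e e' j ((x, y) :: Q) -> local_game e e' j ((x, y) :: P ++ Q).
  move=> aQ ax ay g.
  apply: (@local_game_sub _ _ _ _ _ (P ++ (x, y) :: Q)).
    by move=> z; rewrite !(inE, mem_cat) => /or3P[]->; rewrite ?orbT.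
  apply: IH => // b d bP'; rewrite inE => /orP[/eqP->|dP]; last exact: farj.
  split=> h.
    have [f1 _] := far _ _ bP' aQ; apply: f1; rewrite expnS mul2n -addnn.
    exact: vball_trans h (vball_sym se ax).
  have [_ f1] := far _ _ bP' aQ; apply: f1; rewrite expnS mul2n -addnn.
  exact: vball_trans h (vball_sym se' ay).
split; first exact: IH.
- move=> a x; rewrite mem_cat => /orP[aP|aQ] ax.
    by have [y ay g] := fP a x aP ax; exists y => //; exact: (addP a).
  by have [y ay g] := fQ a x aQ ax; exists y => //; exact: (addQ a).
- move=> a y; rewrite mem_cat => /orP[aP|aQ] ay.
    by have [x ax g] := bP a y aP ay; exists x => //; exact: (addP a).
  by have [x ax g] := bQ a y aQ ay; exists x => //; exact: (addQ a).
Qed.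

(** The local moves still to come stay within [2 ^ (j - 1) + ... + 1 = 2 ^ j - 1] of the position,
    hence inside [A] and [B]. The answers are near as well, because a full game preserves short
    distances ([game_walk]). *)
Lemma game_local (V W : eqType) (e : rel V) (e' : rel W) A B j (P : seq (V * W)) :
  game e e' A B j P ->
  (forall a x, a \in P -> vball e a.1 (2 ^ j).-1 x -> A x) ->
  (forall a y, a \in P -> vball e' a.2 (2 ^ j).-1 y -> B y) ->
  local_game e e' j P.
Proof.
elim: j P => [|j IH] P //= [g f b] hA hB.
have e2 : (2 ^ j.+1).-1 = 2 ^ j + (2 ^ j).-1.
  have : 0 < 2 ^ j by rewrite expn_gt0.
  by rewrite expnS mul2n -addnn; move: (2 ^ j) => n; lia.
have le1 : (2 ^ j).-1 <= (2 ^ j.+1).-1 by rewrite e2 leq_addl.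
have le2 : 2 ^ j <= (2 ^ j.+1).-1 by rewrite e2 leq_addr.
have ext a x y : a \in P -> vball e a.1 (2 ^ j) x -> vball e' a.2 (2 ^ j) y ->
    game e e' A B j ((x, y) :: P) -> local_game e e' j ((x, y) :: P).
  move=> aP ax ay g'; apply: IH g' _ _ => d z; rewrite inE.
    case/orP => [/eqP->|dP] h; last by apply: (hA d) => //; exact: vball_le h.
    by apply: (hA a) => //; rewrite e2; exact: vball_trans h.
  case/orP => [/eqP->|dP] h; last by apply: (hB d) => //; exact: vball_le h.
  by apply: (hB a) => //; rewrite e2; exact: vball_trans h.
split.
- apply: IH g _ _ => a x aP h; [apply: (hA a)|apply: (hB a)] => //; exact: vball_le h.
- move=> a x aP ax; have Ax : A x by apply: (hA a) => //; exact: vball_le ax.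
  have [y By g'] := f x Ax; have ax2 := ax; case: ax2 => p w sp.
  have wA : walk e A a.1 p x.
    apply: walk_sub (truncation_walk w sp) => z az.
    by apply: (hA a) => //; exact: vball_le az.
  have ay : vball e' a.2 (2 ^ j) y.
    apply: (game_walk (b := (x, y)) g' _ _ wA sp); first by rewrite inE aP orbT.
    exact: mem_head.
  by exists y => //; exact: (ext a).
- move=> a y aP ay; have By : B y by apply: (hB a) => //; exact: vball_le ay.
  have [x Ax g'] := b y By; have ay2 := ay; case: ay2 => p w sp.
  have wB : walk e' B a.2 p y.
    apply: walk_sub (truncation_walk w sp) => z az.
    by apply: (hB a) => //; exact: vball_le az.
  have ax : vball e a.1 (2 ^ j) x.
    apply: (game_walk (a := swap_pair a) (b := (y, x)) (game_swap g') _ _ wB sp).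
      by apply: map_f; rewrite inE aP orbT.
    exact: mem_head.
  by exists x => //; exact: (ext a).
Qed.

(** * Components of sparse graphs *)

Section UnicyclicOrientation.
Variables (V : eqType) (e : rel V) (S : set V) (c : seq V).
Hypotheses (cyc : cycle_in e S c).
Hypothesis reach : forall v, S v -> exists2 y, y \in c & linked e S v y.

(* Orient the cycle along [next c], and every other vertex towards the cycle. *)
Lemma unicyclic_orientation : exists f : V -> V,
  (forall v, v \in c -> f v = next c v) /\
  (forall v, S v -> [/\ S (f v), e v (f v) & f (f v) <> v]) /\
  (forall v, S v -> exists n, iter n f v \in c).
Proof.
have [c3 /andP[cc uc] cS] := cyc.
pose D v n := exists p y, [/\ walk e S v p y, y \in c & size p = n].
have exD v : S v -> exists n, `[< D v n >].
  by move=> /reach[y yc [p w]]; exists (size p); apply/asboolP; exists p, y.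
(* Off the cycle, [u] is the first step of a shortest walk from [v] to [c]. *)
have stepD v : exists u, S v -> v \notin c ->
    [/\ S u, e v u & forall n, D v n -> exists2 i, i < n & D u i].
  have [Sv|nSv] := pselect (S v); last by exists v => /nSv.
  case: (ex_minnP (exD v Sv)) => n /asboolP[p [y [w yc pn]]] nmin.
  case: p w pn => [|u p] w pn; first by exists v => _; case: w => _ /= ->; rewrite yc.
  have [_ evu wu] := (walk_consE _ _ _ _ _ _).1 w.
  exists u => _ _; split => //; first exact: walk_start wu.
  move=> i /asboolP /nmin ni; exists (size p); last by exists p, y.
  by apply: leq_trans ni; rewrite -pn.
have [g gP] := choice stepD.
pose f v := if v \in c then next c v else g v.
have fS v : S v -> S (f v) /\ e v (f v).
  rewrite /f; case: ifP => [vc Sv|/negbT vc Sv]; last by have [] := gP v Sv vc.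
  by split; [apply: cS; rewrite mem_next|exact: next_cycle].
exists f; split; first by move=> v vc; rewrite /f vc.
have exm v : S v -> exists n, D v n.
  by move=> /reach[y yc [p w]]; exists (size p), p, y.
split.
- move=> v Sv; have [h1 h2] := fS v Sv; split => //.
  have [vc|vc] := boolP (v \in c).
    have fc : f v \in c by rewrite /f vc mem_next.
    by rewrite {1}/f fc /f vc; apply/eqP; exact: next2_neq.
  have [fc|fc] := boolP (f v \in c).
    by rewrite {1}/f fc => h; move: vc; rewrite -h mem_next fc.
  (* Infinite descent: both [v] and [f v] step closer to [c], so a return to [v] would shorten the
     walk from [v] to [c] forever. *)
  move=> ffv; have [n] := exm v Sv; elim/ltn_ind: n => n IH Dn.
  have [_ _ h] := gP v Sv vc; have [i il Di] := h n Dn.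
  have fv : g v = f v by rewrite /f (negbTE vc).
  rewrite fv in Di; have [_ _ h'] := gP (f v) h1 fc; have [l ll] := h' i Di.
  have -> : g (f v) = v by rewrite -[RHS]ffv {2}/f (negbTE fc).
  by apply: IH; exact: ltn_trans il.
- move=> v Sv; have [n] := exm v Sv; elim/ltn_ind: n v Sv => n IH v Sv Dn.
  have [vc|vc] := boolP (v \in c); first by exists 0.
  have [Su _ h] := gP v Sv vc; have [i il Di] := h n Dn.
  have [l lc] := IH i il _ Su Di; exists l.+1.
  by rewrite iterSr {2}/f (negbTE vc).
Qed.

End UnicyclicOrientation.

Lemma set2_eq (T : Type) (x y v w : T) :
  [set x; y] = [set v; w] :> set T -> (x = v /\ y = w) \/ (x = w /\ y = v).
Proof.
move=> h; have hx : [set v; w] x by rewrite -h; left.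
have hy : [set v; w] y by rewrite -h; right.
have hv : [set x; y] v by rewrite h; left.
have hw : [set x; y] w by rewrite h; right.
case: hx => /= xE; case: hy => /= yE; subst; [|by left|by right|].
  by case: hw => /= ->; left.
by case: hv => /= ->; left.
Qed.

Section Components.
Variables (V : eqType) (e : rel V).
Hypotheses (se : symmetric e) (ie : irreflexive e).

Lemma linked_walk x y p z : linked e setT x y -> walk e setT y p z ->
  walk e (linked e setT x) y p z.
Proof.
move=> lxy w; apply: (walk_in _ w) => u uy.
exact: linked_trans lxy (walk_linked w uy).
Qed.

Lemma linked_eq x y : linked e setT x y -> linked e setT x = linked e setT y.
Proof.
move=> l; apply/seteqP; split => z; first exact/linked_trans/linked_sym.
exact: linked_trans.
Qed.

Lemma component_eq C x : components e C -> C x -> C = linked e setT x.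
Proof. by case=> y _ <-; exact: linked_eq. Qed.

Lemma component_linked x : components e (linked e setT x).
Proof. by exists x. Qed.

Lemma component_walk C x p y : components e C -> C x -> walk e setT x p y ->
  walk e C x p y.
Proof.
move=> cC Cx; rewrite (component_eq cC Cx); apply: linked_walk.
exact: linked_refl.
Qed.

Lemma component_connected_on C : components e C -> connected_on e C.
Proof.
move=> cC; have [x _ xC] := cC; split.
  by exists x; rewrite -xC; exact: linked_refl.
move=> y z Cy; have := cC => /component_eq/(_ Cy) CE.
rewrite {1}CE => -[p w]; exists p; exact: component_walk w.
Qed.

Lemma cycle_linked A c x y : ucycle e c -> x \in c -> y \in c ->
  (forall z, z \in c -> A z) -> linked e A x y.
Proof.
move=> /andP[cc uc] xc yc cA; have [i l el] := rot_to xc.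
have w : walk e A x l (last x l).
  split => // [|z]; last by rewrite -el mem_rot; exact: cA.
  by move: cc; rewrite -(rot_cycle i) el /= rcons_path => /andP[].
by apply: (walk_linked w); rewrite -el mem_rot.
Qed.

Lemma cycle_component C c x : components e C -> cycle_in e setT c -> x \in c ->
  C x -> cycle_in e C c.
Proof.
move=> cC [c3 uc _] xc Cx; split => // z zc.
rewrite (component_eq cC Cx); exact: cycle_linked zc _.
Qed.

End Components.

(* If a component had two cycles, then some edge [x y] of the second is not   *)
(* an edge of the first.  Its deletion leaves connected a suitable finite set *)
(* [S] containing both cycles; orienting the rest as above gives [#|S|] edges *)
(* besides [x y].                                                             *)
Lemma NO_unicyclic (G : graph) C c : (forall l, 0 < l -> NO l G) ->
  components (@adj G) C -> cycle_in (@adj G) C c -> unicyclic (@adj G) C c.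
Proof.
move=> hNO cC cyc; set e := @adj G in cyc cC *.
have se : symmetric e by exact: adj_sym.
have ie : irreflexive e by exact: adj_irr.
have [c3 /andP[cc uc] cA] := cyc.
split => //; first exact: component_connected_on.
move=> d [d3 /andP[cd ud] dA].
apply: consecutive_sub_dihedral => // x xd; apply/negPn/negP => nxy.
set y := next d x in nxy.
have exy : e x y by exact: next_cycle.
have xy : x != y by apply: contraTneq exy => <-; rewrite ie.
have [z zc] : exists z, z \in c by case: (c) c3 => // z l _; exists z; exact: mem_head.
have [_ /(_ z x (cA z zc) (dA x xd)) [q wq]] := component_connected_on se cC.
pose S := undup (c ++ d ++ q).
have cS u : u \in c -> u \in S by move=> h; rewrite mem_undup mem_cat h.
have dS u : u \in d -> u \in S by move=> h; rewrite mem_undup !mem_cat h orbT.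
have qS u : u \in q -> u \in S by move=> h; rewrite mem_undup !mem_cat h !orbT.
(* The ends of the deleted edge remain linked along the rest of [d], and [q] ties [d] to [c]. *)
pose e2 : rel G := fun u v => e u v && ~~ (((u == x) && (v == y)) || ((u == y) && (v == x))).
have se2 : symmetric e2.
  by move=> u v; rewrite /e2 se; congr (_ && ~~ _); rewrite orbC andbC [X in _ || X]andbC.
pose A := [set u | u \in S].
have lyx j : j < size d -> linked e2 A y (iter j (next d) y).
  elim: j => [|j IH] jd; first by apply: linked_refl; apply: dS; rewrite mem_next.
  have idm : iter j (next d) y \in d.
    by elim: (j) => [|i IHi]; rewrite ?iterS mem_next.
  apply: (linked_trans (IH (ltnW jd))); apply: linked1.
  - exact: dS.
  - by apply: dS; rewrite /= mem_next.
  rewrite /e2 iterS next_cycle //=.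
  have zx : iter j (next d) y != x.
    by rewrite /y -iterSr; apply: iter_next_neq.
  rewrite (negbTE zx) /= negb_and; case: (eqVneq _ y) => //= ->.
  exact: next2_neq.
have l2 : linked e2 A x y.
  apply: linked_sym => //.
  have [i [_ li]] := cycle_traject ud xd.
  have d1 : (size d).-1 < size d by rewrite prednK // (ltn_trans _ d3).
  have := lyx _ d1; rewrite /y -iterSr prednK ?li //; exact: ltn_trans d3.
have l12 u v : linked e A u v -> linked e2 A u v.
  case=> p; elim: p u => [|w p IH] u.
    by move=> w; have [_ <- _] := w; apply: linked_refl; exact: walk_start w.
  move=> /walk_consE[Au euw ww]; apply: (linked_trans _ (IH _ ww)).
  have Aw := walk_start ww.
  have [h|] := boolP (e2 u w); first exact: linked1.
  rewrite /e2 euw /= negbK => /orP[] /andP[/eqP-> /eqP->] //.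
  exact: linked_sym.
have c2 : cycle_in e2 A c.
  split => //; rewrite /ucycle uc andbT; apply: cycle_from_next => // u ucm.
  rewrite /e2 next_cycle //=; apply: contra nxy; rewrite /consecutive.
  by case/orP => /andP[/eqP ux /eqP uy];
    rewrite -ux -uy ucm eqxx ?orbT.
have wqA : walk e A z q x.
  by apply: (walk_in _ wq) => u; rewrite inE => /orP[/eqP->|]; [exact: cS|exact: qS].
have reach v : A v -> exists2 y, y \in c & linked e2 A v y.
  rewrite /A /= mem_undup !mem_cat => /or3P[vc|vd|vq]; exists z => //; apply: l12.
  - by apply: (cycle_linked (c := c)) => //; rewrite /ucycle cc.
  - apply: (linked_trans (y := x)); last by apply: linked_sym => //; exists q.
    by apply: (cycle_linked (c := d)) => //; rewrite /ucycle cd.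
  - apply: linked_sym => //; apply: (walk_linked wqA); by rewrite inE vq orbT.
have [f [_ [fA _]]] := unicyclic_orientation c2 reach.
have S0 : 0 < size S by have := cS z zc; case: (S).
apply: (hNO _ S0); exists A; split.
  apply/card_eq_seq; exists S; split => //; exact: undup_uniq.
(* One edge from each [v] in [S] to [f v], all distinct because [f (f v)] is never [v], together
   with the edge [x y], which [e2] lacks. *)
pose E := [set x; y] :: [seq [set v; f v] | v <- S].
apply/(card_ge_seq (T := {classic set G})); exists (E : seq {classic set G}); split.
- rewrite /= map_inj_in_uniq ?undup_uniq ?andbT.
    apply/negP => /mapP[v vS h0]; have h := set2_eq h0; have [_] := fA v vS.
    by rewrite /e2; case: h => -[<- <-]; rewrite !eqxx ?orbT andbF.
  move=> v w vS wS h0; have [[]//|[vw wv]] := set2_eq h0.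
  have [_ _] := fA w wS; by rewrite -vw wv.
- by rewrite /= size_map.
- move=> a; rewrite inE => /orP[/eqP->|/mapP[v vS ->]].
    by exists x, y; split => //; apply: dS; rewrite ?mem_next.
  have [Afv ev _] := fA v vS.
  by exists v, (f v); split => //; case/andP: ev.
Qed.

(** * Completeness of the completions *)

(* Two shortest paths to [x] from the neighbours, on a cycle, of its vertex   *)
(* farthest from [x] enclose a short cycle.                                   *)
Lemma vball_acyclic (V : eqType) (e : rel V) x R : symmetric e -> irreflexive e ->
  (forall c, cycle_in e setT c -> size c <= (2 * R).+2 ->
     forall z, z \in c -> ~ vball e x R z) ->
  acyclic e (vball e x R).
Proof.
move=> se ie far c [c3 /andP[cc uc] cB].
pose D z n := `[< exists2 p, walk e setT z p x & size p = n >].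
have exD z : exists n, z \in c -> D z n /\ forall i, D z i -> n <= i.
  have [zc|zc] := boolP (z \in c); last by exists 0.
  have ex : exists n, D z n.
    by have /(vball_sym se)[p w _] := cB z zc; exists (size p); apply/asboolP; exists p.
  by case: (ex_minnP ex) => n Dn nmin; exists n.
have [d dP] := choice exD.
have dR z : z \in c -> d z <= R.
  move=> zc; have [_ h] := dP z zc; have /(vball_sym se)[p w pR] := cB z zc.
  by apply: leq_trans pR; apply: h; apply/asboolP; exists p.
have [u uc' umax] : exists2 u, u \in c & forall z, z \in c -> d z <= d u.
  have [z0 z0c] : exists z, z \in c by case: (c) c3 => // z l _; exists z; exact: mem_head.
  have ex : exists n, has (fun z => d z == n) c.
    by exists (d z0); apply/hasP; exists z0.
  have bd n : has (fun z => d z == n) c -> n <= R.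
    by move=> /hasP[z zc /eqP <-]; exact: dR.
  case: (ex_maxnP ex bd) => n /hasP[u uc' /eqP un] nmax; exists u => // z zc.
  by rewrite un; apply: nmax; apply/hasP; exists z.
have short v : v \in c -> e u v -> exists p,
    [/\ path e u (v :: p), uniq (u :: v :: p), last v p = x & size p <= R].
  move=> vc euv; have [/asboolP[p0 w0 s0] vmin] := dP v vc.
  have [p [w up sp _]] := walk_uniq w0.
  have spE : size p = d v.
    apply/eqP; rewrite eqn_leq -{1}s0 sp; apply: vmin; apply/asboolP; by exists p.
  exists p; split.
  - by have [pp _ _] := w; rewrite /= euv.
  - rewrite cons_uniq up andbT; apply/negP; rewrite inE => /orP[/eqP uv|us].
      by rewrite uv ie in euv.
    (* Passing through [u] would place [v] farther from [x] than [u], against the choice of [u]. *)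
    have := umax v vc; rewrite -spE; apply/negP; rewrite -ltnNge.
    case/path.splitP: us w => p1 p2 w; have [w1 w2] := (walk_catE _ _ _ _ _ _).1 w.
    rewrite last_rcons in w2; have [_ umin] := dP u uc'.
    apply: (@leq_ltn_trans (size p2)); first by apply: umin; apply/asboolP; exists p2.
    by rewrite size_cat size_rcons addSn ltnS leq_addl.
  - by case: w.
  - by rewrite spE dR.
have e1 : e u (next c u) by exact: next_cycle.
have e2 : e u (prev c u) by rewrite se; exact: prev_cycle.
have [p [pp up lp sp]] := short _ (etrans (mem_next _ _) uc') e1.
have [q [pq uq lq sq]] := short _ (etrans (mem_prev _ _) uc') e2.
have nq : next c u <> prev c u.
  move=> h; have := next2_neq uc uc' c3; rewrite h next_prev //.
  by rewrite eqxx.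
(* Each path has at most [R] edges beyond its first one, so the enclosed cycle has length at most
   [2 * R + 2]. *)
have [b [ub sb bsub]] := two_paths_cycle se pp pq up uq nq (etrans lp (esym lq)).
have hb : cycle_in e setT [:: u, next c u & b].
  by split => //=; case/andP: sb; case: (b).
apply: (far _ hb _ u (mem_head _ _)); last exact: cB.
by move: sb => /andP[_ sb] /=; lia.
Qed.

(** Pigeonhole: fewer than [k] of the tree components of type [s] meet [L]. *)
Lemma YES_fresh (G : graph) (L : seq G) m k (s : Sigma m k) :
  YES s G -> size L < k -> exists r, [/\ tree_type (@adj G) (linked (@adj G) setT r) r s,
    is_tree (@adj G) (linked (@adj G) setT r) &
    forall z, z \in L -> ~ linked (@adj G) setT r z].
Proof.
move=> /(card_ge_seq (T := {classic set G}))[Cs [uCs sCs hCs]] sL.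
have [C CCs CL] : exists2 C, C \in Cs & C \notin
    [seq (linked (@adj G) setT z : {classic set G}) | z <- L].
  apply: contrapT => nex; have : size Cs <= size L.
    rewrite -(size_map (fun z => linked (@adj G) setT z : {classic set G}) L).
    apply: uniq_leq_size => // C hC; apply/negPn/negP => hn; apply: nex.
    by exists C.
  by rewrite sCs leqNgt sL.
have [cC tC [r Cr hr]] := hCs C CCs.
have CE := component_eq (@adj_sym G) cC Cr.
exists r; rewrite -CE; split => // z zL Cz.
have CE2 := component_eq (@adj_sym G) cC Cz.
by move/negP: CL; apply; rewrite CE2 map_f.
Qed.

(** * The strategy on two models of the theory *)

Section GlobalGame.
Variable le : forall m k : nat, rel (Sigma m k).
Hypothesis hle : forall m k : nat, total_order (@le m k).
Variable k : nat.
Let L := 2 * max_depth k.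
Let M := max_depth k.

Definition same_type (G H : graph) (D : set G) (D' : set H) := exists s (g : Gamma le s M k),
  unicyclic_type (@adj G) D g /\ unicyclic_type (@adj H) D' g.

(* Short cycles are either far from the chosen vertices, or have all their    *)
(* vertices in the position, in components [Act] matched by type.             *)
Definition far_cycles (G : graph) j (P : seq G) (Act : seq {classic set G}) :=
  forall c z, cycle_in (@adj G) setT c -> size c <= L -> z \in c ->
    (linked (@adj G) setT z : {classic set G}) \notin Act ->
    forall x, x \in P -> ~ vball (@adj G) x (2 ^ j) z.

Definition marked_cycles (G : graph) (P : seq G) (Act : seq {classic set G}) :=
  forall D c z, D \in Act -> cycle_in (@adj G) D c -> z \in c -> z \in P.

(** [Act] pairs the components opened so far, those whose short cycle has been put into the
    position. As the position thereby contains vertices that nobody chose, it is the size of [Act],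
    not of [P], that is weighed against the rounds left. *)
Record invariant (G H : graph) j (P : seq (G * H))
    (Act : seq ({classic set G} * {classic set H})) : Prop := Invariant {
  inv_local : local_game (@adj G) (@adj H) j P;
  inv_far1 : far_cycles j (map fst P) (map fst Act);
  inv_far2 : far_cycles j (map snd P) (map snd Act);
  inv_mark1 : marked_cycles (map fst P) (map fst Act);
  inv_mark2 : marked_cycles (map snd P) (map snd Act);
  inv_act : forall a, a \in Act -> [/\ components (@adj G) a.1,
     components (@adj H) a.2 & same_type a.1 a.2];
  inv_inj : forall a b, a \in Act -> b \in Act -> a.1 = b.1 <-> a.2 = b.2 }.

Lemma map_fst_swap (X Y : Type) (P : seq (X * Y)) :
  map fst (map (@swap_pair X Y) P) = map snd P.
Proof. by rewrite -map_comp. Qed.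

Lemma map_snd_swap (X Y : Type) (P : seq (X * Y)) :
  map snd (map (@swap_pair X Y) P) = map fst P.
Proof. by rewrite -map_comp. Qed.

Lemma invariant_swap (G H : graph) j (P : seq (G * H)) Act :
  invariant j P Act -> invariant (G := H) (H := G) j
    (map (@swap_pair G H) P) (map (@swap_pair {classic set G} {classic set H}) Act).
Proof.
case=> h1 h2 h3 h4 h5 h6 h7; split; rewrite ?map_fst_swap ?map_snd_swap //.
- exact: local_game_swap.
- move=> a; rewrite mem_map_swap => /h6[c1 c2 [s [g [g1 g2]]]]; split => //.
  by exists s, g.
- by move=> a b; rewrite !mem_map_swap => aA bA; split=> /(h7 _ _ aA bA).
Qed.

Lemma far_cycles_le (G : graph) i j (P : seq G) Act : i <= j ->
  far_cycles j P Act -> far_cycles i P Act.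
Proof.
move=> ij h c z hc sc zc zA x xP b; apply: (h c z hc sc zc zA x xP).
by apply: vball_le b; rewrite leq_exp2l.
Qed.

Lemma far_cycles_cons (G : graph) j (P : seq G) Act a x : far_cycles j.+1 P Act ->
  a \in P -> vball (@adj G) a (2 ^ j) x -> far_cycles j (x :: P) Act.
Proof.
move=> h aP ax c z hc sc zc zA y; rewrite inE => /orP[/eqP->|yP] b.
  apply: (h c z hc sc zc zA a aP); rewrite expnS mul2n -addnn.
  exact: vball_trans b.
by apply: (far_cycles_le (leqnSn j) h hc sc zc zA yP).
Qed.

Lemma marked_cycles_sub (G : graph) (P Q : seq G) Act : {subset P <= Q} ->
  marked_cycles P Act -> marked_cycles Q Act.
Proof. by move=> PQ h D c z DA hc zc; apply: PQ; exact: h hc zc. Qed.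

Lemma invariant_near (G H : graph) j (P : seq (G * H)) Act a x :
  invariant j.+1 P Act -> a \in P -> vball (@adj G) a.1 (2 ^ j) x ->
  exists y, invariant j ((x, y) :: P) Act.
Proof.
case=> [[_ f _] h2 h3 h4 h5 h6 h7] aP ax; have [y ay g] := f a x aP ax.
exists y; split => //=.
- by apply: (far_cycles_cons h2 _ ax); exact: map_f.
- by apply: (far_cycles_cons h3 _ ay); exact: map_f.
- by apply: marked_cycles_sub h4 => z zP; rewrite inE zP orbT.
- by apply: marked_cycles_sub h5 => z zP; rewrite inE zP orbT.
Qed.

Lemma same_type_trans (G H : graph) (D : set G) (D' : set H) s (g : Gamma le s M k) :
  same_type D D' -> unicyclic_type (@adj H) D' g -> unicyclic_type (@adj G) D g.
Proof.
move=> [s' [g' [hD hD']]] h; have /unicyclic_typeE[c [cs uc _]] := h.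
have ss : s' = s by rewrite -cs; exact/esym/(unicyclic_type_size hD' uc).
by subst s'; rewrite (unicyclic_type_uniq hle h hD').
Qed.

Lemma same_type_sym (G H : graph) (D : set G) (D' : set H) :
  same_type D D' -> same_type D' D.
Proof. by move=> [s [g [? ?]]]; exists s, g. Qed.

Lemma leq_pow_depth j : j <= k -> 2 ^ j <= M.
Proof.
move=> jk; rewrite /M /max_depth; apply: (@leq_trans (3 ^ j)).
  by case: j {jk} => // j; rewrite leq_exp2r.
by rewrite leq_exp2l //; lia.
Qed.

(** Through [i0] both graphs have the same capped number of components of the type of [C], and fewer
    than [k] of them are matched. *)
Lemma unmarked_cycle_match (G H : graph) (i0 : completion_index le k) j
    (Act : seq ({classic set G} * {classic set H})) c z :
  (forall l, 0 < l -> NO l G) -> completion i0 G -> completion i0 H ->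
  cycle_in (@adj G) setT c -> size c <= L -> z \in c ->
  (linked (@adj G) setT z : {classic set G}) \notin map fst Act ->
  size Act + j.+1 <= k ->
  (forall a, a \in Act -> [/\ components (@adj G) a.1,
     components (@adj H) a.2 & same_type a.1 a.2]) ->
  (forall a b, a \in Act -> b \in Act -> a.1 = b.1 <-> a.2 = b.2) ->
  exists (C : set H), [/\ components (@adj H) C, same_type (linked (@adj G) setT z) C &
    (C : {classic set H}) \notin map snd Act].
Proof.
move=> nG cG cH hc sc zc; set C := linked (@adj G) setT z => zA sAct hAct injA.
have cC : components (@adj G) C by exact: component_linked.
have hcC : cycle_in (@adj G) C c.
  by apply: (cycle_component (@adj_sym G) cC hc zc); exact: linked_refl.
have uC := NO_unicyclic nG cC hcC.
have hs : size c < (2 * max_depth k).+1 by [].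
pose s : cycle_length k := exist _ (Ordinal hs) (unicyclic_size uC).
have hm : max_depth k < (max_depth k).+1 by [].
have [g gC] : exists g : Gamma le (val (val s)) (Ordinal hm) k, unicyclic_type (@adj G) C g.
  exact: (unicyclic_type_ex hle _ _ uC).
have := cG s (Ordinal hm) g; have := cH s (Ordinal hm) g.
set n0 := entry _ _ => nH nG'.
have n0k : n0 <= k by rewrite -ltnS /n0 /entry.
pose N : seq ({classic set G} * {classic set H}) :=
  [seq a <- Act | `[< unicyclic_type (@adj G) (a.1 : set G) g >]].
have injN : {in N &, forall a b, a.1 = b.1 <-> a.2 = b.2}.
  by move=> a b; rewrite !mem_filter => /andP[_ aA] /andP[_ bA]; exact: injA.
have hN a : a \in N -> typed_components g a.1 /\ typed_components g a.2.
  rewrite mem_filter => /andP[/asboolP ga aA].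
  have [c1 c2 st] := hAct a aA; split; split => //.
  exact: same_type_trans (same_type_sym st) ga.
have sN : size N < k.
  rewrite size_filter; apply: (leq_ltn_trans (count_size _ _)).
  by apply: leq_trans sAct; rewrite addnS ltnS leq_addr.
have CN : (C : {classic set G}) \notin map fst N.
  by apply: contra zA => /mapP[a]; rewrite mem_filter => /andP[_ aA] ->; exact: map_f.
have tC : typed_components g C by split.
have [C' [cC' gC'] C'N] := @capped_card_match {classic set G} {classic set H}
  _ _ k n0 N C n0k nG' nH injN hN sN tC CN.
exists C'; split => //; first by exists (val (val s)), g.
apply: contra C'N => /mapP[a aA Ca]; rewrite Ca; apply: map_f.
rewrite mem_filter aA andbT; apply/asboolP.
by have [_ _ st] := hAct a aA; apply: same_type_trans st _; rewrite -Ca.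
Qed.

(** By [far_cycles] the two cycles are farther than [2 ^ j.+1] from the position, so the game around
    them can be glued to the running one, with as many rounds left. Afterwards all cycle vertices of
    the opened components are in the position. *)
Lemma invariant_activate (G H : graph) (i0 : completion_index le k) j
    (P : seq (G * H)) Act c z :
  (forall l, 0 < l -> NO l G) -> completion i0 G -> completion i0 H ->
  invariant j.+1 P Act -> size Act + j.+1 <= k ->
  cycle_in (@adj G) setT c -> size c <= L -> z \in c ->
  (linked (@adj G) setT z : {classic set G}) \notin map fst Act ->
  exists Q C2, [/\ invariant j.+1 (P ++ Q) ((linked (@adj G) setT z, C2) :: Act) &
    z \in map fst Q].
Proof.
move=> nG cG cH [h1 h2 h3 h4 h5 h6 h7] sAct hc sc zc zA.
have [C2 [cC2 st C2A]] := unmarked_cycle_match nG cG cH hc sc zc zA sAct h6 h7.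
set C := linked (@adj G) setT z in zA st *.
have cC : components (@adj G) C by exact: component_linked.
have [s [g [gC gC2]]] := st.
have [c1 [c1s uc1 w1]] := unicyclic_type_word (@adj_sym G) gC.
have [c2 [c2s uc2 w2]] := unicyclic_type_word (@adj_sym H) gC2.
have c12 : size c1 = size c2 by rewrite c1s c2s.
have hcC : cycle_in (@adj G) C c.
  by apply: (cycle_component (@adj_sym G) cC hc zc); exact: linked_refl.
have cyc_sub (K : graph) D d (cD : components (@adj K) D) : unicyclic (@adj K) D d ->
    forall b u, cycle_in (@adj K) D b -> u \in b -> u \in d.
  by move=> [_ _ ud] b u /ud bd; rewrite (mem_dihedral_mem bd).
have zc1 : z \in c1 by exact: cyc_sub uc1 _ _ hcC zc.
have c1L : size c1 <= L.
  by have [_ _ ud] := uc1; rewrite -(size_dihedral (ud _ hcC)).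
have cycT (K : graph) D d : unicyclic (@adj K) D d -> cycle_in (@adj K) setT d.
  by move=> [_ [d3 ud _] _].
have jk : j.+1 <= k by apply: leq_trans sAct; rewrite leq_addl.
(* Local moves stay within [2 ^ j.+1 - 1] of the cycle, which the recorded depth [M] covers. *)
have M2 : (2 ^ j.+1).-1 <= M by apply: leq_trans (leq_pow_depth jk); exact: leq_pred.
have gQ : local_game (@adj G) (@adj H) j.+1 (zip c1 c2).
  apply: game_local.
  - apply: (unicyclic_game (k := k) (m := M)) uc1 uc2 _ jk; try exact: adj_sym;
      try exact: adj_irr.
    by rewrite w1 w2.
  - move=> a x aQ [p w sp]; have ac : a.1 \in c1.
      by rewrite -[c1](zip_map_fst c12) map_f.
    apply: (near_cycle uc1 ac _ (leq_trans sp M2)).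
    exact: (component_walk (@adj_sym G) cC (unicyclic_mem uc1 ac) w).
  - move=> a x aQ [p w sp]; have ac : a.2 \in c2.
      by rewrite -[c2](zip_map_snd c12) map_f.
    apply: (near_cycle uc2 ac _ (leq_trans sp M2)).
    exact: (component_walk (@adj_sym H) cC2 (unicyclic_mem uc2 ac) w).
exists (zip c1 c2), C2; split; last by rewrite zip_map_fst.
have linkedC (K : graph) D d u : components (@adj K) D -> unicyclic (@adj K) D d ->
    u \in d -> linked (@adj K) setT u = D.
  move=> cD ud uu; apply/esym/component_eq => //; first exact: adj_sym.
  exact: (unicyclic_mem ud uu).
have far_new (K : graph) (X : seq K) (D : set K) d (B : seq {classic set K}) :
    components (@adj K) D -> unicyclic (@adj K) D d -> far_cycles j.+1 X B ->
    far_cycles j.+1 (X ++ d) ((D : {classic set K}) :: B).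
  move=> cD ud hX b u hb sb ub; rewrite inE negb_or => /andP[uD uB] x.
  rewrite mem_cat => /orP[xX|xd]; first exact: (hX b u hb sb ub uB x xX).
  move=> [p w _]; move/eqP: uD; apply; rewrite -(linkedC _ _ _ _ cD ud xd).
  by apply/esym/linked_eq; [exact: adj_sym|exists p].
have mark_new (K : graph) (X : seq K) (D : set K) d (B : seq {classic set K}) :
    components (@adj K) D -> unicyclic (@adj K) D d -> marked_cycles X B ->
    marked_cycles (X ++ d) ((D : {classic set K}) :: B).
  move=> cD ud hX D' b u; rewrite inE => /orP[/eqP->|D'B] hb ub; rewrite mem_cat.
    by rewrite (cyc_sub _ _ _ cD ud _ _ hb ub) orbT.
  by rewrite (hX D' b u D'B hb ub).
split; rewrite ?map_cat ?zip_map_fst ?zip_map_snd //.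
- apply: local_game_cat => //; try exact: adj_sym.
  move=> a b aP bQ.
  have b1 : b.1 \in c1 by rewrite -[c1](zip_map_fst c12) map_f.
  have b2 : b.2 \in c2 by rewrite -[c2](zip_map_snd c12) map_f.
  split.
    apply: (h2 c1) => //; [exact: cycT uc1| |exact: map_f].
    by rewrite (linkedC _ _ _ _ cC uc1 b1).
  apply: (h3 c2) => //; [exact: cycT uc2|by rewrite -c12| |exact: map_f].
  by rewrite (linkedC _ _ _ _ cC2 uc2 b2).
- exact: far_new.
- exact: far_new.
- exact: mark_new.
- exact: mark_new.
- by move=> a; rewrite inE => /orP[/eqP->|/h6].
- have nA a : a \in Act -> C <> a.1 /\ C2 <> a.2.
    move=> aA; split => h; first by move/negP: zA; apply; rewrite h; exact: map_f.
    by move/negP: C2A; apply; rewrite h; exact: map_f.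
  move=> a b; rewrite !inE => /orP[/eqP->|aA] /orP[/eqP->|bA] //=.
  + by have [? ?] := nA b bA; split.
  + by have [? ?] := nA a aA; split => /esym.
  + exact: h7.
Qed.

(** The ball around [x] is acyclic, as no short cycle meets it, and [YES] for its type provides a
    tree component of [H] that avoids the position. In that component there is no cycle and no
    vertex chosen before. *)
Lemma invariant_far (G H : graph) j (P : seq (G * H)) Act x :
  model sparse_theory H -> invariant j.+1 P Act -> j.+1 <= k ->
  (forall a, a \in P -> ~ vball (@adj G) a.1 (2 ^ j) x) ->
  (forall c z, cycle_in (@adj G) setT c -> size c <= L -> z \in c ->
    ~ vball (@adj G) x (2 ^ j) z) ->
  exists y, invariant j ((x, y) :: P) Act.
Proof.
move=> mH [h1 h2 h3 h4 h5 h6 h7] jk farx farc.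
(* The cap serves two purposes: it is at least [k] for the rounds to be played, and larger than
   [size P] so that one of the tree components is untouched. *)
pose R := (2 ^ j).-1; pose K := maxn k (size P).+1.
have j2 : 0 < 2 ^ j by rewrite expn_gt0.
have jM : 2 ^ j <= M by apply: leq_pow_depth; exact: ltnW.
have acx : acyclic (@adj G) (vball (@adj G) x R).
  apply: vball_acyclic; [exact: adj_sym|exact: adj_irr|].
  move=> c hc sc z zc b; apply: (farc c z hc _ zc).
    by apply: (leq_trans sc); rewrite /L -/M /R; lia.
  by apply: vball_le b; exact: leq_pred.
have [s hs] := tree_type_ex K (@adj G) setT x R.
have hY : YES s H by apply: mH; right; exists R, K, s; split => //; rewrite /K; lia.
have [|y [hy [_ ty] yP]] := YES_fresh (L := map snd P) hY.
  by rewrite size_map /K; lia.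
have yC : linked (@adj H) setT y y by exact: linked_refl.
have cC : components (@adj H) (linked (@adj H) setT y) by exact: component_linked.
have gxy : local_game (@adj G) (@adj H) j [:: (x, y)].
  apply: (game_local (A := truncation (@adj G) setT x R)
                     (B := truncation (@adj H) (linked (@adj H) setT y) y R)).
  - apply: (tree_game (k := K) (s := s)) => //; try exact: adj_sym;
      try exact: adj_irr.
    + by apply: acyclic_sub ty => z; exact: truncation_sub.
    + by rewrite /K; lia.
  - by move=> a z; rewrite inE => /eqP->.
  - move=> a z; rewrite inE => /eqP-> [p w sp]; exists p => //.
    exact: (component_walk (@adj_sym H) cC yC w).
have far_y z n : vball (@adj H) y n z -> linked (@adj H) setT y z by case=> p w _; exists p.
exists y; split => //=.
- apply: (local_game_cat (P := [:: (x, y)])) => //; try exact: adj_sym.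
    by case: h1.
  move=> a b; rewrite inE => /eqP-> bP; split => [/(vball_sym (@adj_sym G))|/far_y].
    exact: farx.
  by apply: yP; exact: map_f.
- move=> c z hc sc zc zA u; rewrite inE => /orP[/eqP->|uP]; first exact: farc zc.
  exact: (far_cycles_le (leqnSn j) h2 hc sc zc zA uP).
- move=> c z hc sc zc zA u; rewrite inE => /orP[/eqP->|uP].
    move=> /far_y yz; apply: (ty c).
    exact: (cycle_component (@adj_sym H) cC hc zc yz).
  exact: (far_cycles_le (leqnSn j) h3 hc sc zc zA uP).
- by apply: marked_cycles_sub h4 => z zP; rewrite inE zP orbT.
- by apply: marked_cycles_sub h5 => z zP; rewrite inE zP orbT.
Qed.

Lemma model_NO (G : graph) : model sparse_theory G -> forall l, 0 < l -> NO l G.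
Proof. by move=> mG l l0; apply: mG; left; exists l. Qed.

(** Either [x] is near the position, or near a short cycle, or neither. In the second case the
    component cannot be open already, since its cycle would then lie in the position with [x] near
    it; once it is opened, [x] is a near move. *)
Lemma invariant_forth (G H : graph) (i0 : completion_index le k) j
    (P : seq (G * H)) Act x :
  model sparse_theory G -> model sparse_theory H ->
  completion i0 G -> completion i0 H ->
  invariant j.+1 P Act -> size Act + j.+1 <= k ->
  exists y P' Act', [/\ invariant j ((x, y) :: P') Act', {subset P <= P'} &
    size Act' + j <= k].
Proof.
move=> mG mH cG cH hP sAct.
have [[a [aP ax]]|farx] := pselect (exists a, a \in P /\ vball (@adj G) a.1 (2 ^ j) x).
  have [y hy] := invariant_near hP aP ax; exists y, P, Act; split => //.
  by apply: leq_trans sAct; rewrite leq_add2l.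
have [[c [z [hc sc zc xz]]]|farc] := pselect (exists c z,
    [/\ cycle_in (@adj G) setT c, size c <= L, z \in c & vball (@adj G) x (2 ^ j) z]).
  have [zA|zA] := boolP ((linked (@adj G) setT z : {classic set G}) \in map fst Act).
    case: farx; have /mapP[a aP za] : z \in map fst P.
      apply: (inv_mark1 hP zA _ zc).
      apply: (cycle_component (@adj_sym G) (component_linked _ _) hc zc).
      exact: linked_refl.
    by exists a; rewrite -za; split => //; exact: (vball_sym (@adj_sym G)).
  have [Q [C2 [hQ zQ]]] := invariant_activate (model_NO mG) cG cH hP sAct hc sc zc zA.
  have /mapP[a aQ za] := zQ.
  have aPQ : a \in P ++ Q by rewrite mem_cat aQ orbT.
  have [|y hy] := invariant_near (x := x) hQ aPQ.
    by rewrite -za; exact: (vball_sym (@adj_sym G)).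
  exists y, (P ++ Q), ((linked (@adj G) setT z, C2) :: Act); split => //.
    by move=> b bP; rewrite mem_cat bP.
  by rewrite /= addSnnS.
have [|a aP|c z hc sc zc|y hy] := invariant_far (x := x) mH hP.
- by apply: leq_trans sAct; rewrite leq_addl.
- by move=> ax; apply: farx; exists a.
- by move=> xz; apply: farc; exists c, z.
exists y, P, Act; split => //; by apply: leq_trans sAct; rewrite leq_add2l.
Qed.

Lemma invariant_back (G H : graph) (i0 : completion_index le k) j
    (P : seq (G * H)) Act y :
  model sparse_theory G -> model sparse_theory H ->
  completion i0 G -> completion i0 H ->
  invariant j.+1 P Act -> size Act + j.+1 <= k ->
  exists x P' Act', [/\ invariant j ((x, y) :: P') Act', {subset P <= P'} &
    size Act' + j <= k].
Proof.
move=> mG mH cG cH hP sA.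
have sA2 : size (map (@swap_pair {classic set G} {classic set H}) Act) + j.+1 <= k.
  by rewrite size_map.
have [x [P' [Act' [hP' PP' sA']]]] :=
  invariant_forth y mH mG cH cG (invariant_swap hP) sA2.
exists x, (map (@swap_pair H G) P'), (map (@swap_pair {classic set H} {classic set G}) Act').
split; [exact: (invariant_swap hP')| |by rewrite size_map].
by move=> a aP; rewrite mem_map_swap; apply: PP'; exact: map_f.
Qed.

(** The position only has to contain the pairs of values of the variables; opened cycles may add
    further pairs at each quantifier. *)
Lemma invariant_sat (V : Type) (f : fo V) (G H : graph)
    (i0 : completion_index le k) j (P : seq (G * H)) Act (rG : V -> G) (rH : V -> H) :
  model sparse_theory G -> model sparse_theory H ->
  completion i0 G -> completion i0 H ->
  invariant j P Act -> size Act + j <= k -> (forall v, (rG v, rH v) \in P) ->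
  qdepth f <= j -> sat rG f <-> sat rH f.
Proof.
move=> mG mH cG cH.
elim: f j P Act rG rH => {V} [V x y|V x y|V f IH|V f IHf g IHg|V f IHf g IHg|
  V f IHf g IHg|V f IH|V f IH] j P Act rG rH hP sA rP /= qf.
1,2: have at_ : atomic_iso (@adj G) (@adj H) P
  by exact: (local_game_le (leq0n j) (inv_local hP)).
- have [/= h _] := at_ _ _ (rP x) (rP y).
  by split => /eqP; [rewrite h|rewrite -h] => /eqP.
- by have [/= _ ->] := at_ _ _ (rP x) (rP y).
- by have h := IH j P Act rG rH hP sA rP qf; split => nf /h.
1-3: move: qf; rewrite geq_max => /andP[qf qg];
  have h1 := IHf j P Act rG rH hP sA rP qf;
  have h2 := IHg j P Act rG rH hP sA rP qg; tauto.
all: case: j qf hP sA => // j qf hP sA.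
all: have step x y P' Act' : invariant j ((x, y) :: P') Act' -> {subset P <= P'} ->
    size Act' + j <= k ->
    sat (fun u => if u is Some w then rG w else x) f <->
    sat (fun u => if u is Some w then rH w else y) f
  by move=> hP' PP' sA'; apply: IH hP' sA' _ qf; case=> [w|];
     [rewrite inE PP' ?orbT|exact: mem_head].
all: have forth x : exists y, sat (fun u => if u is Some w then rG w else x) f <->
      sat (fun u => if u is Some w then rH w else y) f
  by have [y [P' [Act' [h1 h2 h3]]]] := invariant_forth x mG mH cG cH hP sA;
     exists y; exact: step h1 h2 h3.
all: have back y : exists x, sat (fun u => if u is Some w then rG w else x) f <->
      sat (fun u => if u is Some w then rH w else y) f
  by have [x [P' [Act' [h1 h2 h3]]]] := invariant_back y mG mH cG cH hP sA;
     exists x; exact: step h1 h2 h3.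
- split=> -[x]; first by have [y h] := forth x => /h; exists y.
  by have [y h] := back x => /h; exists y.
- split=> h x; first by have [y h'] := back x; apply/h'.
  by have [y h'] := forth x; apply/h'.
Qed.

Lemma completion_k_complete (i : completion_index le k) :
  k_complete k (add_sentence sparse_theory (completion i)).
Proof.
move=> f fk.
have mT G : model (add_sentence sparse_theory (completion i)) G ->
    model sparse_theory G /\ completion i G.
  by move=> mG; split; [move=> A TA; apply: mG; left|apply: mG; right].
have [[G [mG hG]]|nex] := pselect (exists G,
    model (add_sentence sparse_theory (completion i)) G /\ fo_prop f G); last first.
  by right => G mG hG; apply: nex; exists G.
left => H mH; have [mG' cG] := mT G mG; have [mH' cH] := mT H mH.
have hinv : invariant (G := G) (H := H) k [::] [::].
  split => //.
  by elim: (k) => [//|n IH]; split.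
rewrite /fo_prop; apply/(invariant_sat mG' mH' cG cH hinv); last exact: hG.
- by rewrite add0n.
- by case.
- exact: fk.
Qed.

End GlobalGame.

(** * Forests satisfying the theory *)

Section Forest.

(** Types of all depths and caps together, so that a single graph can realise them all. *)
Definition type_code : eqType := {k : nat & {m : nat & Sigma m k}}.
Definition code m k (s : Sigma m k) : type_code :=
  existT (fun k => {m : nat & Sigma m k}) k (existT (fun m => Sigma m k) m s).

Lemma code_inj m k : injective (@code m k).
Proof.
move=> s t /eqP; rewrite /code -!/(Tagged _ _) eq_Tagged => /eqP.
by move=> /eqP; rewrite eq_Tagged => /eqP.
Qed.

Lemma code_depth m m' k k' (s : Sigma m k) (t : Sigma m' k') :
  code s = code t -> k = k' /\ m = m'.
Proof.
move=> h; split; first exact: (congr1 tag h).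
exact: (congr1 (fun u : type_code => tag (tagged u)) h).
Qed.

(* A vertex of the forest lists the labels met on the way to the root; a      *)
(* label consists of a type and of a number distinguishing siblings.          *)
Definition label : eqType := (type_code * nat)%type.

(** A vertex labelled by [s] gets exactly [s t] children labelled by [t]; as [s t <= k], the capped
    count is [s t] itself. Labels of depth zero have no children. *)
Definition child (a b : label) : bool :=
  `[< exists k m (s : Sigma m.+1 k) (t : Sigma m k),
      [/\ a.1 = code s, b.1 = code t & b.2 < s t] >].

Definition forest_vertex : eqType := (seq label + 'I_3)%type.

Variable triangle : bool.

(** One-letter words are roots, and [inl [::]] is isolated. The vertices [inr i] form a triangle or
    are isolated, as [triangle] says. *)
Definition parent (x y : forest_vertex) : bool :=
  match x, y with
  | inl (b :: a :: l), inl l' => (l' == a :: l) && child a b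
  | inr i, inr j => triangle && (j == ordS i)
  | _, _ => false
  end.

Definition succ (x : forest_vertex) : forest_vertex :=
  match x with inl l => inl (behead l) | inr i => inr (ordS i) end.

Lemma parent_succ x y : parent x y -> y = succ x.
Proof.
case: x y => [[|b [|a l]]|i] [l'|j] //=; first by move=> /andP[/eqP->].
by move=> /andP[_ /eqP->].
Qed.

Lemma parent_irr x : parent x x = false.
Proof.
case: x => [[|b [|a l]]|i] //=.
  by case: eqP => // /(congr1 size) /=; lia.
by case: i => -[|[|[|//]]] hi; rewrite -val_eqE /= ?andbF.
Qed.

Definition forest_adj : rel forest_vertex := fun x y => parent x y || parent y x.

Lemma forest_sym : symmetric forest_adj.
Proof. by move=> x y; rewrite /forest_adj orbC. Qed.

Lemma forest_irr : irreflexive forest_adj.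
Proof. by move=> x; rewrite /forest_adj parent_irr. Qed.

Definition forest : graph := Graph forest_sym forest_irr.

(* Each edge joins some vertex [v] to [succ v], so [l] vertices span at most [l] edges. *)
Lemma forest_NO l : NO l forest.
Proof.
move=> [S [/card_eq_seq[s [us ss sS]]]].
move=> /(card_ge_seq (T := {classic set forest}))[E [uE sE hE]].
have : size E <= size [seq ([set v; succ v] : {classic set forest}) | v <- s].
  apply: uniq_leq_size => // a /hE[x [y [Sx Sy axy ->]]].
  have [/parent_succ->|/parent_succ->] := orP axy.
    by apply: map_f; apply/sS.
  by rewrite classical_sets.setUC; apply: (map_f (fun v => [set v; succ v] : {classic set forest})); apply/sS.
by rewrite size_map sE ss ltnn.
Qed.

Inductive descendant (p : seq label) : seq label -> Prop :=
| Desc0 : descendant p p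
| DescS a b q : descendant p (a :: q) -> child a b -> descendant p (b :: a :: q).

Definition descendants p : set forest_vertex := [set x | exists2 q, x = inl q & descendant p q].

Lemma descendant_size p q : descendant p q -> size p <= size q.
Proof. by elim=> // a b r _ h _; exact: leq_trans h (leqnSn _). Qed.

Lemma descendant_child a b l q : child a b -> descendant (b :: a :: l) q ->
  descendant (a :: l) q.
Proof.
move=> ab; elim=> [|c d r _ h cd]; first by apply: DescS => //; exact: Desc0.
exact: DescS.
Qed.

Lemma forest_adjP x l : forest_adj (inl l) x ->
  (exists a b r, [/\ l = b :: a :: r, x = inl (a :: r) & child a b]) \/
  (exists a b r, [/\ l = a :: r, x = inl (b :: a :: r) & child a b]).
Proof.
case: x => [l'|j]; rewrite /forest_adj; last by case: l => [|? []].
case/orP; last first.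
  by case: l' => [|b [|a r]] //= /andP[/eqP-> h]; right; exists a, b, r.
by case: l => [|b [|a r]] //= /andP[/eqP-> h]; left; exists a, b, r.
Qed.

Lemma descendants_step p q x : descendant p q -> forest_adj (inl q) x ->
  x = inl (behead p) \/ descendants p x.
Proof.
move=> dq /forest_adjP[[a [b [r [qE -> ab]]]]|[a [b [r [qE -> ab]]]]].
  move: qE; case: dq => [->|a' b' r' h _ [_ ea er]]; first by left.
  by right; exists (a :: r) => //; rewrite -ea -er.
by right; exists (b :: a :: r) => //; apply: DescS => //; rewrite -qE.
Qed.

(** The type depends on the first label only; [i] and [l] are arbitrary so that the induction can
    pass to the children. *)
Lemma forest_tree_type m k (s : Sigma m k) i l :
  tree_type forest_adj (descendants ((code s, i) :: l)) (inl ((code s, i) :: l)) s.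
Proof.
elim: m s i l => [//|m IH] s i l; set a := (code s, i); set p := a :: l.
set A := descendants p; rewrite tree_typeS => t.
set B := truncation forest_adj A (inl p) m.+1.
have Ap : A (inl p) by exists p => //; exact: Desc0.
have cha b : child a b -> exists (u : Sigma m k), b.1 = code u /\ b.2 < s u.
  case/asboolP => k' [m' [s' [u [h1 h2 h3]]]].
  have [kk mm] := code_depth h1; subst k'; case: mm => mm; subst m'.
  by exists u; move: h3; rewrite -(code_inj h1).
(* A walk from the child that avoids the root stays among the descendants of the child, so branch
   and descendants agree up to depth [m]. *)
have trB b : child a b -> truncation forest_adj (branch forest_adj B (inl p) (inl (b :: p)))
    (inl (b :: p)) m = truncation forest_adj (descendants (b :: p)) (inl (b :: p)) m.
  move=> ab; have adjb : forest_adj (inl p) (inl (b :: p)).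
    by rewrite /forest_adj /= eqxx ab orbT.
  apply/seteqP; split => x [q w sq]; exists q => //; last first.
    apply: walk_linkedin.
    have w2 : walk forest_adj A (inl (b :: p)) q x.
      by apply: walk_sub w => y [r -> dr]; exists r => //; exact: descendant_child dr.
    have w3 : walk forest_adj A (inl p) (inl (b :: p) :: q) x by exact: walk_cons.
    apply: (walk_in _ w) => y yq; split.
      have [_ _ h] := truncation_walk w3 (sq : size (inl (b :: p) :: q) <= m.+1).
      by apply: h; rewrite inE yq orbT.
    have [_ _ h] := w; have [r -> /descendant_size] := h y yq.
    by move=> /= h2 [rE]; rewrite rE /= ltnn in h2.
  have {}w : walk forest_adj (B `\ inl p) (inl (b :: p)) q x.
    by apply: walk_sub w => y; exact: linked_end.
  have hw : descendants (b :: p) (inl (b :: p)) by exists (b :: p) => //; exact: Desc0.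
  elim: q {sq} (inl (b :: p) : forest_vertex) w hw => [|z q IHq] y w hy.
    by have [_ <- _] := w; exact: walk_nil.
  have [_ yz wz] := (walk_consE _ _ _ _ _ _).1 w.
  apply: walk_cons => //; apply: IHq => //.
  case: hy yz => r -> dr yz; have [zE|//] := descendants_step dr yz.
  by have [_ []] := walk_start wz.
have chB b : child a b -> B (inl (b :: p)).
  move=> ab; apply: truncation_child => //.
    by exists (b :: p) => //; apply: DescS => //; exact: Desc0.
  by rewrite /forest_adj /= eqxx ab orbT.
have -> : typed_children forest_adj A (inl p) t =
    (fun j => inl ((code t, j) :: p)) @` `I_(s t).
  apply/seteqP; split => x.
    case=> /truncation_sub[q -> dq] /forest_adjP[].
      case=> a' [b' [r [pE [qE] _]]]; have := descendant_size dq.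
      by rewrite qE pE /= ltnn.
    case=> a' [b [r [[<- <-] [qE] ab]]] ht; subst q.
    have [u [bu bs]] := cha b ab.
    have hu : tree_type forest_adj (descendants (b :: p)) (inl (b :: p)) u.
      by case: (b) bu => b1 b2 /= ->; exact: IH.
    have ut : u = t.
      by apply: tree_type_uniq hu _; exact: tree_type_trunc (trB b ab) ht.
    by exists b.2; rewrite -?ut // -bu; case: (b).
  case=> j jt <-; have ab : child a (code t, j).
    by apply/asboolP; exists k, m, s, t.
  split; [exact: chB|by rewrite /forest_adj /= eqxx ab orbT|].
  by apply: tree_type_trunc (esym (trB _ ab)) _; exact: IH.
have stk : s t <= k by rewrite -ltnS.
apply: (@capped_card_image _ forest_vertex) => //; first by move=> x y _ _ [].
apply/capped_cardP => //; exists (iota 0 (s t)); split.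
- exact: iota_uniq.
- exact: size_iota.
- by move=> x; rewrite mem_iota.
- by move=> _ x xs; rewrite mem_iota.
Qed.

(** A longest word on a cycle could only have its parent as a neighbour there, while a cycle
    supplies two neighbours. *)
Lemma forest_acyclic c l : cycle_in forest_adj setT c -> inl l \in c -> False.
Proof.
move=> [c3 /andP[cc uc] _] lc.
pose sz (x : forest_vertex) := if x is inl q then size q else 0.
have [q qc qmax] : exists2 q, inl q \in c & forall x, x \in c -> sz x <= size q.
  have ex : exists n, has (fun x => if x is inl q then size q == n else false) c.
    by exists (size l); apply/hasP; exists (inl l).
  have bd n : has (fun x => if x is inl q then size q == n else false) c ->
      n <= \max_(x <- c) sz x.
    move=> /hasP[[q|//] qc /eqP <-].
    by rewrite (big_rem _ qc) /= leq_maxl.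
  case: (ex_maxnP ex bd) => n /hasP[[q|//] qc /eqP qn] nmax; exists q => // -[r|//] rc /=.
  by rewrite qn; apply: nmax; apply/hasP; exists (inl r).
have nb x : x \in c -> forest_adj (inl q) x -> x = succ (inl q).
  move=> xc /forest_adjP[[a [b [r [-> -> _]]]]//|[a [b [r [qE xE _]]]]].
  by have := qmax x xc; rewrite xE qE /= ltnn.
have n1 := nb _ (etrans (mem_next _ _) qc) (next_cycle cc qc).
have n2 : prev c (inl q) = succ (inl q).
  by apply: nb; rewrite ?mem_prev // forest_sym; exact: prev_cycle.
have := next2_neq uc qc c3.
by rewrite n1 -n2 next_prev // eqxx.
Qed.

(** The roots labelled [code s] with numbers below [k] lie in [k] distinct trees. *)
Lemma forest_YES m k (s : Sigma m k) : YES s forest.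
Proof.
have desc i : linked forest_adj setT (inl [:: (code s, i)]) = descendants [:: (code s, i)].
  set p := [:: _]; apply/seteqP; split => x.
    case=> q w; have hp : descendants p (inl p) by exists p => //; exact: Desc0.
    elim: q (inl p : forest_vertex) w hp => [|z q IH] y w hy.
      by have [_ <- _] := w.
    have [_ yz wz] := (walk_consE _ _ _ _ _ _).1 w; apply: IH wz _.
    case: hy yz => r -> dr yz; have [zE|//] := descendants_step dr yz.
    move: yz; rewrite zE /= => /forest_adjP[[? [? [? []]]]|[? [? [? []]]]] //.
  case=> q -> dq {x}; elim: dq => [|a b r _ IH ab]; first exact: linked_refl.
  by apply: (linked_trans IH); apply: linked1; rewrite // /forest_adj /= eqxx ab orbT.
apply/(card_ge_seq (T := {classic set forest})).
exists [seq (linked forest_adj setT (inl [:: (code s, i)]) : {classic set forest}) | i <- iota 0 k].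
split; last 1 first.
- move=> C /mapP[i _ ->]; split.
  + exact: component_linked.
  + split; first exact: (@component_connected_on forest_vertex _ forest_sym _ (component_linked _ _)).
    move=> c [c3 uc cC]; have [x xc] : exists x, x \in c.
      by case: (c) c3 => // x l _; exists x; exact: mem_head.
    have := cC x xc; rewrite desc => -[l xE _].
    by apply: (@forest_acyclic c l); [split|rewrite -xE].
  + by exists (inl [:: (code s, i)]); [exact: linked_refl|rewrite desc; exact: forest_tree_type].
- rewrite map_inj_uniq ?iota_uniq // => i j.
  rewrite !desc => h; have : descendants [:: (code s, j)] (inl [:: (code s, i)]).
    by rewrite -h; exists [:: (code s, i)] => //; exact: Desc0.
  by case=> q [<-] d; inversion d.
- by rewrite size_map size_iota.
Qed.

Lemma forest_model : model sparse_theory forest.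
Proof.
move=> A [[l _ ->]|[m [k [s [_ ->]]]]]; [exact: forest_NO|exact: forest_YES].
Qed.

Lemma forest_cycle c : cycle_in forest_adj setT c -> triangle.
Proof.
move=> hc; have [c3 /andP[cc uc] _] := hc.
have [x xc] : exists x, x \in c by case: (c) c3 => // x l _; exists x; exact: mem_head.
case: x xc => [l lc|i ic]; first by case: (forest_acyclic hc lc).
have := next_cycle cc ic; case: (next c (inr i)) => [l|j]; rewrite /forest_adj /=.
  by case: l => [|? []].
by case/orP => /andP[].
Qed.

End Forest.

Lemma triangle_cycle : cycle_in (forest_adj true) setT
  [:: inr ord0; inr (ordS ord0); inr (ordS (ordS ord0))].
Proof. by split => //; rewrite /ucycle /forest_adj /= !inE /= -!val_eqE /=. Qed.

(** One of the two forests has a component with a triangle, the other has no cycle at all. The count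
    for the type of that component is positive in the first and zero in the second, and a cap
    [k > 0] keeps these apart. *)
Lemma completion_not_entailed (le : forall m k : nat, rel (Sigma m k)) k
    (i : completion_index le k) : (forall m k : nat, total_order (@le m k)) -> 0 < k ->
  ~ entails sparse_theory (completion i).
Proof.
move=> hle k0 hi.
have h1 := hi _ (forest_model true); have h0 := hi _ (forest_model false).
have hc := triangle_cycle; set c := [:: _; _; _] in hc.
have cC := component_linked (forest_adj true) (inr ord0).
set C := linked _ _ _ in cC.
have hcC : cycle_in (forest_adj true) C c.
  apply: (cycle_component (@forest_sym true) cC hc (mem_head _ _)).
  exact: linked_refl.
have uC : unicyclic (@adj (forest true)) C c.
  exact: (NO_unicyclic (fun l _ => @forest_NO true l) cC hcC).
have h3 : 3 < (2 * max_depth k).+1.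
  rewrite /max_depth ltnS (@leq_trans (2 * 3 ^ 1)) // leq_mul2l leq_exp2l //=; lia.
pose s : cycle_length k := exist _ (Ordinal h3) (leqnn 3).
have [g gC] : exists g : Gamma le (val (val s)) (val (@ord0 (max_depth k))) k,
    unicyclic_type (@adj (forest true)) C g.
  exact: (unicyclic_type_ex hle _ _ uC).
have n0k : entry (val i) g <= k by rewrite -ltnS /entry.
have /(@capped_cardP {classic set (forest true)} _ _ _ n0k)[t1 [_ s1 _ t1P]] := h1 s ord0 g.
have /(@capped_cardP {classic set (forest false)} _ _ _ n0k)[t0 [_ s0 t0P _]] := h0 s ord0 g.
have n0 : entry (val i) g = 0.
  rewrite -s0; case: t0 t0P {s0} => // D t0 /(_ D (mem_head _ _))[_].
  move=> /unicyclic_typeE[d [_ [_ [d3 ud _] _] _]].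
  by have : cycle_in (forest_adj false) setT d by []; move=> /forest_cycle.
have := t1P _ C (conj cC gC); rewrite n0 => /(_ k0).
by move: s1; rewrite n0 => /size0nil ->.
Qed.

Local Close Scope card_scope.
Local Close Scope classical_set_scope.

(** * Expansion of probabilities over unicyclic components *)

Section Bernoulli.
Variables (R : comRingType) (I : finType).
Implicit Types (X Y Z E : {set I}) (p a b : R).
Local Open Scope ring_scope.

Lemma prod_two_values X Y a b : Y \subset X ->
  \prod_i (if i \in X then if i \in Y then a else b else 1) =
  a ^+ #|Y| * b ^+ (#|X| - #|Y|).
Proof.
move=> YX; rewrite -big_mkcond /= (bigID (fun i => i \in Y)) /=; congr (_ * _).
  rewrite (eq_bigl (fun i => i \in Y)) => [|i]; last first.
    by apply/andP/idP => [[]//|iY]; split => //; exact: (fintype.subsetP YX).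
  by rewrite (eq_bigr (fun _ => a)) ?prodr_const // => i ->.
rewrite (eq_bigl (fun i => i \in X :\: Y)) => [|i]; last by rewrite inE andbC.
rewrite (eq_bigr (fun _ => b)) => [|i]; last by rewrite inE => /andP[/negbTE->].
by rewrite prodr_const cardsD (finset.setIidPr YX).
Qed.

Lemma sum_subsets a X : \sum_(D : {set I} | D \subset X) a ^+ #|D| = (1 + a) ^+ #|X|.
Proof.
rewrite -[in RHS]prodr_const [in RHS]big_mkcond /=.
rewrite [RHS](eq_bigr (fun i => (if i \in X then a else 0) + 1)); last first.
  by move=> i _; case: ifP => _; rewrite ?add0r // [LHS]addrC.
rewrite bigA_distr /= [LHS]big_mkcond /=; apply: eq_bigr => D _.
case: ifP => [DX|/negbT /fintype.subsetPn[i iD iX]]; last first.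
  by rewrite (bigD1 i) //= iD (negbTE iX) mul0r.
rewrite -prodr_const [LHS]big_mkcond /=; apply: eq_bigr => i _.
by case: ifP => // iD; rewrite (fintype.subsetP DX).
Qed.

(** The slots outside [X] integrate out; the sum is the expansion of a product over all slots. *)
Lemma bernoulli_cylinder X Y Z p : Y \subset X -> X \subset Z ->
  \sum_(E : {set I} | (E \subset Z) && (E :&: X == Y))
     p ^+ #|E| * (1 - p) ^+ (#|Z| - #|E|) = p ^+ #|Y| * (1 - p) ^+ (#|X| - #|Y|).
Proof.
move=> YX XZ; rewrite -prod_two_values //.
(* Weights of presence ([F]) and absence ([G]) of a slot; a zero excludes the choice that
   contradicts [Z] or [Y]. *)
pose F i := if i \in Z then if (i \in X) && (i \notin Y) then 0 else p else 0.
pose G i := if i \in Z then if i \in Y then 0 else 1 - p else 1.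
rewrite (eq_bigr (fun i => F i + G i)); last first.
  move=> i _; rewrite /F /G; case: (boolP (i \in X)) => iX /=.
    by rewrite (fintype.subsetP XZ) //; case: ifP => _ /=; rewrite ?addr0 ?add0r.
  have /negbTE -> : i \notin Y by apply: contra iX => /(fintype.subsetP YX).
  by case: ifP => _; rewrite ?add0r // addrC subrK.
rewrite bigA_distr /= big_mkcond /=; apply: eq_bigr => E _.
case: ifP => [/andP[EZ /eqP EX]|/negbT].
  rewrite -prod_two_values //; apply: eq_bigr => i _; rewrite /F /G.
  have iY : (i \in Y) = (i \in E) && (i \in X) by rewrite -EX inE.
  have := fintype.subsetP EZ i; case: (boolP (i \in E)) iY => /= iE iY h.
    by rewrite h // iY; case: (i \in X).
  by rewrite iY; case: ifP.
rewrite negb_and => /orP[/fintype.subsetPn[i iE iZ]|].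
  by rewrite (bigD1 i) //= iE /F (negbTE iZ) mul0r.
rewrite finset.eqEsubset negb_and => /orP[/fintype.subsetPn[i]|/fintype.subsetPn[i iY]].
  rewrite inE => /andP[iE iX] iY.
  by rewrite (bigD1 i) //= iE /F iX iY /= if_same mul0r.
have iX := fintype.subsetP YX i iY; have iZ := fintype.subsetP XZ i iX.
rewrite inE iX andbT => iE.
by rewrite (bigD1 i) //= (negbTE iE) /G iZ iY mul0r.
Qed.

Lemma bernoulli_total Z p :
  \sum_(E : {set I} | E \subset Z) p ^+ #|E| * (1 - p) ^+ (#|Z| - #|E|) = 1.
Proof.
have := @bernoulli_cylinder finset.set0 finset.set0 Z p.
rewrite !finset.sub0set => /(_ isT isT); rewrite cards0 subn0 !expr0 mulr1 => h; rewrite -[RHS]h.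
by apply: eq_bigl => E; rewrite finset.setI0 eqxx andbT.
Qed.

End Bernoulli.

Lemma sum_subset_imset (R : nmodType) (I J : finType) (f : I -> J) (D : {set I})
    (G : {set J} -> R) : injective f ->
  (\sum_(X : {set J} | X \subset f @: D) G X =
   \sum_(Y : {set I} | Y \subset D) G (f @: Y))%R.
Proof.
move=> injf; rewrite (reindex_onto (fun Y : {set I} => f @: Y)
  (fun X : {set J} => f @^-1: X)) /=.
  apply: eq_bigl => Y.
  have -> : f @^-1: (f @: Y) = Y by apply/setP => x; rewrite inE mem_imset.
  by rewrite eqxx andbT; apply/idP/idP => [|/imsetS //]; move/fintype.subsetP => h;
     apply/fintype.subsetP => x xY; have := h (f x); rewrite !mem_imset //; exact.
move=> X XD; apply/setP => y; apply/imsetP/idP => [[x]|yX].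
  by rewrite inE => xX ->.
by have /imsetP[x xD yE] := fintype.subsetP XD y yX; exists x => //; rewrite inE -yE.
Qed.

(** * Edge sets and closed sets of vertices *)

Section EdgeSets.
Variable n : nat.
Implicit Types (E : {set {set 'I_n}}) (T : {set 'I_n}).

Definition touching T : {set {set 'I_n}} :=
  [set e in edge_slots n | ~~ (e \subset ~: T)]%SET.

Lemma card_slots : #|edge_slots n| = 'C(n, 2).
Proof. by rewrite /edge_slots card_draws card_ord. Qed.

Lemma card_touching T : #|touching T| = 'C(n, 2) - 'C(n - #|T|, 2).
Proof.
have -> : touching T = edge_slots n :\: [set e : {set 'I_n} | (e \subset ~: T) && (#|e| == 2)].
  by apply/setP => e; rewrite !inE; case: (#|e| == 2); rewrite ?andbF ?andbT.
rewrite cardsD card_slots (finset.setIidPr _); last first.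
  by apply/fintype.subsetP => e; rewrite !inE => /andP[].
by rewrite cards_draws cardsCs finset.setCK card_ord.
Qed.

Lemma edge_relE E x y : E \subset edge_slots n ->
  edge_rel E x y = ([set x; y]%SET \in E).
Proof.
move=> ES; rewrite /edge_rel; case: (boolP (_ \in E)) => h; rewrite ?andbF //.
have := fintype.subsetP ES _ h; by rewrite inE cards2; case: (x == y).
Qed.

Lemma slotP (e : {set 'I_n}) : e \in edge_slots n -> exists x y,
  x != y /\ e = [set x; y]%SET.
Proof. by rewrite inE => /cards2P. Qed.

Definition closed_in E T := [forall x, forall y, (x \in T) && edge_rel E x y ==> (y \in T)].

Lemma closed_inP E T : reflect (forall x y, x \in T -> edge_rel E x y -> y \in T)
  (closed_in E T).
Proof.
apply: (iffP forallP) => [h x y xT exy|h x].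
  by have /forallP/(_ y)/implyP := h x; apply; rewrite xT.
by apply/forallP => y; apply/implyP => /andP[]; exact: h.
Qed.

(** The induced graph is relabelled by ['I_#|T|], so that its contribution depends on [T] through
    its size only. *)
Definition restrict_edges E T : {set {set 'I_#|T|}} :=
  [set e in edge_slots #|T| | [set enum_val x | x in e] \in E]%SET.

End EdgeSets.
Arguments closed_in {n}.

Definition lift_edges n (T : {set 'I_n}) (e : {set 'I_#|T|}) : {set 'I_n} :=
  [set enum_val x | x in e].

Lemma lift_edges_inj n (T : {set 'I_n}) : injective (@lift_edges n T).
Proof. exact: imset_inj enum_val_inj. Qed.

Lemma lift_touching n (T : {set 'I_n}) (e : {set 'I_#|T|}) :
  e \in edge_slots #|T| -> lift_edges e \in touching T.
Proof.
move=> es; rewrite !inE card_imset; last exact: enum_val_inj.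
move: (es); rewrite inE => -> /=; have [x [y [_ eE]]] := slotP es.
apply/fintype.subsetPn; exists (enum_val x); first by apply: imset_f; rewrite eE !inE eqxx.
by rewrite inE negbK enum_valP.
Qed.

(** That [T] is closed and induces a given graph is a condition on the slots touching [T] alone:
    those coming from [F] are edges, the others are not. Its probability is therefore that of a
    cylinder. *)
Lemma restrict_edgesP n (E : {set {set 'I_n}}) (T : {set 'I_n})
    (F : {set {set 'I_#|T|}}) : E \subset edge_slots n -> F \subset edge_slots #|T| ->
  closed_in E T && (restrict_edges E T == F) =
  (E :&: touching T == @lift_edges n T @: F)%SET.
Proof.
move=> ES FS; have injl := @lift_edges_inj n T.
have liftT (e : {set 'I_#|T|}) x : x \in lift_edges e -> x \in T.
  by move=> /imsetP[y _ ->]; exact: enum_valP.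
apply/andP/eqP => [[/closed_inP cl /eqP rF]|h].
  apply/setP => e; rewrite inE; apply/andP/imsetP => [[eE]|[e' e'F ->]]; last first.
    have := e'F; rewrite -rF inE => /andP[e's ->]; split => //; exact: lift_touching.
  rewrite inE => /andP[es /fintype.subsetPn[x xe]]; rewrite inE negbK => xT.
  have [y [xy eE2]] : exists y, x != y /\ e = [set x; y]%SET.
    have [u [v [uv eE2]]] := slotP es; move: xe; rewrite eE2 !inE.
    case/orP => /eqP ->; first by exists v.
    by exists u; rewrite eq_sym; split => //; exact: finset.setUC.
  have yT : y \in T by apply: (cl x y xT); rewrite edge_relE // -eE2.
  exists [set enum_rank_in xT x; enum_rank_in xT y]%SET; last first.
    by rewrite /lift_edges imsetU1 imset_set1 !enum_rankK_in.
  rewrite -rF !inE cards2; apply/andP; split.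
    rewrite (_ : enum_rank_in xT x != enum_rank_in xT y) //.
    by apply: contra xy => /eqP h; rewrite -(enum_rankK_in xT xT) h enum_rankK_in.
  by rewrite imsetU1 imset_set1 !enum_rankK_in // -eE2.
have liftE (e : {set 'I_n}) x y : e \in E -> x \in e -> x \in T -> y \in e -> y \in T.
  move=> eE xe xT ye; have : e \in E :&: touching T.
    rewrite inE eE inE (fintype.subsetP ES _ eE) /=; apply/fintype.subsetPn.
    by exists x; rewrite // inE negbK.
  by rewrite h => /imsetP[e' _ eE']; apply: (liftT e'); rewrite -eE'.
split.
  apply/closed_inP => x y xT; rewrite edge_relE // => xyE.
  by apply: (liftE _ x y xyE); rewrite ?inE ?eqxx ?orbT.
apply/eqP/setP => e; rewrite inE; apply/andP/idP => [[es eE]|eF].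
  have : lift_edges e \in E :&: touching T by rewrite inE eE lift_touching.
  by rewrite h mem_imset.
have es := fintype.subsetP FS e eF; split => //.
have : lift_edges e \in lift_edges (T := T) @: F by rewrite mem_imset.
by rewrite -h inE => /andP[].
Qed.

Lemma set2_eq_finset (T : finType) (x y v w : T) : [set x; y]%SET = [set v; w]%SET ->
  (x = v /\ y = w) \/ (x = w /\ y = v).
Proof.
move=> h; have hx : x \in [set v; w]%SET by rewrite -h !inE eqxx.
have hy : y \in [set v; w]%SET by rewrite -h !inE eqxx orbT.
have hv : v \in [set x; y]%SET by rewrite h !inE eqxx.
have hw : w \in [set x; y]%SET by rewrite h !inE eqxx orbT.
case/set2P: hx => xE; case/set2P: hy => yE; subst; [|by left|by right|].
  by case/set2P: hw => ->; left.
by case/set2P: hv => ->; left.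
Qed.

(* Every edge of a unicyclic component is an edge of the orientation: else,   *)
(* closing it by a path of the orientation would give a second cycle.         *)
Lemma card_unicyclic_edges u (F : {set {set 'I_u}}) : F \subset edge_slots u ->
  (forall x, exists C c, [/\ components (edge_rel F) C, C x & unicyclic (edge_rel F) C c]) ->
  #|F| = u.
Proof.
move=> FS hF; set e := edge_rel F in hF.
have se : symmetric e by exact: edge_rel_sym.
have exf (C : set 'I_u) : exists f : 'I_u -> 'I_u, components e C ->
    (exists c, unicyclic e C c) -> exists c, [/\ unicyclic e C c,
      forall v, v \in c -> f v = next c v,
      forall v, C v -> [/\ C (f v), e v (f v) & f (f v) <> v] &
      forall v, C v -> exists n, iter n f v \in c].
  have [[cC [c uc]]|no] := pselect (components e C /\ exists c, unicyclic e C c); last first.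
    by exists id => cC uC; case: no.
  have cyc : cycle_in e C c by case: uc.
  have [f [f1 [f2 f3]]] : exists f : 'I_u -> 'I_u,
      (forall v, v \in c -> f v = next c v) /\
      (forall v, C v -> [/\ C (f v), e v (f v) & f (f v) <> v]) /\
      (forall v, C v -> exists n, iter n f v \in c).
    apply: unicyclic_orientation => // v Cv.
    have [y yc] : exists y, y \in c.
      by have := unicyclic_size uc; case: (c) => // y l _; exists y; exact: mem_head.
    by exists y => //; have [[_ h] _ _] := uc; apply: h => //; exact: (unicyclic_mem uc).
  by exists f => _ _; exists c.
have [fC fCP] := choice exf.
pose comp x := linked e setT x.
have compx x : comp x x by exact: linked_refl.
have compP x : exists c, [/\ unicyclic e (comp x) c,
      forall v, v \in c -> fC (comp x) v = next c v,
      forall v, comp x v -> [/\ comp x (fC (comp x) v), e v (fC (comp x) v)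
                               & fC (comp x) (fC (comp x) v) <> v] &
      forall v, comp x v -> exists n, iter n (fC (comp x)) v \in c].
  apply: fCP; first exact: component_linked.
  by have [C [c [cC Cx uc]]] := hF x; exists c; rewrite /comp -(component_eq se cC Cx).
pose g x := fC (comp x) x.
have gE x y : comp x y -> g y = fC (comp x) y.
  by move=> xy; rewrite /g /comp -(linked_eq se xy).
have gP x : e x (g x) /\ g (g x) <> x.
  have [c [_ _ /(_ x (compx x))[h1 h2 h3] _]] := compP x; split => //.
  by rewrite (gE x) // -/(g x).
have inj2 : injective (fun v => [set v; g v]%SET).
  move=> v w /set2_eq_finset[[]//|[vw wv]].
  by have [_] := gP w; rewrite -vw wv.
suff -> : F = [set [set v; g v]%SET | v : 'I_u]%SET by rewrite card_imset // card_ord.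
apply/setP => a; apply/idP/imsetP => [aF|[v _ ->]]; last first.
  by have [h _] := gP v; move: h; rewrite /e edge_relE.
have [x [y [xy aE]]] := slotP (fintype.subsetP FS a aF).
have exy : e x y by rewrite /e edge_relE // -aE.
pose ef : rel 'I_u := fun v w => (w == g v) || (v == g w).
have [|nef] := boolP (ef x y).
  case/orP => /eqP h; first by exists x; rewrite // -h.
  by exists y; rewrite // -h aE finset.setUC.
have sef : symmetric ef by move=> v w; rewrite /ef orbC.
have [c [uc fc fP fr]] := compP x; set C := comp x in uc fc fP fr.
have gC v : C v -> g v = fC C v by exact: gE.
have Cg v : C v -> C (g v) by move=> Cv; rewrite gC //; have [] := fP v Cv.
have lit v n : C v -> linked ef C v (iter n g v).
  move=> Cv; have Ci i : C (iter i g v) by elim: i => //= i; exact: Cg.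
  elim: n => [|n IH]; first exact: linked_refl.
  apply: (linked_trans IH); apply: linked1; [exact: Ci|exact: (Ci n.+1)|].
  by rewrite /ef /= eqxx.
have itE v n : C v -> iter n g v = iter n (fC C) v.
  move=> Cv; have Ci i : C (iter i g v) by elim: i => //= i; exact: Cg.
  by elim: n => //= n IH; rewrite gC // IH.
have lc v : C v -> exists2 z, z \in c & linked ef C v z.
  move=> Cv; have [n] := fr v Cv; rewrite -itE // => h.
  by exists (iter n g v) => //; exact: lit.
have cC v : v \in c -> C v by exact: (unicyclic_mem uc).
have Cy : C y by apply: linked1.
have lxy : linked ef C x y.
  have [v vc xv] := lc x (compx x); have [w wc yw] := lc y Cy.
  apply: (linked_trans xv); apply: (linked_trans _ (linked_sym sef yw)).
  have ucc := unicyclic_uniq uc.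
  have [i [ei _]] := cycle_traject ucc vc.
  have : w \in traject (next c) v (size c) by rewrite -ei mem_rot.
  case/trajectP => l _ ->; suff -> : iter l (next c) v = iter l g v by apply: lit; exact: cC.
  have Ii n : iter n (next c) v \in c by elim: n => //= n; rewrite mem_next.
  by elim: l => //= l IH; rewrite -IH gC ?fc //; exact: cC.
have [p /walk_uniq[q [[pq lq qC] uq _ _]]] := lxy.
case/lastP: q pq lq qC uq => [|q z] pq lq qC uq; first by rewrite /= in lq; rewrite lq eqxx in xy.
rewrite last_rcons in lq; subst z.
have efe v w : ef v w -> e v w.
  by case/orP => /eqP ->; have [h _] := gP v; have [h' _] := gP w; rewrite // se.
have q0 : 0 < size q.
  by case: (q) pq => //=; rewrite andbT (negbTE nef).
have hd : cycle_in e C [:: y, x & q].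
  split; first by [].
    rewrite /ucycle; apply/andP; split.
      rewrite /= se exy /=; apply: sub_path pq => v w; exact: efe.
    by move: uq; rewrite -rcons_cons rcons_uniq.
  move=> v vq; apply: qC; move: vq; rewrite !inE mem_rcons inE.
  by case/or3P => ->; rewrite ?orbT.
(* [y x] is an edge of the new cycle, hence of [c], and there [g] follows [next c]; so [x y] belongs
   to the orientation after all. *)
have := unicyclic_consecutive uc hd (mem_head _ _); rewrite /= eqxx => hcons.
case/negP: nef; case/orP: hcons => /andP[vc /eqP vE].
  have gy : g y = x by rewrite (gC _ Cy) fc.
  by rewrite /ef gy eqxx orbT.
have gx : g x = y by rewrite (gC _ (compx x)) fc.
by rewrite /ef gx eqxx.
Qed.

(** * Families of typed components *)

Section TypedComponents.
Variable le : forall m k : nat, rel (Sigma m k).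
Hypothesis hle : forall m k : nat, total_order (@le m k).
Variable k : nat.
Notation pos := (position le k).

Section OneGraph.
Variable n : nat.
Implicit Types (E : {set {set 'I_n}}) (S T : {set 'I_n}) (q : pos).

Definition vset S : set 'I_n := [set x | x \in S]%classic.

Definition is_component E S : bool := `[< components (edge_rel E) (vset S) >].

Definition has_type E S q : bool :=
  `[< unicyclic_type (edge_rel E) (vset S) (tagged q) >].

Definition typed_sets E : {set {set 'I_n}} :=
  [set S | is_component E S && [exists q, has_type E S q]].

Lemma vset_inj : injective vset.
Proof.
move=> S T h; apply/setP => x; have e : vset S x = vset T x by rewrite h.
by apply/idP/idP => xS; [change (vset T x); rewrite -e|change (vset S x); rewrite e].
Qed.

Lemma vset_finset (C : set 'I_n) : vset [set x | `[< C x >]]%SET = C.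
Proof.
by apply/seteqP; split => x; rewrite /vset /= inE => /asboolP.
Qed.

Lemma component_closed E S : is_component E S -> closed_in E S.
Proof.
move=> /asboolP cS; apply/closed_inP => x y xS exy.
have : vset S y; last by [].
rewrite (component_eq (@edge_rel_sym _ _) cS (xS : vset S x)).
exact: linked1.
Qed.

Lemma component_eq_finset E S S' x : is_component E S -> is_component E S' ->
  x \in S -> x \in S' -> S = S'.
Proof.
move=> /asboolP cS /asboolP cS' xS xS'; apply: vset_inj.
rewrite (component_eq (@edge_rel_sym _ _) cS (xS : vset S x)).
by rewrite (component_eq (@edge_rel_sym _ _) cS' (xS' : vset S' x)).
Qed.

End OneGraph.

Section Restriction.
Variables (n : nat) (E : {set {set 'I_n}}) (T : {set 'I_n}).
Hypotheses (ES : E \subset edge_slots n) (cl : closed_in E T).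
Let F := restrict_edges E T.
Let f : 'I_#|T| -> 'I_n := enum_val.
Let injf : injective f. Proof. exact: enum_val_inj. Qed.

Lemma restrict_sub : F \subset edge_slots #|T|.
Proof. by apply/fintype.subsetP => e; rewrite inE => /andP[]. Qed.

Lemma restrict_edge_rel x y : edge_rel F x y = edge_rel E (f x) (f y).
Proof.
rewrite /edge_rel (inj_eq injf); case: (eqVneq x y) => //= xy.
rewrite !inE cards2 xy /= (_ : [set enum_val z | z in [set x; y]%SET] = [set f x; f y])%SET //.
by rewrite imsetU1 imset_set1.
Qed.

Lemma vset_imset (S : {set 'I_#|T|}) : vset (f @: S)%SET = (f @` vset S)%classic.
Proof.
apply/seteqP; split => y; first by move=> /imsetP[x xS ->]; exists x.
by case=> x xS <-; exact: imset_f.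
Qed.

Lemma restrict_embeds (A : set 'I_#|T|) : embeds_on f (edge_rel F) (edge_rel E) A.
Proof. by move=> x y _ _; exact: restrict_edge_rel. Qed.

Lemma linked_restrict x :
  linked (edge_rel E) setT (f x) = (f @` linked (edge_rel F) setT x)%classic.
Proof.
rewrite -(linked_map injf x (restrict_embeds (A := classical_sets.setT))).
apply/seteqP; split => y [p w]; exists p; last exact: walk_sub w.
apply: (walk_in _ w) => z zp.
have : vset T z; last first.
  by move=> zT; exists (enum_rank_in zT z); rewrite // /f enum_rankK_in.
have /closed_inP clP := cl.
elim: p (f x) w zp (enum_valP x : f x \in T) => [|v p IH] u w.
  by rewrite inE => /eqP ->.
have [_ uv wv] := (walk_consE _ _ _ _ _ _).1 w.
by rewrite inE => /orP[/eqP->//|zp] uT; apply: IH wv zp (clP _ _ uT uv).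
Qed.

Lemma component_restrict (S : {set 'I_#|T|}) : is_component F S = is_component E (f @: S)%SET.
Proof.
apply/asboolP/asboolP; rewrite vset_imset.
  by move=> [x _ <-]; exists (f x) => //; exact: linked_restrict.
move=> [y _ Sy]; have : (f @` vset S)%classic y by rewrite -Sy; exact: linked_refl.
case=> x xS xy; exists x => //; rewrite -xy linked_restrict in Sy.
by apply/seteqP; split => z h; apply: (mem_image_inj injf);
  [rewrite -Sy|rewrite Sy]; exists z.
Qed.

Lemma has_type_restrict (S : {set 'I_#|T|}) q : has_type F S q = has_type E (f @: S)%SET q.
Proof.
apply/asboolP/asboolP; rewrite vset_imset => h;
apply/(unicyclic_type_map hle (tagged q) injf (@edge_rel_sym _ F) (@edge_rel_irr _ F)
  (@edge_rel_sym _ E) (@edge_rel_irr _ E) (restrict_embeds (A := vset S))); exact: h.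
Qed.

Lemma typed_restrict : [set S in typed_sets E | S \subset T]%SET =
  (fun S : {set 'I_#|T|} => f @: S)%SET @: typed_sets F.
Proof.
have ft (S : {set 'I_#|T|}) : (f @: S)%SET \in typed_sets E = (S \in typed_sets F).
  rewrite !inE component_restrict; congr (_ && _).
  by apply: eq_existsb => q; rewrite has_type_restrict.
apply/setP => S; rewrite inE; apply/andP/imsetP => [[tS ST]|[S' tS' ->]]; last first.
  rewrite ft; split => //; apply/fintype.subsetP => y /imsetP[x _ ->].
  exact: enum_valP.
have SE : S = (f @: (f @^-1: S))%SET.
  apply/setP => y; apply/idP/imsetP => [yS|[x]]; last by rewrite inE => xS ->.
  have yT := fintype.subsetP ST y yS; exists (enum_rank_in yT y).
    by rewrite inE /f enum_rankK_in.
  by rewrite /f enum_rankK_in.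
by exists (f @^-1: S)%SET => //; rewrite -ft -SE.
Qed.

End Restriction.

Lemma cover_typed_closed n (E : {set {set 'I_n}}) (D : {set {set 'I_n}}) :
  D \subset typed_sets E -> closed_in E (finset.cover D).
Proof.
move=> DE; apply/closed_inP => x y /bigcupP[S SD xS] exy.
apply/bigcupP; exists S => //.
have := fintype.subsetP DE S SD; rewrite inE => /andP[cS _].
by have /closed_inP clS := component_closed cS; exact: clS xS exy.
Qed.

Section Expansion.
Variable R : realType.
Variable h : forall n, {set {set 'I_n}} -> {set {set 'I_n}} -> R.
Local Open Scope ring_scope.

Definition relabelling_invariant := forall n (E : {set {set 'I_n}}) (T : {set 'I_n})
    (D : {set {set 'I_#|T|}}), E \subset edge_slots n -> closed_in E T ->
  D \subset typed_sets (restrict_edges E T) ->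
  h E ((fun S : {set 'I_#|T|} => [set enum_val x | x in S]%SET) @: D) =
  h (restrict_edges E T) D.

Hypothesis hinv : relabelling_invariant.

Definition spanning_sum u (F : {set {set 'I_u}}) : R :=
  \sum_(D : {set {set 'I_u}} | D \subset typed_sets F) if finset.cover D == [set: 'I_u]%SET then h F D else 0.

(** The coefficient [a(u)] of the expansion: it runs over the labelled graphs on [u] vertices and
    involves neither [n] nor [p]. *)
Definition spanning_total u : R :=
  \sum_(F : {set {set 'I_u}} | F \subset edge_slots u) spanning_sum F.

(** Families are grouped by the vertex set [T] that they cover. This set is closed, being a union of
    components, and the family lives in the graph induced on it. *)
Lemma sum_families n (E : {set {set 'I_n}}) : E \subset edge_slots n ->
  \sum_(D : {set {set 'I_n}} | D \subset typed_sets E) h E D =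
  \sum_(T : {set 'I_n}) if closed_in E T then spanning_sum (restrict_edges E T) else 0.
Proof.
move=> ES; rewrite (partition_big (fun D => finset.cover D) xpredT) //=.
apply: eq_bigr => T _; case: (boolP (closed_in E T)) => cl; last first.
  rewrite big_pred0 // => D; apply/negbTE; apply: contra cl => /andP[DE /eqP <-].
  exact: cover_typed_closed DE.
pose lf (S : {set 'I_#|T|}) : {set 'I_n} := [set enum_val x | x in S].
have injlf : injective lf by exact: imset_inj enum_val_inj.
transitivity (\sum_(D : {set {set 'I_n}} | D \subset lf @: typed_sets (restrict_edges E T))
    if finset.cover D == T then h E D else 0).
  rewrite -big_mkcondr /=; apply: eq_bigl => D.
  case: (eqVneq (finset.cover D) T) => cD; rewrite ?andbF // !andbT.
  rewrite -(typed_restrict cl); apply/idP/idP => /fintype.subsetP DE;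
    apply/fintype.subsetP => S SD; have := DE S SD; last by rewrite inE => /andP[].
  by move=> St; rewrite inE St /= -cD; apply: (finset.bigcup_sup S).
rewrite sum_subset_imset //; apply: eq_bigr => D DF.
have -> : finset.cover (lf @: D) = [set enum_val x | x in finset.cover D]%SET.
  apply/setP => y; apply/bigcupP/imsetP => [[_ /imsetP[S SD ->] /imsetP[x xS ->]]|].
    by exists x => //; apply/bigcupP; exists S.
  case=> x /bigcupP[S SD xS] ->; exists (lf S); first exact: imset_f.
  exact: imset_f.
have -> : ([set enum_val x | x in finset.cover D]%SET == T) = (finset.cover D == [set: 'I_#|T|]%SET).
  apply/eqP/eqP => [cT|->].
    apply/setP => x; rewrite inE; have := enum_valP x; rewrite -{2}cT.
    by rewrite mem_imset //; exact: enum_val_inj.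
  apply/setP => y; apply/imsetP/idP => [[x _ ->]|yT]; first exact: enum_valP.
  by exists (enum_rank_in yT y); rewrite ?inE // enum_rankK_in.
by case: ifP => // _; rewrite -(hinv ES cl DF).
Qed.

Definition weight n (p : R) (E : {set {set 'I_n}}) : R :=
  p ^+ #|E| * (1 - p) ^+ (#|edge_slots n| - #|E|).

Lemma expect_families n p :
  \sum_(E : {set {set 'I_n}} | E \subset edge_slots n)
     weight p E * (\sum_(D : {set {set 'I_n}} | D \subset typed_sets E) h E D) =
  \sum_(T : {set 'I_n}) \sum_(F : {set {set 'I_#|T|}} | F \subset edge_slots #|T|)
     spanning_sum F * (p ^+ #|F| * (1 - p) ^+ (#|touching T| - #|F|)).
Proof.
transitivity (\sum_(E : {set {set 'I_n}} | E \subset edge_slots n) \sum_(T : {set 'I_n})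
   if closed_in E T then weight p E * spanning_sum (restrict_edges E T) else 0).
  apply: eq_bigr => E ES; rewrite sum_families // mulr_sumr; apply: eq_bigr => T _.
  by case: ifP => _; rewrite ?mulr0.
rewrite exchange_big /=; apply: eq_bigr => T _.
rewrite -big_mkcondr /=.
rewrite (partition_big (fun E => restrict_edges E T)
  (fun F => F \subset edge_slots #|T|)) /=; last first.
  by move=> E _; exact: restrict_sub.
apply: eq_bigr => F FS.
rewrite (eq_bigr (fun E => spanning_sum F * weight p E)); last first.
  by move=> E /andP[_ /eqP->]; rewrite mulrC.
rewrite -mulr_sumr; congr (_ * _).
have LF : lift_edges (T := T) @: F \subset touching T.
  apply/fintype.subsetP => _ /imsetP[e eF ->]; apply: lift_touching.
  exact: (fintype.subsetP FS).
have TS : touching T \subset edge_slots n.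
  by apply/fintype.subsetP => e; rewrite !inE => /andP[].
have cF : #|lift_edges (T := T) @: F| = #|F| by rewrite card_imset //; exact: lift_edges_inj.
rewrite -cF -(bernoulli_cylinder p LF TS).
apply: eq_bigl => E; case: (boolP (E \subset edge_slots n)) => //= ES.
exact: restrict_edgesP.
Qed.

(** A graph covered by unicyclic components has as many edges as vertices; this is where the
    exponent [u] of [p] comes from. *)
Lemma spanning_sum_card u (F : {set {set 'I_u}}) : F \subset edge_slots u ->
  spanning_sum F != 0 -> #|F| = u.
Proof.
move=> FS nz; apply: card_unicyclic_edges => // x.
have [D /andP[DF /eqP cD]] : exists D : {set {set 'I_u}},
    (D \subset typed_sets F) && (finset.cover D == [set: 'I_u]%SET).
  apply/existsP; apply: contraNT nz => /existsPn noD; apply/eqP.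
  rewrite /spanning_sum big1 // => D DF; case: ifP => // cD.
  by have := noD D; rewrite DF cD.
have /bigcupP[S SD xS] : x \in finset.cover D by rewrite cD inE.
have := fintype.subsetP DF S SD; rewrite inE => /andP[/asboolP cS /existsP[q /asboolP]].
by move=> /unicyclic_typeE[c [_ uc _]]; exists (vset S), c; split.
Qed.

Lemma expect_by_size n p :
  \sum_(E : {set {set 'I_n}} | E \subset edge_slots n)
     weight p E * (\sum_(D : {set {set 'I_n}} | D \subset typed_sets E) h E D) =
  \sum_(u < n.+1) 'C(n, u)%:R *
    (p ^+ u * (1 - p) ^+ ('C(n, 2) - 'C(n - u, 2) - u)) * spanning_total u.
Proof.
rewrite expect_families.
pose G u := p ^+ u * (1 - p) ^+ ('C(n, 2) - 'C(n - u, 2) - u) * spanning_total u.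
rewrite (eq_bigr (fun T : {set 'I_n} => G #|T|)); last first.
  move=> T _; rewrite /G /spanning_total mulr_sumr; apply: eq_bigr => F FS.
  have [->|nz] := eqVneq (spanning_sum F) 0; first by rewrite mul0r mulr0.
  by rewrite (spanning_sum_card FS nz) card_touching mulrC.
have Tn (T : {set 'I_n}) : (#|T| < n.+1)%N by rewrite ltnS -[X in (_ <= X)%N]card_ord max_card.
rewrite (partition_big (fun T : {set 'I_n} => Ordinal (Tn T)) xpredT) //=.
apply: eq_bigr => u _; rewrite (eq_bigr (fun _ => G u)); last first.
  by move=> T /eqP <-.
rewrite sumr_const -mulrA -/(G u) mulr_natl; congr (_ *+ _).
rewrite (_ : 'C(n, u) = #|[set A : {set 'I_n} | #|A| == u]%SET|); last first.
  by rewrite card_draws card_ord.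
apply: eq_card => T.
by rewrite [RHS]inE.
Qed.

End Expansion.
End TypedComponents.

(** Moebius inversion on the lattice of subsets: the coefficient of [g B] is zero to the power
    [#|C| - #|B|], which vanishes unless [B = C]. *)
Lemma alternating_subsets (R : comRingType) (I : finType) (g : {set I} -> R) (C : {set I}) :
  (\sum_(D : {set I} | D \subset C) \sum_(B : {set I} | B \subset D)
     (-1) ^+ (#|D| - #|B|) * g B = g C)%R.
Proof.
rewrite (exchange_big_dep (fun B : {set I} => B \subset C)) /=; last first.
  by move=> D B DC BD; exact: fintype.subset_trans BD DC.
have inner (B : {set I}) : B \subset C ->
    (\sum_(D : {set I} | (D \subset C) && (B \subset D)) (-1) ^+ (#|D| - #|B|) =
     0 ^+ (#|C| - #|B|) :> R)%R.
  move=> BC; rewrite (reindex_onto (fun Y : {set I} => B :|: Y) (fun D => D :\: B)) /=.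
    transitivity (\sum_(Y : {set I} | Y \subset C :\: B) (-1) ^+ #|Y| : R)%R.
      have eqP' (Y : {set I}) : ((B :|: Y \subset C) && (B \subset B :|: Y) &&
          ((B :|: Y) :\: B == Y)) = (Y \subset C :\: B).
        rewrite finset.subUset BC finset.subsetUl /= andbT finset.setDUl finset.setDv.
        rewrite finset.set0U finset.subsetD; congr (_ && _).
        exact/eqP/finset.setDidPl.
      apply: eq_big => // Y; rewrite eqP' finset.subsetD => /andP[_ dYB].
      by rewrite cardsU finset.setIC (disjoint_setI0 dYB) cards0 subn0 addKn.
    by rewrite sum_subsets subrr cardsD (finset.setIidPr BC).
  by move=> D /andP[_ BD]; rewrite -{1}(finset.setIidPr BD) finset.setID.
rewrite (bigD1 C) //= -mulr_suml inner // subnn expr0 mul1r.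
rewrite big1 ?addr0 // => B /andP[BC BneC]; rewrite -mulr_suml inner //.
have : #|B| < #|C| by rewrite proper_card // finset.properEneq BneC.
by rewrite -subn_gt0; case: (_ - _) => // m _; rewrite exprS !mul0r.
Qed.

(** * Inclusion-exclusion for the completions *)

Section CountingTerms.
Variable le : forall m k : nat, rel (Sigma m k).
Hypothesis hle : forall m k : nat, total_order (@le m k).
Variables (k : nat) (R : realType).
Notation pos := (position le k).
Variable t : pos -> nat.
Local Open Scope ring_scope.

Definition pattern n (E D : {set {set 'I_n}}) : R :=
  [forall q : pos, minn #|[set S in D | has_type E S q]%SET| k == t q]%:R.

(** The Moebius transform of the indicator [pattern]. It turns the indicator of a completion into a
    sum over families of components, the shape to which the expansion applies. *)
Definition moebius n (E D : {set {set 'I_n}}) : R :=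
  \sum_(B : {set {set 'I_n}} | B \subset D) (-1) ^+ (#|D| - #|B|) * pattern E B.

Lemma moebius_sum n (E C : {set {set 'I_n}}) :
  \sum_(D : {set {set 'I_n}} | D \subset C) moebius E D = pattern E C.
Proof. exact: alternating_subsets. Qed.

Lemma moebius_norm n (E D : {set {set 'I_n}}) : `|moebius E D| <= 2 ^+ #|D|.
Proof.
apply: (le_trans (ler_norm_sum _ _ _)).
apply: (@le_trans _ _ (\sum_(B : {set {set 'I_n}} | B \subset D) 1 ^+ #|B|)).
  apply: ler_sum => B _; rewrite expr1n normrM normrX normrN1 expr1n mul1r.
  by rewrite /pattern; case: [forall _, _]; rewrite ?normr1 ?normr0.
by rewrite sum_subsets.
Qed.

Lemma moebius_invariant : relabelling_invariant le k moebius.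
Proof.
move=> n E T D ES cl DF; set lf := fun S : {set 'I_#|T|} => [set enum_val x | x in S]%SET.
have injlf : injective lf by exact: imset_inj enum_val_inj.
rewrite /moebius sum_subset_imset //; apply: eq_bigr => B BD.
rewrite !card_imset //; congr (_ * _); rewrite /pattern; congr ((nat_of_bool _)%:R).
apply: eq_forallb => q; congr (minn _ _ == _).
rewrite (_ : [set S in lf @: B | has_type E S q]%SET =
             lf @: [set S in B | has_type (restrict_edges E T) S q]%SET) ?card_imset //.
apply/setP => S; rewrite inE; apply/andP/imsetP.
  case=> /imsetP[S' S'B ->] hS; exists S' => //.
  by rewrite inE S'B (has_type_restrict hle E).
case=> S'; rewrite inE => /andP[S'B hS] ->; split; first exact: imset_f.
by rewrite -(has_type_restrict hle E).
Qed.

End CountingTerms.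

Section TypedCounts.
Variable le : forall m k : nat, rel (Sigma m k).
Hypothesis hle : forall m k : nat, total_order (@le m k).
Variables (k : nat) (R : realType).
Local Open Scope ring_scope.

(** The number of subfamilies of [D], a majorant of the Moebius coefficients. Being nonnegative, it
    admits no cancellation, so a bound on its expectation bounds the partial sums of its
    expansion. *)
Definition family_weight n (E D : {set {set 'I_n}}) : R := 2 ^+ #|D|.

Lemma family_weight_invariant : relabelling_invariant le k family_weight.
Proof.
move=> n E T D _ _ _; rewrite /family_weight card_imset //.
exact: imset_inj enum_val_inj.
Qed.

Lemma spanning_total_norm (t : position le k -> nat) u :
  `|spanning_total le k (moebius R t) u| <= spanning_total le k family_weight u.
Proof.
apply: (le_trans (ler_norm_sum _ _ _)); apply: ler_sum => F _.
apply: (le_trans (ler_norm_sum _ _ _)); apply: ler_sum => D _.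
by case: ifP => _; rewrite ?normr0 // moebius_norm.
Qed.

Lemma spanning_total_ge0 u : 0 <= spanning_total le k family_weight u.
Proof.
apply: sumr_ge0 => F _; apply: sumr_ge0 => D _.
by case: ifP => // _; rewrite exprn_ge0 // ler0n.
Qed.

Lemma capped_card_set n (A : {set {set 'I_n}}) j : (j <= k)%N ->
  capped_card (@vset n @` [set S | S \in A])%classic k j <-> minn #|A| k = j.
Proof.
move=> jk.
have h : capped_card (@vset n @` [set S | S \in A])%classic k (minn #|A| k).
  apply: (@capped_card_image _ {classic set 'I_n}); first exact: geq_minr.
    by move=> S T _ _; exact: vset_inj.
  apply/capped_cardP; first exact: geq_minr.
  exists (take k (enum A)); split.
  - exact/take_uniq/enum_uniq.
  - by rewrite size_take_min -cardE minnC.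
  - by move=> S /mem_take; rewrite mem_enum.
  - rewrite gtn_min ltnn orbF => Ak S SA.
    by rewrite take_oversize ?mem_enum // -cardE ltnW.
split=> [h'|<-//].
by apply: (@capped_card_uniq {classic set 'I_n} _ k _ _ _ _ h h') => //; exact: geq_minr.
Qed.

Lemma completion_pattern n (E : {set {set 'I_n}}) (i : completion_index le k) :
  `[< completion i (graph_of E) >] =
  [forall q : position le k,
     minn #|[set S in typed_sets le k E | has_type E S q]%SET| k == val i q].
Proof.
have XE (q : position le k) : @typed_components le k (graph_of E) _ _ (tagged q) =
    (@vset n @` [set S | S \in [set S in typed_sets le k E | has_type E S q]%SET])%classic.
  apply/seteqP; split => [C [cC tC]|C [S]].
    exists [set x | `[< C x >]]%SET; last exact: vset_finset.
    rewrite /= !inE /is_component /has_type vset_finset.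
    have -> : `[< components (edge_rel E) C >] by exact/asboolP.
    have tq : `[< unicyclic_type (edge_rel E) C (tagged q) >] by exact/asboolP.
    by rewrite tq andbT; apply/existsP; exists q.
  by rewrite /= !inE => /andP[/andP[/asboolP cS _] /asboolP tS] <-.
have ik (q : position le k) : (val i q <= k)%N by rewrite -ltnS.
apply/asboolP/forallP => h.
  move=> q; apply/eqP/(capped_card_set _ (ik q)); rewrite -XE.
  by case: q => -[s m] g; exact: (h s m g).
move=> s m g; have := h (existT _ (s, m) g) => /eqP/(capped_card_set _ (ik _)).
by rewrite -XE.
Qed.

Lemma gnp_prob_completion n (p : R) (i : completion_index le k) :
  gnp_prob n p (completion i) =
  \sum_(u < n.+1) 'C(n, u)%:R *
    (p ^+ u * (1 - p) ^+ ('C(n, 2) - 'C(n - u, 2) - u)) *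
    spanning_total le k (moebius R (fun q => val i q)) u.
Proof.
rewrite -expect_by_size //; last exact: moebius_invariant.
rewrite /gnp_prob big_mkcondr /=; apply: eq_bigr => E _.
by rewrite moebius_sum /pattern -completion_pattern /weight; case: ifP => _;
  rewrite ?mulr1 ?mulr0.
Qed.

End TypedCounts.

(** * Families of disjoint short cycles *)

Definition cycle_edges n (c : seq 'I_n) : {set {set 'I_n}} :=
  [set [set x; next c x] | x in c]%SET.

Lemma card_cycle_edges n (c : seq 'I_n) : uniq c -> 2 < size c ->
  #|cycle_edges c| = size c.
Proof.
move=> uc c3; rewrite card_in_imset; first exact/card_uniqP.
move=> x y xc yc /set2_eq_finset[[]//|[xE yE]].
by have := next2_neq uc yc c3; rewrite -xE yE eqxx.
Qed.

(** Repetitions are allowed, so there are exactly [n ^ s] sequences of length [s]; distinctness is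
    left to [disjoint_cycles]. *)
Definition bounded_cycle (L n : nat) : finType := {s : 'I_L.+1 & s.-tuple 'I_n}.

Definition cycle_seq L n (c : bounded_cycle L n) : seq 'I_n := tagged c.

Lemma size_cycle_seq L n (c : bounded_cycle L n) : size (cycle_seq c) = tag c.
Proof. by rewrite size_tuple. Qed.

Definition disjoint_cycles L n (X : {set bounded_cycle L n}) : bool :=
  [forall c in X, uniq (cycle_seq c) && (2 < size (cycle_seq c))] &&
  [forall c in X, forall d in X, (c != d) ==>
     [forall x, ~~ ((x \in cycle_seq c) && (x \in cycle_seq d))]].

Definition family_edges L n (X : {set bounded_cycle L n}) : {set {set 'I_n}} :=
  \bigcup_(c in X) cycle_edges (cycle_seq c).

Lemma card_family_edges L n (X : {set bounded_cycle L n}) : disjoint_cycles X ->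
  #|family_edges X| = \sum_(c in X) size (cycle_seq c).
Proof.
move=> /andP[/forall_inP uX /forall_inP dX].
pose F (c : bounded_cycle L n) : {set {set 'I_n}} :=
  if c \in X then cycle_edges (cycle_seq c) else finset.set0.
have -> : family_edges X = \bigcup_c F c by rewrite /family_edges big_mkcond.
rewrite -sum1_card partition_disjoint_bigcup.
  rewrite [RHS]big_mkcond; apply: eq_bigr => c _; rewrite sum1_card /F.
  case: ifP => [cX|_]; last by rewrite cards0.
  by have /andP[uc c3] := uX c cX; exact: card_cycle_edges.
move=> c d cd; rewrite /F; case: ifP => cX; last by rewrite finset.disjoints_subset finset.sub0set.
case: ifP => dX'; last by rewrite disjoint_sym finset.disjoints_subset finset.sub0set.
rewrite -finset.setI_eq0; apply/eqP/setP => e; rewrite !inE; apply/negbTE/negP.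
move=> /andP[/imsetP[x xc ->] /imsetP[y yd h]].
have := dX c cX => /forall_inP/(_ d dX')/implyP/(_ cd)/forallP/(_ x)/negP; apply.
rewrite xc /=; have : x \in [set x; next (cycle_seq c) x]%SET by rewrite !inE eqxx.
by rewrite h !inE => /orP[]/eqP->; rewrite ?mem_next.
Qed.

Section ShortCycles.
Variable le : forall m k : nat, rel (Sigma m k).
Variables (k : nat) (R : realType).
Let L := 2 * max_depth k.

(** Each typed component contributes its own cycle; distinct components are disjoint, hence so are
    these cycles. *)
Lemma typed_cycles n (E : {set {set 'I_n}}) : E \subset edge_slots n ->
  exists X : {set bounded_cycle L n},
    [/\ #|X| = #|typed_sets le k E|, disjoint_cycles X & family_edges X \subset E].
Proof.
move=> ES; pose C := typed_sets le k E.
have ex (S : {set 'I_n}) : exists c : bounded_cycle L n,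
    S \in C -> unicyclic (edge_rel E) (vset S) (cycle_seq c).
  have [SC|] := boolP (S \in C); last first.
    by exists (existT (fun s : 'I_L.+1 => s.-tuple 'I_n) ord0 [tuple]).
  have := SC; rewrite inE => /andP[_ /existsP[q /asboolP]].
  move=> /unicyclic_typeE[c [cs uc _]].
  have sc : size c == val (tag q).1 :> nat by rewrite cs.
  by exists (existT (fun s : 'I_L.+1 => s.-tuple 'I_n) (val (tag q).1) (Tuple sc)).
have [f fP] := choice ex.
have compC S : S \in C -> is_component E S by rewrite inE => /andP[].
have meet S S' x : S \in C -> S' \in C -> x \in cycle_seq (f S) ->
    x \in cycle_seq (f S') -> S = S'.
  move=> SC SC' xS xS'; apply: (component_eq_finset (compC _ SC) (compC _ SC') (x := x)).
    exact: (unicyclic_mem (fP S SC) xS).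
  exact: (unicyclic_mem (fP S' SC') xS').
have injf : {in C &, injective f}.
  move=> S S' SC SC' fS; have c3 := unicyclic_size (fP S SC).
  have [x xS] : exists x, x \in cycle_seq (f S).
    by case: (cycle_seq (f S)) c3 => // x l _; exists x; exact: mem_head.
  by apply: (meet _ _ x) => //; rewrite -fS.
exists (f @: C)%SET; split.
- by rewrite card_in_imset.
- apply/andP; split.
    apply/forall_inP => _ /imsetP[S SC ->].
    by rewrite (unicyclic_uniq (fP S SC)) (unicyclic_size (fP S SC)).
  apply/forall_inP => _ /imsetP[S SC ->]; apply/forall_inP => _ /imsetP[S' SC' ->].
  apply/implyP => nSS; apply/forallP => x; apply: contra nSS => /andP[xS xS'].
  by rewrite (meet S S' x).
- apply/bigcupsP => _ /imsetP[S SC ->]; apply/fintype.subsetP => _ /imsetP[x xc ->].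
  by rewrite -edge_relE //; exact: (cycle_edge (fP S SC)).
Qed.

Local Open Scope ring_scope.

(** The subfamilies of the cycles found in [E] are among all disjoint families of cycles contained
    in [E]. Such a family is present with probability [p] to the number of its edges, and dropping
    disjointness turns the sum into a product over single cycles. *)
Lemma family_weight_bound n (p : R) : 0 <= p -> p <= 1 ->
  \sum_(E : {set {set 'I_n}} | E \subset edge_slots n) weight p E *
    (\sum_(D : {set {set 'I_n}} | D \subset typed_sets le k E) family_weight R E D) <=
  \prod_(c : bounded_cycle L n) (1 + 2 * p ^+ tag c).
Proof.
move=> p0 p1; have q0 : 0 <= 1 - p by rewrite subr_ge0.
have w0 (E : {set {set 'I_n}}) : 0 <= weight p E by rewrite mulr_ge0 ?exprn_ge0.
pose good (X : {set bounded_cycle L n}) (E : {set {set 'I_n}}) :=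
  disjoint_cycles X && (family_edges X \subset E).
apply: (@le_trans _ _ (\sum_(E : {set {set 'I_n}} | E \subset edge_slots n)
   \sum_(X : {set bounded_cycle L n} | good X E) weight p E * 2 ^+ #|X|)).
  apply: ler_sum => E ES; rewrite -mulr_sumr ler_wpM2l //.
  have [X [cX dX XE]] := typed_cycles ES.
  (* Both sums equal [3] to the number of typed components, so families of components can be traded
     for families of cycles. *)
  rewrite /family_weight sum_subsets -cX -sum_subsets.
  rewrite [leRHS](bigID (fun Y : {set bounded_cycle L n} => Y \subset X)) /= -[leLHS]addr0 lerD //; last first.
    by apply: sumr_ge0 => Y _; rewrite exprn_ge0.
  rewrite le_eqVlt; apply/orP; left; apply/eqP; apply: eq_bigl => Y.
  apply/idP/andP => [YX|[]//]; split => //; apply/andP; split.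
    move: dX => /andP[/forall_inP h1 /forall_inP h2]; apply/andP; split.
      by apply/forall_inP => c /(fintype.subsetP YX) /h1.
    apply/forall_inP => c /(fintype.subsetP YX) /h2 /forall_inP h.
    by apply/forall_inP => d /(fintype.subsetP YX) /h.
  apply: fintype.subset_trans XE; apply/bigcupsP => c cY.
  by apply: (finset.bigcup_sup c) => //; exact: (fintype.subsetP YX).
rewrite (exchange_big_dep (fun X => disjoint_cycles X && (family_edges X \subset edge_slots n)))
  /=; last first.
  by move=> E X ES /andP[-> XE] /=; exact: fintype.subset_trans ES.
rewrite (eq_bigr (fun c : bounded_cycle L n => 2 * p ^+ tag c + 1)); last first.
  by move=> c _; rewrite addrC.
rewrite bigA_distr /= [leRHS](bigID (fun X : {set bounded_cycle L n} => disjoint_cycles X &&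
  (family_edges X \subset edge_slots n))) /= -[leLHS]addr0 lerD //; last first.
  apply: sumr_ge0 => X _; apply: prodr_ge0 => c _.
  by case: ifP => // _; rewrite mulr_ge0 // exprn_ge0.
apply: ler_sum => X /andP[dX XS].
rewrite -mulr_suml (eq_bigl (fun E : {set {set 'I_n}} => (E \subset edge_slots n) &&
   (E :&: family_edges X == family_edges X))); last first.
  move=> E; rewrite /good dX /=; congr (_ && _).
  by rewrite finset.setIC; apply/idP/eqP => [/finset.setIidPl|/finset.setIidPl].
rewrite bernoulli_cylinder // subnn expr0 mulr1 card_family_edges // expr_sum.
rewrite -prodr_const -big_split /= [leRHS](bigID (fun c => c \in X)) /=.
rewrite [X in _ <= _ * X]big1 ?mulr1; last by move=> c /negbTE ->.
rewrite le_eqVlt; apply/orP; left; apply/eqP; apply: eq_bigr => c cX.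
by rewrite cX size_cycle_seq mulrC.
Qed.

(** At [p = 1 / n] the [n ^ s] sequences of length [s] contribute [2] to the exponent, and there are
    [L.+1] lengths. *)
Lemma family_weight_expR n : (0 < n)%N ->
  \sum_(E : {set {set 'I_n}} | E \subset edge_slots n) weight (n%:R^-1) E *
    (\sum_(D : {set {set 'I_n}} | D \subset typed_sets le k E) family_weight R E D) <=
  expR (2 * L.+1%:R).
Proof.
move=> n0; have p0 : 0 <= n%:R^-1 :> R by rewrite invr_ge0.
have p1 : n%:R^-1 <= 1 :> R by rewrite invf_le1 ?ltr0n // ler1n.
apply: (le_trans (family_weight_bound n p0 p1)).
apply: (@le_trans _ _ (\prod_(c : bounded_cycle L n) expR (2 * n%:R^-1 ^+ tag c))).
  apply: ler_prod => c _; rewrite expR_ge1Dx andbT.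
  by rewrite addr_ge0 // mulr_ge0 // exprn_ge0.
rewrite -expR_sum ler_expR -mulr_sumr ler_wpM2l //.
rewrite -(@sig_big_dep _ _ _ _ (fun s : 'I_L.+1 => s.-tuple 'I_n : finType) xpredT
  (fun _ => xpredT) (fun s _ => n%:R^-1 ^+ s)) /=.
rewrite (eq_bigr (fun _ => 1)) ?sumr_const ?card_ord // => s _.
rewrite sumr_const card_tuple card_ord -[LHS]mulr_natl natrX -exprMn divff ?expr1n //.
by rewrite pnatr_eq0 -lt0n.
Qed.

End ShortCycles.

Local Open Scope ring_scope.
Local Open Scope classical_set_scope.

(** * Limits of the completion probabilities *)

Section Analysis.
Variable R : realType.
Implicit Types (c p : R) (n u i m : nat).

(** The slots touching [u] vertices, counted vertex by vertex: the one with index [i] brings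
    [n - 1 - i] new slots. *)
Lemma sub_bin2 n u : (u <= n)%N ->
  ('C(n, 2) - 'C(n - u, 2) = \sum_(i < u) (n - 1 - i))%N.
Proof.
elim: u => [|u IH] un; first by rewrite subn0 subnn big_ord0.
rewrite big_ord_recr /= -IH; last exact: ltnW.
have -> : (n - u = (n - u.+1).+1)%N by rewrite subnSK.
have := leq_bin2l 2 (leq_subr u n); rewrite -[(n - u)%N]subnSK // binS bin1.
lia.
Qed.

Definition size_prob p n u : R :=
  'C(n, u)%:R * (p ^+ u * (1 - p) ^+ ('C(n, 2) - 'C(n - u, 2) - u)).

Lemma bin_prod n u : 'C(n, u)%:R * u`!%:R = \prod_(i < u) (n - i)%:R :> R.
Proof. by rewrite -natrM bin_ffact ffact_prod natr_prod. Qed.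

(** This is [y exp(1 - y) <= 1] at [y = m p] combined with [1 - p <= exp(- p)]; the exponent is
    [p - 1] instead of [- 1] because only [m.-1] factors [1 - p] are present. *)
Lemma expR_factor p m : 0 <= p -> p <= 1 -> (0 < m)%N ->
  m%:R * p * (1 - p) ^+ m.-1 <= expR (p - 1).
Proof.
move=> p0 p1 m0; have q0 : 0 <= 1 - p by rewrite subr_ge0.
have h1 : m%:R * p <= expR (m%:R * p - 1).
  by apply: le_trans (expR_ge1Dx _); rewrite addrC subrK.
have h2 : (1 - p) ^+ m.-1 <= expR (- p *+ m.-1).
  rewrite -mulr_natl expRM_natl lerXn2r ?nnegrE ?expR_ge0 //; exact: expR_ge1Dx.
apply: (le_trans (ler_pM _ _ h1 h2)); rewrite ?exprn_ge0 ?mulr_ge0 //.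
rewrite -expRD ler_expR; case: m m0 {h1 h2} => // m _ /=.
by rewrite -mulr_natl -natr1; lra.
Qed.

(* The ratio of consecutive factors is at most [exp (p - 1)] because          *)
(* [y exp (1 - y) <= 1]; hence the bound does not depend on [c].              *)
Lemma size_prob_le p n u : 0 <= p -> p <= 2^-1 -> (u <= n)%N ->
  size_prob p n u <= expR (3 * p *+ u) * (expR (- 1) ^+ u / u`!%:R).
Proof.
move=> p0 p2 un; have p1 : p <= 1 by apply: (le_trans p2); lra.
have q0 : 0 <= 1 - p by rewrite subr_ge0.
have q1 : 1 - p <= 1 by lra.
(* Prepares the division by [(1 - p) ^+ u] below; this is what [p <= 1/2] is for. *)
have qE : expR (- (2 * p)) <= 1 - p.
  rewrite expRN -[leRHS]invrK lef_pV2 ?posrE ?expR_gt0 ?invr_gt0 //; last by lra.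
  apply: le_trans (expR_ge1Dx _).
  rewrite -[leLHS]mul1r ler_pdivrMr; last by lra.
  by nra.
set T := ('C(n, 2) - 'C(n - u, 2))%N.
have fu : 0 < u`!%:R :> R by rewrite ltr0n fact_gt0.
(* With the extra factor [(1 - p) ^+ u] the left side is bounded by a product of [u] factors
   [m p (1 - p) ^ (m - 1)], where [m = n - i]. *)
have step : size_prob p n u * u`!%:R * (1 - p) ^+ u <= expR (p - 1) ^+ u.
  have -> : size_prob p n u * u`!%:R * (1 - p) ^+ u =
      (\prod_(i < u) (n - i)%:R) * p ^+ u * ((1 - p) ^+ (T - u) * (1 - p) ^+ u).
    by rewrite -bin_prod /size_prob -/T; ring.
  apply: (@le_trans _ _ ((\prod_(i < u) (n - i)%:R) * p ^+ u * (1 - p) ^+ T)).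
    rewrite ler_wpM2l //.
      by rewrite mulr_ge0 ?exprn_ge0 // prodr_ge0 // => i _; rewrite ler0n.
    rewrite -exprD; apply: ler_wiXn2l => //; lia.
  rewrite /T sub_bin2 // expr_sum.
  have -> : p ^+ u = \prod_(i < u) p by rewrite prodr_const card_ord.
  have -> : expR (p - 1) ^+ u = \prod_(i < u) expR (p - 1) by rewrite prodr_const card_ord.
  rewrite -!big_split /=; apply: ler_prod => i _; apply/andP; split.
    by rewrite !mulr_ge0 ?exprn_ge0.
  have -> : (n - 1 - i = (n - i).-1)%N by lia.
  by apply: expR_factor => //; rewrite subn_gt0; exact: leq_trans un.
rewrite mulrA ler_pdivlMr //.
have qu : 0 < (1 - p) ^+ u by rewrite exprn_gt0 //; lra.
rewrite -(ler_pM2r qu); apply: (le_trans step).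
(* [3 p] is made up of [p] from the factors [exp(p - 1)] and [2 p] from the division by [1 - p]. *)
have -> : expR (3 * p *+ u) = expR (p *+ u) * expR (2 * p) ^+ u.
  by rewrite -expRM_natl -expRD; congr expR; rewrite -(mulr_natl (3 * p) u) -(mulr_natl p u); ring.
have -> : expR (p - 1) ^+ u = expR (p *+ u) * expR (- 1) ^+ u.
  by rewrite -mulr_natl expRM_natl -exprMn -expRD.
rewrite -!mulrA ler_wpM2l ?expR_ge0 // mulrCA ler_peMr ?exprn_ge0 ?expR_ge0 //.
rewrite -exprMn exprn_ege1 //.
have := qE; rewrite expRN => h.
by rewrite -(ler_pM2l (_ : 0 < (expR (2 * p))^-1)) ?invr_gt0 ?expR_gt0 // mulr1 mulKf ?gt_eqF ?expR_gt0.
Qed.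

Lemma size_prob_ge0 p n u : 0 <= p -> p <= 1 -> 0 <= size_prob p n u.
Proof.
by move=> p0 p1; rewrite !mulr_ge0 // ?exprn_ge0 // subr_ge0.
Qed.

Lemma cvg_inv_nat : (n%:R^-1 : R) @[n --> \oo] --> (0 : R).
Proof. by rewrite -cvg_shiftS; exact: cvg_harmonic. Qed.

Lemma cvg_pn c : (c / n%:R : R) @[n --> \oo] --> (0 : R).
Proof. by rewrite -[0 in X in _ --> X](mulr0 c); apply: cvgMr; exact: cvg_inv_nat. Qed.

(** Squeezed between [exp(- m p / (1 - p))] and [exp(- m p)] with [m = n - 2 - i] and [p = c / n];
    the product [m p] is eventually [r n], which tends to [c]. *)
Lemma cvg_pow c i : 0 < c ->
  ((1 - c / n%:R) ^+ (n - 2 - i) : R) @[n --> \oo] --> expR (- c).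
Proof.
move=> c0; have pn := cvg_pn c.
pose r n : R := c - (2 + i)%:R * (c / n%:R).
have rc : r n @[n --> \oo] --> c.
  rewrite -[X in _ --> X]subr0 -[X in _ - X](mulr0 (2 + i)%:R).
  by apply: cvgB; [exact: cvg_cst|apply: cvgMr].
have q1 : (1 - c / n%:R : R) @[n --> \oo] --> (1 : R).
  by rewrite -[X in _ --> X]subr0; apply: cvgB; [exact: cvg_cst|].
have up : expR (- r n) @[n --> \oo] --> expR (- c).
  apply: (@continuous_cvg _ _ _ _ _ (fun n => - r n) expR); first exact: continuous_expR.
  exact: cvgN.
have low : expR (- (r n / (1 - c / n%:R))) @[n --> \oo] --> expR (- c).
  apply: (@continuous_cvg _ _ _ _ _ (fun n => - (r n / (1 - c / n%:R))) expR).
    exact: continuous_expR.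
  rewrite -[X in - X](divr1 c); apply: cvgN; apply: cvgM => //.
  by apply: cvgV => //; exact: oner_neq0.
apply: squeeze_cvgr low up; near=> n.
have n0 : (0 < n)%N by near: n; exact: nbhs_infty_ge.
have n2 : (2 + i <= n)%N by near: n; exact: nbhs_infty_ge.
have nR : 0 < n%:R :> R by rewrite ltr0n.
have pn1 : c / n%:R < 1.
  rewrite ltr_pdivrMr // mul1r.
  have : c + 1 <= n%:R by near: n; exact: nbhs_infty_ger.
  by apply: lt_le_trans; rewrite ltrDl.
have pn0 : 0 < c / n%:R by rewrite divr_gt0.
have q0 : 0 < 1 - c / n%:R by rewrite subr_gt0.
have rE : r n = (n - 2 - i)%:R * (c / n%:R).
  rewrite /r -subnDA natrB // mulrBl; congr (_ - _).
  by rewrite mulrCA divff ?mulr1 // gt_eqF.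
apply/andP; split.
  rewrite rE -mulrA -mulrN expRM_natl lerXn2r ?nnegrE ?expR_ge0 ?(ltW q0) //.
  rewrite expRN -[leRHS]invrK lef_pV2 ?posrE ?expR_gt0 ?invr_gt0 //.
  apply: le_trans (expR_ge1Dx _); move: (c / n%:R) q0 => p q0.
  have -> : 1 + p / (1 - p) = (1 - p)^-1 by field; exact: lt0r_neq0.
  exact: lexx.
rewrite rE -[X in expR X]mulrN expRM_natl lerXn2r ?nnegrE ?expR_ge0 ?(ltW q0) //.
exact: expR_ge1Dx.
Unshelve. all: by end_near.
Qed.

(** Up to [u!], the expression is eventually a product of [u] factors, one for each vertex, each
    tending to [c exp(- c)]. *)
Lemma size_prob_cvg c u : 0 < c ->
  size_prob (c / n%:R) n u @[n --> \oo] --> (c * expR (- c)) ^+ u / u`!%:R.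
Proof.
move=> c0; have pn := cvg_pn c.
have fu : u`!%:R != 0 :> R by rewrite pnatr_eq0 -lt0n fact_gt0.
have fac (i : nat) : ((n - i)%:R * (c / n%:R)) * (1 - c / n%:R) ^+ (n - 2 - i)
    @[n --> \oo] --> c * expR (- c).
  apply: cvgM; last exact: cvg_pow.
  have : (c - i%:R * (c / n%:R) : R) @[n --> \oo] --> c.
    rewrite -[X in _ --> X]subr0 -[X in _ - X](mulr0 i%:R).
    by apply: cvgB; [exact: cvg_cst|apply: cvgMr].
  apply: cvg_trans; apply: near_eq_cvg; near=> n.
  have n0 : (0 < n)%N by near: n; exact: nbhs_infty_ge.
  have ni : (i <= n)%N by near: n; exact: nbhs_infty_ge.
  rewrite natrB // mulrBl; congr (_ - _).
  by rewrite mulrCA divff ?mulr1 // pnatr_eq0 -lt0n.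
have prodc : \prod_(i < u) (((n - i)%:R * (c / n%:R)) * (1 - c / n%:R) ^+ (n - 2 - i))
    @[n --> \oo] --> (c * expR (- c)) ^+ u.
  have -> : (c * expR (- c)) ^+ u = \prod_(i < u) (c * expR (- c)).
    by rewrite prodr_const card_ord.
  apply: cvg_big; first exact: (@mul_continuous R).
  by move=> i _; exact: fac.
apply: (@cvg_trans _ ((fun n => \prod_(i < u) (((n - i)%:R * (c / n%:R)) *
    (1 - c / n%:R) ^+ (n - 2 - i)) * u`!%:R^-1) @ \oo)); last exact: cvgMr_tmp prodc.
apply: near_eq_cvg; near=> n.
have n2 : (u < n)%N by near: n; exact: nbhs_infty_ge.
rewrite /size_prob !big_split /= -bin_prod prodr_const card_ord -expr_sum.
(* One of the [n - 1 - i] slots counted for each vertex goes to an edge, as there are [u] edges on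
   [u] vertices. *)
have -> : ('C(n, 2) - 'C(n - u, 2) - u = \sum_(i < u) (n - 2 - i))%N.
  rewrite sub_bin2; last exact: ltnW.
  rewrite (eq_bigr (fun i : 'I_u => (n - 2 - i) + 1)%N); last by move=> i _; have := ltn_ord i; lia.
  by rewrite big_split /= sum1_card card_ord addnK.
rewrite prodr_const card_ord -exprMn; move: ((1 - _) ^+ _) (_ ^+ u) => x y; field.
Unshelve. all: by end_near.
Qed.

End Analysis.

(* Tannery's theorem. *)
Lemma dominated_sums_cvg (R : realType) (b : nat -> nat -> R) (l M a : nat -> R) (B : R) (N : nat) :
  (forall u, b n u @[n --> \oo] --> l u) ->
  (forall U, \sum_(0 <= u < U) M u <= B) ->
  (forall n u, (N <= n)%N -> (u <= n)%N -> `|b n u * a u| <= M u) ->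
  cvgn (fun n => \sum_(u < n.+1) b n u * a u).
Proof.
move=> bl MB bM.
have M0 u : 0 <= M u.
  by apply: le_trans (bM (N + u)%N u (leq_addr _ _) (leq_addl _ _)); exact: normr_ge0.
have lM u : `|l u * a u| <= M u.
  have c1 : `|b n u * a u| @[n --> \oo] --> `|l u * a u|.
    by apply: cvg_norm; apply: cvgMr_tmp; exact: bl.
  have <- := cvg_lim (@Rhausdorff R) c1; apply: limr_le; first by apply/cvg_ex; exists `|l u * a u|.
  near=> n; apply: bM; near: n; exact: nbhs_infty_ge.
have Mnd : {homo series M : n m / (n <= m)%N >-> n <= m}.
  by apply: nondecreasing_series => u _ _; exact: M0.
have Mc : cvgn (series M).
  apply/cvg_ex; eexists; apply: nondecreasing_cvgn => //.
  by exists B => _ [U _ <-]; exact: MB.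
have lc : cvgn (series (fun u => l u * a u)).
  apply: normed_cvg; apply: series_le_cvg Mc => // u; exact: normr_ge0.
apply/cvg_ex; exists (limn (series (fun u => l u * a u))).
apply/cvgrPdist_lt => eps e0; have e3 : 0 < eps / 3 by lra.
have [U [hU1 hU2]] : exists U, `|limn (series M) - series M U| < eps / 3 /\
    `|limn (series (fun u => l u * a u)) - series (fun u => l u * a u) U| < eps / 3.
  have /cvgrPdist_lt/(_ _ e3) h1 := Mc.
  have /cvgrPdist_lt/(_ _ e3) h2 := lc.
  have [U _ hU] := filterI h1 h2.
  by exists U; have [] := hU U (leqnn U).
have hfin : \sum_(0 <= u < U) b n u * a u @[n --> \oo] --> \sum_(0 <= u < U) l u * a u.
  apply: cvg_big; first exact: add_continuous.
  by move=> u _; apply: cvgMr_tmp; exact: bl.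
have /cvgrPdist_lt/(_ _ e3) h3 := hfin.
near=> n.
have nU : (U <= n)%N by near: n; exact: nbhs_infty_ge.
have nN : (N <= n)%N by near: n; exact: nbhs_infty_ge.
have h3n : `|\sum_(0 <= u < U) l u * a u - \sum_(0 <= u < U) b n u * a u| < eps / 3.
  by near: n.
rewrite -(big_mkord xpredT (fun u => b n u * a u)).
rewrite (@big_cat_nat _ _ _ U) //=; last exact: leqW.
have tail : `|\sum_(U <= u < n.+1) b n u * a u| < eps / 3.
  apply: (le_lt_trans (ler_norm_sum _ _ _)).
  apply: (@le_lt_trans _ _ (\sum_(U <= u < n.+1) M u)).
    rewrite big_nat_cond [leRHS]big_nat_cond; apply: ler_sum => u /andP[/andP[_ un] _].
    by apply: bM => //; rewrite -ltnS.
  have -> : \sum_(U <= u < n.+1) M u = series M n.+1 - series M U.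
    rewrite /series /= (@big_cat_nat _ _ _ U 0 n.+1) //=; last exact: leqW.
    by rewrite [RHS]addrC addKr.
  apply: le_lt_trans hU1; apply: le_trans (ler_norm _); rewrite lerD2r.
  exact: nondecreasing_cvgn_le.
set s := limn _ in hU2 *; set sU := series _ U in hU2.
rewrite (_ : s - _ = (s - sU) + (sU - \sum_(0 <= u < U) b n u * a u)
  - \sum_(U <= u < n.+1) b n u * a u); last by ring.
have t1 : `|sU - \sum_(0 <= u < U) b n u * a u| < eps / 3 by exact: h3n.
apply: (le_lt_trans (ler_normB _ _)); apply: (@lt_le_trans _ _ (eps / 3 + eps / 3 + eps / 3)).
  by apply: ltrD tail; apply: (le_lt_trans (ler_normD _ _)); exact: ltrD.
by lra.
Unshelve. all: by end_near.
Qed.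

Section Limit.
Variable R : realType.
Variable le : forall m k : nat, rel (Sigma m k).
Hypothesis hle : forall m k : nat, total_order (@le m k).
Variables (k : nat) (c : R).
Hypothesis c0 : 0 < c.
Let beta := spanning_total le k (family_weight R).

(* The bound is read off from [G(n, 1/n)], where the expectation on the left  *)
(* is at most the expected weight of the families of disjoint short cycles.   *)
Lemma spanning_total_summable : exists B, forall U,
  \sum_(0 <= u < U) beta u * (expR (- 1) ^+ u / u`!%:R) <= B.
Proof.
exists (expR (2 * (2 * max_depth k).+1%:R)) => U.
(* For [c = 1] the limits are exactly the dominating numbers [exp(- u) / u!], so their partial sums
   inherit the bound that is uniform in [n]. *)
have lim1 : \sum_(0 <= u < U) size_prob (1 / n%:R) n u * beta u @[n --> \oo] -->
    \sum_(0 <= u < U) (1 * expR (- 1)) ^+ u / u`!%:R * beta u.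
  apply: cvg_big; first exact: add_continuous.
  by move=> u _; apply: cvgMr_tmp; apply: size_prob_cvg.
rewrite (eq_bigr (fun u => (1 * expR (- 1)) ^+ u / u`!%:R * beta u)); last first.
  by move=> u _; rewrite mul1r mulrC.
rewrite -(cvg_lim (@Rhausdorff R) lim1); apply: limr_le; first by apply/cvg_ex; eexists; exact: lim1.
near=> n; have nU : (U <= n)%N by near: n; exact: nbhs_infty_ge.
have n0 : (0 < n)%N by near: n; exact: nbhs_infty_ge.
have p0 : 0 <= 1 / n%:R :> R by rewrite divr_ge0.
have p1 : 1 / n%:R <= 1 :> R by rewrite ler_pdivrMr ?ltr0n // mul1r ler1n.
apply: le_trans (family_weight_expR le k R n0).
rewrite expect_by_size //; last exact: family_weight_invariant.
rewrite -(big_mkord xpredT (fun u => 'C(n, u)%:R *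
  (n%:R^-1 ^+ u * (1 - n%:R^-1) ^+ ('C(n, 2) - 'C(n - u, 2) - u)) * beta u)).
rewrite (@big_cat_nat _ _ _ U 0 n.+1) //=; last exact: leqW.
rewrite -[leLHS]addr0 lerD //; first by rewrite /size_prob mul1r.
apply: sumr_ge0 => u _; rewrite mulr_ge0 ?spanning_total_ge0 //.
by rewrite -[n%:R^-1]mul1r -/(size_prob _ _ _); exact: size_prob_ge0.
Unshelve. all: by end_near.
Qed.

Lemma completion_prob_cvg (i : completion_index le k) :
  cvgn (fun n => gnp_prob n (c / n%:R) (completion i)).
Proof.
have [B hB] := spanning_total_summable.
pose a := spanning_total le k (moebius R (fun q => val i q)).
rewrite (_ : (fun n => _) = fun n => \sum_(u < n.+1) size_prob (c / n%:R) n u * a u); last first.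
  by apply/funext => n; rewrite gnp_prob_completion.
(* From [N] on, [c / n <= 1/2], as [size_prob_le] demands; and [u <= n] gives [3 p u <= 3 c], whence
   the constant [exp(3 c)]. *)
pose N := (Num.bound (2 * c)).+1.
apply: (@dominated_sums_cvg R (fun n => size_prob (c / n%:R) n)
  (fun u => (c * expR (- c)) ^+ u / u`!%:R)
  (fun u => expR (3 * c) * (beta u * (expR (- 1) ^+ u / u`!%:R))) a (expR (3 * c) * B) N).
- by move=> u; exact: size_prob_cvg.
- by move=> U; rewrite -mulr_sumr ler_wpM2l ?expR_ge0.
move=> n u nN un; have nR : 2 * c < n%:R.
  apply: (@lt_le_trans _ _ (Num.bound (2 * c))%:R).
    by rewrite archi_boundP // mulr_ge0 // ltW.
  by rewrite ler_nat; exact: leq_trans nN.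
have n0 : 0 < n%:R :> R by apply: le_lt_trans nR; rewrite mulr_ge0 // ltW.
have p0 : 0 <= c / n%:R by rewrite divr_ge0 // ltW.
have p2 : c / n%:R <= 2^-1 by rewrite ler_pdivrMr // ler_pdivlMl //; exact: ltW.
rewrite normrM ger0_norm; last by apply: size_prob_ge0 => //; lra.
rewrite (mulrC (beta u)) mulrA; apply: ler_pM; rewrite ?normr_ge0 //.
- by apply: size_prob_ge0 => //; lra.
- apply: (le_trans (size_prob_le p0 p2 un)).
  rewrite ler_wpM2r ?divr_ge0 ?exprn_ge0 ?expR_ge0 // ler_expR.
  rewrite -mulrnAr ler_wpM2l // -mulr_natr mulrAC ler_pdivrMr //.
  by rewrite ler_wpM2l ?ler_nat // ltW.
- exact: spanning_total_norm.
Qed.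

Lemma completion_prob_total n (p : R) :
  \sum_(i : completion_index le k) gnp_prob n p (completion i) = 1.
Proof.
rewrite /gnp_prob; under eq_bigr do rewrite big_mkcondr /=.
rewrite exchange_big /= -[RHS](bernoulli_total (edge_slots n) p).
apply: eq_bigr => E _; have [i0 hi0] := completion_ex hle k (graph_of E).
rewrite (bigD1 i0) //= asboolT // big1 ?addr0 // => i /eqP ii0.
by case: ifPn => // /asboolP hi; case: ii0; exact: completion_uniq hi hi0.
Qed.

Lemma gnp_prob_ge0 n (p : R) A : 0 <= p -> p <= 1 -> 0 <= gnp_prob n p A.
Proof.
by move=> p0 p1; apply: sumr_ge0 => E _; rewrite mulr_ge0 ?exprn_ge0 ?subr_ge0.
Qed.

(** The index set is finite, so the sum of the limits is the limit of a sum that is constantly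
    one. *)
Lemma completion_limits_total :
  \esum_(i in [set: completion_index le k])
    (limn (fun n => gnp_prob n (c / n%:R) (completion i)))%:E = 1%:E.
Proof.
have lim0 i : 0 <= limn (fun n => gnp_prob n (c / n%:R) (@completion le k i)).
  apply: limr_ge; first exact: completion_prob_cvg.
  near=> n; have nc : c <= n%:R by near: n; exact: nbhs_infty_ger.
  have n0 : 0 < n%:R :> R by exact: lt_le_trans nc.
  by apply: gnp_prob_ge0; [rewrite divr_ge0 // ltW|rewrite ler_pdivrMr // mul1r].
rewrite esum_fset; [|exact: finite_finset|by move=> i _; rewrite lee_fin].
rewrite (_ : [set: _] = [set` index_enum (completion_index le k)]); last first.
  by apply/seteqP; split => // i _ /=; rewrite mem_index_enum.
rewrite -fsbig_seq ?index_enum_uniq // sumEFin; congr (_%:E).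
have tot : \sum_(i : completion_index le k) gnp_prob n (c / n%:R) (completion i) @[n --> \oo] -->
    \sum_(i : completion_index le k) limn (fun n => gnp_prob n (c / n%:R) (completion i)).
  by apply: cvg_big; [exact: add_continuous|move=> i _; exact: completion_prob_cvg].
rewrite -(cvg_lim (@Rhausdorff R) tot); under eq_fun do rewrite completion_prob_total.
exact: lim_cst.
Unshelve. all: by end_near.
Qed.

End Limit.

Local Close Scope classical_set_scope.

Theorem theorem1p3 (R : realType) (c : R) (hc : 0 < c)
    (le : forall m k : nat, rel (Sigma m k))
    (hle : forall m k : nat, total_order (le m k))
    (k : nat) (hk : (0 < k)%N) :
  complete_set_of_completions (fun n : nat => c / n%:R) k sparse_theory
    (@completion le k).
Proof.
split.
- by move=> i; exact: completion_not_entailed.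
- by move=> i; exact: completion_k_complete.
- by move=> i j ij G _ [Ai Aj]; apply: ij; exact: completion_uniq Ai Aj.
by split=> [i|]; [exact: completion_prob_cvg|exact: completion_limits_total].
Qed.
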